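(* Let $((\mathfrak g,\mu),\rho,T)$ be a relative Rota-Baxter Lie algebra with $\rho:\mathfrak g\to\mathfrak{gl}(V)$, $T:V\to\mathfrak g$, and put $\pi=\mu+\rho$. Then the $L_\infty$-algebra $\big(s^{-1}L'\oplus\mathfrak h,\{l_k^{(s^{-1}\pi,T)}\}_{k=1}^{+\infty}\big)$ is a strict extension of the $L_\infty$-algebra $\bigoplus_{k=0}^{+\infty}s^{-1}C^{k|0}(\mathfrak g\oplus V,\mathfrak g\oplus V)$ by the $L_\infty$-algebra $\bigoplus_{k=1}^{+\infty}\mathrm{Hom}(\wedge^kV,\mathfrak g)$; that is, there is the following short exact sequence of $L_\infty$-algebras: $$0\longrightarrow\bigoplus_{k=1}^{+\infty}\mathrm{Hom}(\wedge^kV,\mathfrak g)\stackrel{\iota}{\longrightarrow}s^{-1}L'\oplus\mathfrak h\stackrel{p}{\longrightarrow}\bigoplus_{k=0}^{+\infty}s^{-1}C^{k|0}(\mathfrak g\oplus V,\mathfrak g\oplus V)\longrightarrow0,$$ where $\iota(\theta)=(0,\theta)$ and $p(s^{-1}f,\theta)=s^{-1}f$.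
   Context: $\mathbf K$ is a field of characteristic $0$. $\mathbb S_{(i,j)}$ denotes the set of $(i,j)$-shuffles, $\varepsilon(\sigma)$ the Koszul sign. The desuspension is $(s^{-1}E)^i=E^{i+1}$. Relative Rota-Baxter Lie algebra: a triple $((\mathfrak g,[\cdot,\cdot]_{\mathfrak g}),\rho,T)$ with $(\mathfrak g,[\cdot,\cdot]_{\mathfrak g})$ a Lie algebra (also written $(\mathfrak g,\mu)$ with $\mu=[\cdot,\cdot]_{\mathfrak g}$), $\rho:\mathfrak g\to\mathfrak{gl}(V)$ a representation on a vector space $V$, and $T:V\to\mathfrak g$ linear with $[Tu,Tv]_{\mathfrak g}=T(\rho(Tu)(v)-\rho(Tv)(u))$ for all $u,v\in V$ (then $T$ is called a relative Rota-Baxter operator). Nijenhuis-Richardson bracket and bidegree: put $C^n(\mathfrak g\oplus V,\mathfrak g\oplus V)=\mathrm{Hom}(\wedge^{n+1}(\mathfrak g\oplus V),\mathfrak g\oplus V)$ (degree $n\ge0$) and $L=\bigoplus_{n\ge0}C^n(\mathfrak g\oplus V,\mathfrak g\oplus V)$. For $P,Q$ of degrees $p,q$, $[P,Q]_{NR}=P\bar\circ Q-(-1)^{pq}Q\bar\circ P$ with $(P\bar\circ Q)(x_1,\dots,x_{p+q+1})=\sum_{\sigma\in\mathbb S_{(q+1,p)}}(-1)^\sigma P(Q(x_{\sigma(1)},\dots,x_{\sigma(q+1)}),x_{\sigma(q+2)},\dots,x_{\sigma(p+q+1)})$; this makes $L$ a graded Lie algebra. A map $f\in\mathrm{Hom}(\wedge^{k+l+1}(\mathfrak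 g\oplus V),\mathfrak g\oplus V)$ has bidegree $k|l$ if $f$ maps $\wedge^{k+1}\mathfrak g\otimes\wedge^lV$ to $\mathfrak g$, maps $\wedge^k\mathfrak g\otimes\wedge^{l+1}V$ to $V$, and vanishes on all other $\wedge^a\mathfrak g\otimes\wedge^bV$; the space of these is $C^{k|l}=C^{k|l}(\mathfrak g\oplus V,\mathfrak g\oplus V)$. Multilinear maps $f:\wedge^k\mathfrak g\otimes\wedge^lV\to\mathfrak g$ (or $\to V$) are regarded as elements of $C^{k+l-1}$ via the lift $\hat f((x_1,v_1),\dots,(x_{k+l},v_{k+l}))=\sum_{\tau\in\mathbb S_{(k,l)}}(-1)^\tau f(x_{\tau(1)},\dots,x_{\tau(k)},v_{\tau(k+1)},\dots,v_{\tau(k+l)})$, placed in the summand $\mathfrak g$ (respectively $V$). Thus $C^{k|0}\cong\mathrm{Hom}(\wedge^{k+1}\mathfrak g,\mathfrak g)\oplus\mathrm{Hom}(\wedge^k\mathfrak g\otimes V,V)$ and $C^{-1|l}\cong\mathrm{Hom}(\wedge^lV,\mathfrak g)$; in particular $\pi=\mu+\rho\in C^{1|0}$. $L_\infty$-algebra: a $\mathbb Z$-graded vector space $E$ with degree $1$ graded symmetric maps $l_k:\otimes^kE\to E$ ($k\ge1$) with $\sum_{i=1}^n\sum_{\sigma\in\mathbb S_{(i,n-i)}}\varepsilon(\sigma)l_{n-i+1}(l_i(x_{\sigma(1)},\dots,x_{\sigma(i)}),x_{\sigma(i+1)},\dots,x_{\sigma(n)})=0$ for all $n\ge1$ and homogeneous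 $x_1,\dots,x_n$. A strict morphism is a degree $0$ linear map commuting with all $l_k$; the extension is strict in the sense that $\iota$ and $p$ are strict morphisms. The twisting by a Maurer-Cartan element $\alpha$ (i.e. $\alpha\in E^0$ with $\sum_{k\ge1}\frac1{k!}l_k(\alpha,\dots,\alpha)=0$) has operations $l_k^\alpha(x_1,\dots,x_k)=\sum_{n\ge0}\frac1{n!}l_{k+n}(\underbrace{\alpha,\dots,\alpha}_n,x_1,\dots,x_k)$. The middle term: $L'=\bigoplus_{n\ge0}C^{n|0}$, with $C^{n|0}$ in degree $n$; $\mathfrak h=\bigoplus_{n\ge0}C^{-1|(n+1)}=\bigoplus_{n\ge0}\mathrm{Hom}(\wedge^{n+1}V,\mathfrak g)$ with $\mathrm{Hom}(\wedge^{n+1}V,\mathfrak g)$ in degree $n$; $P:L\to L$ is the projection onto $\mathfrak h$ (along the other bidegree components). The untwisted $L_\infty$-operations on $s^{-1}L'\oplus\mathfrak h$ are $l_2(s^{-1}Q,s^{-1}Q')=(-1)^{Q}s^{-1}[Q,Q']_{NR}$ and, for $k\ge2$, $l_k(s^{-1}Q,\theta_1,\dots,\theta_{k-1})=P[\cdots[[Q,\theta_1]_{NR},\theta_2]_{NR},\cdots,\theta_{k-1}]_{NR}$ for homogeneous $Q,Q'\in L'$, $\theta_i\in\mathfrak h$; all operations not obtained from these by permuting arguments (with Koszul signs) vanish. The element $(s^{-1}\pi,T)$ is a Maurer-Cartan element of this $L_\infty$-algebra, and $l_k^{(s^{-1}\pi,T)}$ are the operations twisted by it. The outer terms: every dg Lie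 algebra $(E,[\cdot,\cdot],d)$ is viewed as an $L_\infty$-algebra on $s^{-1}E$ with $l_1(s^{-1}x)=s^{-1}d(x)$, $l_2(s^{-1}x,s^{-1}y)=(-1)^{x}s^{-1}[x,y]$ for homogeneous $x,y$, and $l_k=0$ for $k\ge3$. (1) The $L_\infty$-algebra $\bigoplus_{k\ge0}s^{-1}C^{k|0}(\mathfrak g\oplus V,\mathfrak g\oplus V)$ is obtained in this way from the dg Lie algebra $(\bigoplus_{k\ge0}C^{k|0},[\cdot,\cdot]_{NR},d_\pi=[\pi,\cdot]_{NR})$, which controls deformations of the pair consisting of the Lie algebra $(\mathfrak g,\mu)$ and its representation $\rho$. (2) The $L_\infty$-algebra $\bigoplus_{k\ge1}\mathrm{Hom}(\wedge^kV,\mathfrak g)$ is obtained in this way from the dg Lie algebra $(\bigoplus_{k\ge1}\mathrm{Hom}(\wedge^kV,\mathfrak g),[\![\cdot,\cdot]\!],d_T=[\![T,\cdot]\!])$, in which $\mathrm{Hom}(\wedge^kV,\mathfrak g)$ has degree $k$ and $[\![\theta,\phi]\!]=(-1)^{n-1}[[\mu+\rho,\theta]_{NR},\phi]_{NR}$ for $\theta\in\mathrm{Hom}(\wedge^nV,\mathfrak g)$, $\phi\in\mathrm{Hom}(\wedge^mV,\mathfrak g)$; it controls deformations of the relative Rota-Baxter operator $T$. After desuspension $\mathrm{Hom}(\wedge^kV,\mathfrak g)$ sits in degree $k-1$, and the symbol $s^{-1}$ is suppressed in the notation.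
   Formalization: As stated, ι and p fail to be strict by signs. Proved instead: (1) ι, p as given, with outer differential -d_π and outer bracket -⟦·,·⟧; (2) all three L∞-algebras as given, with ι(θ)=(0,-θ) and p(s^{-1}f,θ)=(-1)^{|f|}s^{-1}f. *)

(* Defs.v *)
From HB Require Import structures.
From mathcomp Require Import all_boot all_order all_algebra all_fingroup.
From mathcomp Require Import boolp classical_sets functions cardinality fsbigop.

Set Implicit Arguments.
Unset Strict Implicit.
Unset Printing Implicit Defensive.

Import Order.TTheory GRing.Theory Num.Theory.

Local Open Scope classical_set_scope.
Local Open Scope ring_scope.

(* s is an (i, n - i)-shuffle: s(0) < ... < s(i-1) and s(i) < ... < s(n-1). *)
Definition shuffle (n i : nat) (s : 'S_n) : bool :=
  [forall a : 'I_n, forall b : 'I_n,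
     ((a < b)%N && ((b < i)%N || (i <= a)%N)) ==> (s a < s b)%N].

Definition permuted (X : Type) (n : nat) (x : n.-tuple X) (s : 'S_n) : seq X :=
  [seq tnth x (s i) | i <- enum 'I_n].

Definition koszul (K : fieldType) (n : nat) (d : 'I_n -> int) (s : 'S_n) : K :=
  \prod_(i < n) \prod_(j < n | (i < j)%N && (s j < s i)%N)
     (-1) ^ (d (s i) * d (s j)).

(* A Z-graded vector space is the family of its homogeneous components, given
   as linear subspaces [gv_deg i] of one ambient module; elements of the ambient
   module outside these subspaces play no role. *)
Record gvspace (K : fieldType) := GVSpace {
  gv_amb :> lmodType K;
  gv_deg : int -> set gv_amb;
  gv_deg0 : forall i, gv_deg i 0;
  gv_degL : forall i (a : K) x y,
    gv_deg i x -> gv_deg i y -> gv_deg i (a *: x + y)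
}.

(* (s^{-1}E)^i = E^{i+1}; the symbol s^{-1} is the identity on elements. *)
Definition desusp (K : fieldType) (E : gvspace K) : gvspace K :=
  @GVSpace K E (fun i => @gv_deg K E (i + 1))
    (fun i => @gv_deg0 K E (i + 1)) (fun i => @gv_degL K E (i + 1)).

Section DirectSum.
Variables (K : fieldType) (E F : gvspace K).

Definition gsum_deg (i : int) : set (E * F)%type :=
  [set x | @gv_deg K E i x.1 /\ @gv_deg K F i x.2].

Lemma gsum_deg0 i : gsum_deg i 0.
Proof. by split; apply: gv_deg0. Qed.

Lemma gsum_degL i (a : K) x y :
  gsum_deg i x -> gsum_deg i y -> gsum_deg i (a *: x + y).
Proof. by move=> [x1 x2] [y1 y2]; split; apply: gv_degL. Qed.

Definition gsum : gvspace K :=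
  @GVSpace K (E * F)%type gsum_deg gsum_deg0 gsum_degL.
End DirectSum.

Section Truncation.
Variables (K : fieldType) (A : lmodType K) (m : int) (X : int -> set A).
Hypothesis X0 : forall i, X i 0.
Hypothesis XL : forall i (a : K) x y, X i x -> X i y -> X i (a *: x + y).

Definition ge_deg (n : int) : set A := if m <= n then X n else [set 0].

Lemma ge_deg0 i : ge_deg i 0.
Proof. by rewrite /ge_deg; case: ifP. Qed.

Lemma ge_degL i (a : K) x y :
  ge_deg i x -> ge_deg i y -> ge_deg i (a *: x + y).
Proof.
rewrite /ge_deg; case: ifP => _; first exact: XL.
by move=> -> ->; rewrite /= scaler0 addr0.
Qed.

Definition gvspace_ge : gvspace K := @GVSpace K A ge_deg ge_deg0 ge_degL.
End Truncation.

(* A family of multilinear operations on a graded vector space is given on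
   words of homogeneous elements, each letter (d, x) carrying the degree d of x.
   The operation l_k is the restriction to words of length k >= 1; the value on
   the empty word is irrelevant. *)
Record higher_ops (K : fieldType) := HigherOps {
  ho_space :> gvspace K;
  ho_op : seq (int * ho_space) -> ho_space
}.

Section Linfty.
Variable K : fieldType.

Definition homog (E : gvspace K) (s : seq (int * E)) : Prop :=
  {in s, forall p, gv_deg p.1 p.2}.

Definition degree (E : gvspace K) (s : seq (int * E)) : int :=
  \sum_(p <- s) p.1.

Definition is_Linfty (E : higher_ops K) : Prop :=
  [/\ forall s : seq (int * E), s != [::] -> homog s ->
        gv_deg (degree s + 1) (ho_op s),
      forall (s1 s2 : seq (int * E)) (d : int) (a : K) (x y : E),
        homog s1 -> homog s2 -> gv_deg d x -> gv_deg d y ->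
        ho_op (s1 ++ (d, a *: x + y) :: s2) =
          a *: ho_op (s1 ++ (d, x) :: s2) + ho_op (s1 ++ (d, y) :: s2),
      forall (n : nat) (x : n.-tuple (int * E)) (s : 'S_n),
        (0 < n)%N -> homog x ->
        ho_op (permuted x s) = koszul K (fun i => (tnth x i).1) s *: ho_op x
    & forall (n : nat) (x : n.-tuple (int * E)), (0 < n)%N -> homog x ->
        \sum_(1 <= i < n.+1) \sum_(s : 'S_n | shuffle i s)
           koszul K (fun i => (tnth x i).1) s *:
           (let t := permuted x s in
            ho_op ((degree (take i t) + 1, ho_op (take i t)) :: drop i t)) = 0].

(* [f i] is the component of f on the degree i part of E. *)
Definition strict_morphism (E F : higher_ops K) (f : int -> E -> F) : Prop :=
  [/\ forall i (a : K) (x y : E), gv_deg i x -> gv_deg i y ->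
        f i (a *: x + y) = a *: f i x + f i y,
      forall i (x : E), gv_deg i x -> gv_deg i (f i x)
    & forall s : seq (int * E), s != [::] -> homog s ->
        f (degree s + 1) (ho_op s) = ho_op [seq (p.1, f p.1 p.2) | p <- s]].

Definition strict_extension (A E B : higher_ops K)
    (iota : int -> A -> E) (p : int -> E -> B) : Prop :=
  [/\ [/\ is_Linfty A, is_Linfty E & is_Linfty B],
      strict_morphism iota,
      strict_morphism p
    & forall i,
      [/\ forall x y : A, gv_deg i x -> gv_deg i y ->
            iota i x = iota i y -> x = y,
          forall z : B, gv_deg i z -> exists2 x : E, gv_deg i x & p i x = z
        & forall x : E, gv_deg i x ->
            (p i x = 0 <-> exists2 y : A, gv_deg i y & iota i y = x)]].

(* alpha is an element of degree 0. The sum over n is the sum of a family of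
   finite support; the library's convention gives 0 otherwise. For [middle] the
   support is finite: bracketing f in C^{n|0} with theta_1, ..., theta_k in h
   gives an element of bidegree (n - k)|*, so only k = n + 1 contributes. *)
Definition twist (E : higher_ops K) (alpha : E) : higher_ops K :=
  @HigherOps K E (fun s =>
    \sum_(n \in [set: nat])
       (n`!%:R)^-1 *: ho_op (nseq n (0 : int, alpha) ++ s)).

(* The operations on s^{-1}E attached to a bracket and a differential on E. The
   letter (i, x) of degree i in s^{-1}E has degree i + 1 in E. *)
Definition dgLie_ops (E : gvspace K) (br : int * E -> int * E -> E)
    (d : int * E -> E) : higher_ops K :=
  @HigherOps K (desusp E) (fun s : seq (int * E) =>
    match s with
    | [:: x] => d (x.1 + 1, x.2)
    | [:: x; y] => (-1) ^ (x.1 + 1) *: br (x.1 + 1, x.2) (y.1 + 1, y.2)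
    | _ => 0
    end).

End Linfty.

(* Hom(/\^m A, B). An alternating map of m arguments is encoded as a function
   on lists that vanishes on all lists of length different from m. *)
Definition alt_map (K : fieldType) (A B : lmodType K) (m : int) :
    set (seq A -> B) :=
  [set f | [/\ forall s, (size s)%:Z != m -> f s = 0,
               forall s1 s2 (a : K) x y,
                 f (s1 ++ (a *: x + y) :: s2) =
                   a *: f (s1 ++ x :: s2) + f (s1 ++ y :: s2)
             & forall s, ~~ uniq s -> f s = 0]].

Lemma alt_map0 (K : fieldType) (A B : lmodType K) (m : int) :
  @alt_map K A B m 0.
Proof. by split=> // *; rewrite scaler0 addr0. Qed.

Lemma alt_mapL (K : fieldType) (A B : lmodType K) (m : int) (a : K)
    (f h : seq A -> B) :
  alt_map m f -> alt_map m h -> alt_map m (a *: f + h).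
Proof.
move=> [f1 f2 f3] [h1 h2 h3]; split=> [s sm|s1 s2 b x y|s us].
- by rewrite !fctE f1 // h1 // scaler0 addr0.
- rewrite !fctE f2 h2 !scalerDr !scalerA mulrC -!addrA; congr (_ + _).
  by rewrite addrCA.
- by rewrite !fctE f3 // h3 // scaler0 addr0.
Qed.

Section RelRB.
Variables (K : fieldType) (g V : lmodType K).

Definition lie_bracket (mu : g -> g -> g) : Prop :=
  [/\ forall (a : K) x y z, mu (a *: x + y) z = a *: mu x z + mu y z,
      forall (a : K) x y z, mu x (a *: y + z) = a *: mu x y + mu x z,
      forall x, mu x x = 0
    & forall x y z, mu x (mu y z) + mu y (mu z x) + mu z (mu x y) = 0].

Definition lie_representation (mu : g -> g -> g) (rho : g -> V -> V) : Prop :=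
  [/\ forall (a : K) x y v, rho (a *: x + y) v = a *: rho x v + rho y v,
      forall (a : K) x u v, rho x (a *: u + v) = a *: rho x u + rho x v
    & forall x y v, rho (mu x y) v = rho x (rho y v) - rho y (rho x v)].

Definition relative_rota_baxter (mu : g -> g -> g) (rho : g -> V -> V)
    (T : V -> g) : Prop :=
  (forall (a : K) u v, T (a *: u + v) = a *: T u + T v) /\
  forall u v, mu (T u) (T v) = T (rho (T u) v - rho (T v) u).

Definition relative_RB_Lie_algebra (mu : g -> g -> g) (rho : g -> V -> V)
    (T : V -> g) : Prop :=
  [/\ lie_bracket mu, lie_representation mu rho
    & relative_rota_baxter mu rho T].

End RelRB.

Section Cochains.
Variables (K : fieldType) (g V : lmodType K).

Local Notation W := (g * V)%type.
Local Notation cochains := (seq W -> W).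

Definition in_g (x : g) : W := (x, 0).
Definition in_V (v : V) : W := (0, v).

(* C^{k|l}. An alternating map is determined by its values on the lists having
   the arguments from g first, so only these are constrained. *)
Definition bidegree (k l : int) : set cochains :=
  [set f | alt_map (k + l + 1) f /\
     forall (xs : seq g) (vs : seq V),
       let y := f ([seq in_g x | x <- xs] ++ [seq in_V v | v <- vs]) in
       (((size xs)%:Z, (size vs)%:Z) != (k + 1, l) -> y.1 = 0) /\
       (((size xs)%:Z, (size vs)%:Z) != (k, l + 1) -> y.2 = 0)].

Lemma bidegree0 k l : bidegree k l 0.
Proof. by split; first exact: alt_map0. Qed.

Lemma bidegreeL k l (a : K) (f h : cochains) :
  bidegree k l f -> bidegree k l h -> bidegree k l (a *: f + h).
Proof.
move=> [f1 f2] [h1 h2]; split; first exact: alt_mapL.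
move=> xs vs y; have [fg fV] := f2 xs vs; have [hg hV] := h2 xs vs.
split=> sz; rewrite /y !fctE /=.
  by rewrite fg // hg // scaler0 addr0.
by rewrite fV // hV // scaler0 addr0.
Qed.

(* L' : C^{n|0} in degree n >= 0 *)
Definition Lprime : gvspace K :=
  gvspace_ge 0 (fun n => bidegree0 n 0) (fun n => @bidegreeL n 0).

(* h : Hom(/\^{n+1} V, g) in degree n >= 0 *)
Definition hspace : gvspace K :=
  gvspace_ge 0 (fun n => @alt_map0 K V g (n + 1))
               (fun n => @alt_mapL K V g (n + 1)).

(* Hom(/\^k V, g) in degree k >= 1 *)
Definition HomVg : gvspace K :=
  gvspace_ge 1 (fun k => @alt_map0 K V g k) (fun k => @alt_mapL K V g k).

(* The lift of f : /\^k g (x) /\^l V -> B, where j is the inclusion of the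
   summand B = g or B = V; f vanishes unless its arguments are a list of length
   k and a list of length l, so that l need not be specified. *)
Definition lift_map (B : lmodType K) (j : B -> W) (k : nat)
    (f : seq g -> seq V -> B) : cochains := fun s =>
  j (\sum_(t : 'S_(size s) | shuffle k t)
       let s' := permuted (in_tuple s) t in
       (-1) ^+ t *: f [seq w.1 | w <- take k s'] [seq w.2 | w <- drop k s']).

Definition lift_mu (mu : g -> g -> g) : cochains :=
  lift_map in_g 2 (fun xs vs =>
    match xs, vs with [:: x; y], [::] => mu x y | _, _ => 0 end).

Definition lift_rho (rho : g -> V -> V) : cochains :=
  lift_map in_V 1 (fun xs vs =>
    match xs, vs with [:: x], [:: v] => rho x v | _, _ => 0 end).

(* Hom(/\^l V, g) -> C^{-1|l} *)
Definition lift_h (theta : seq V -> g) : cochains :=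
  lift_map in_g 0 (fun _ vs => theta vs).

Definition one_cochain (T : V -> g) : seq V -> g := fun vs =>
  if vs is [:: v] then T v else 0.

(* P : L -> h, using C^{-1|l} = Hom(/\^l V, g). *)
Definition proj_h (f : cochains) : seq V -> g := fun vs =>
  (f [seq in_V v | v <- vs]).1.

Lemma proj_h_bidegree (k l : int) (f : cochains) :
  0 <= k -> bidegree k l f -> proj_h f = 0.
Proof.
move=> k0 [_ fb]; apply/funext => vs; have [/= fg _] := fb [::] vs.
rewrite /proj_h fg //; apply/eqP => -[k1 _].
by have := ltr_wpDl k0 (@ltr01 int); rewrite -k1.
Qed.

Lemma shuffle0 (n : nat) (t : 'S_n) : shuffle 0 t = (t == 1%g).
Proof.
apply/idP/eqP => [sh|->]; last first.
  by apply/forallP => a; apply/forallP => b; apply/implyP; rewrite !perm1 => /andP[].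
have lt_t (a b : 'I_n) : (a < b)%N -> (t a < t b)%N.
  by move=> ab; have /forallP/(_ a)/forallP/(_ b) := sh; rewrite ab.
have srt : sorted ltn [seq val i | i <- [seq t i | i <- enum 'I_n]].
  have := iota_ltn_sorted 0 n; rewrite -val_enum_ord -map_comp !sorted_map.
  by apply: sub_sorted => a b; exact: lt_t.
have eqs : [seq val i | i <- [seq t i | i <- enum 'I_n]] = iota 0 n.
  apply: (irr_sorted_eq ltn_trans ltnn srt (iota_ltn_sorted 0 n)) => i.
  rewrite -val_enum_ord; apply/mapP/mapP => -[j _ ->].
    by exists j; rewrite ?mem_enum.
  exists j => //; apply/mapP; exists ((t^-1)%g j); first by rewrite mem_enum.
  by rewrite permKV.
rewrite -val_enum_ord in eqs.
apply/permP => i; rewrite perm1.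
have /(congr1 (fun u => nth i u i)) := inj_map val_inj eqs.
by rewrite (nth_map i) ?size_enum_ord ?nth_ord_enum.
Qed.

Lemma permuted1 (X : Type) (n : nat) (x : n.-tuple X) : permuted x 1%g = x.
Proof.
rewrite -[RHS]map_tnth_enum /permuted; apply: eq_map => i.
by rewrite perm1.
Qed.

Lemma lift_hK (theta : seq V -> g) : proj_h (lift_h theta) = theta.
Proof.
apply/funext => vs; rewrite /proj_h /lift_h /lift_map /=.
rewrite (big_pred1 1%g) => [|t]; last exact: shuffle0.
by rewrite odd_perm1 expr0 scale1r drop0 permuted1 -map_comp map_id.
Qed.


(* P o Q for Q of degree i - 1 *)
Definition circ (i : nat) (P Q : cochains) : cochains := fun s =>
  \sum_(t : 'S_(size s) | shuffle i t)
     let s' := permuted (in_tuple s) t in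
     (-1) ^+ t *: P (Q (take i s') :: drop i s').

(* [P, Q]_NR for P in C^p and Q in C^q, given as (p, P) and (q, Q) *)
Definition NR (a b : int * cochains) : cochains :=
  circ (absz (b.1 + 1)) a.2 b.2 - (-1) ^ (a.1 * b.1) *: circ (absz (a.1 + 1)) b.2 a.2.

Definition NRd (a b : int * cochains) : int * cochains := (a.1 + b.1, NR a b).

Definition middle_space : gvspace K := gsum (desusp Lprime) hspace.

(* The multilinear extension to arguments (s^{-1}Q_j, theta_j) of degree d_j:
   Q_j has degree d_j + 1 in L, theta_j has degree d_j in L, and the sign in the
   second component is the Koszul sign of moving s^{-1}Q_j to the front. *)
Definition middle_op (s : seq (int * (cochains * (seq V -> g)))) :
    cochains * (seq V -> g) :=
  (if s is [:: x; y] then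
     (-1) ^ (x.1 + 1) *: NR (x.1 + 1, x.2.1) (y.1 + 1, y.2.1)
   else 0,
   if (2 <= size s)%N then
     \sum_(j < size s)
        let x := nth (0, 0) s j in
        (-1) ^ (x.1 * \sum_(y <- take j s) y.1) *:
        proj_h (foldl NRd (x.1 + 1, x.2.1)
          [seq (y.1, lift_h y.2.2) | y <- take j s ++ drop j.+1 s]).2
   else 0).

Definition middle : higher_ops K := @HigherOps K middle_space middle_op.

Definition pi_cochain (mu : g -> g -> g) (rho : g -> V -> V) : cochains :=
  lift_mu mu + lift_rho rho.

Definition twisted_middle (mu : g -> g -> g) (rho : g -> V -> V)
    (T : V -> g) : higher_ops K :=
  twist (E := middle) (pi_cochain mu rho, one_cochain T).

Definition d_pi (mu : g -> g -> g) (rho : g -> V -> V) (a : int * cochains) :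
    cochains :=
  NR (1, pi_cochain mu rho) a.

(* [[theta, phi]] for theta in Hom(/\^n V, g) and phi in Hom(/\^m V, g), given
   as (n, theta) and (m, phi); they have degrees n - 1 and m - 1 in L. *)
Definition RB_bracket (mu : g -> g -> g) (rho : g -> V -> V)
    (a b : int * (seq V -> g)) : seq V -> g :=
  (-1) ^ (a.1 - 1) *:
  proj_h (NR (NRd (1, pi_cochain mu rho) (a.1 - 1, lift_h a.2))
             (b.1 - 1, lift_h b.2)).

Definition d_T (mu : g -> g -> g) (rho : g -> V -> V) (T : V -> g)
    (a : int * (seq V -> g)) : seq V -> g :=
  RB_bracket mu rho (1, one_cochain T) a.

Definition pair_ops (mu : g -> g -> g) (rho : g -> V -> V) : higher_ops K :=
  dgLie_ops (E := Lprime) NR (d_pi mu rho).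

Definition RB_ops (mu : g -> g -> g) (rho : g -> V -> V) (T : V -> g) :
    higher_ops K :=
  dgLie_ops (E := HomVg) (RB_bracket mu rho) (d_T mu rho T).

(* [pair_ops] with the differential - d_pi; the two dg Lie algebras are isomorphic
   by f |-> (-1)^|f| f. The twisted differential is
   l_2(s^{-1}pi, s^{-1}f) = (-1)^|pi| s^{-1}[pi, f] = - s^{-1}(d_pi f) in the
   first component, so this is the structure for which the projection
   (s^{-1}f, theta) |-> s^{-1}f is a strict morphism. *)
Definition pair_ops_opp (mu : g -> g -> g) (rho : g -> V -> V) :
    higher_ops K :=
  dgLie_ops (E := Lprime) NR (fun a => - d_pi mu rho a).

(* [RB_ops] with the bracket - [[.,.]] (and the differential d_T unchanged); the
   two dg Lie algebras are isomorphic by theta |-> - theta. On Hom(/\^n V, g) one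
   has (-1)^n [[theta, phi]] = - [[pi, theta], phi], whereas the twisted l_2 is
   + [[pi, theta], phi], so this is the structure for which the inclusion
   theta |-> (0, theta) is a strict morphism. *)
Definition RB_ops_opp (mu : g -> g -> g) (rho : g -> V -> V) (T : V -> g) :
    higher_ops K :=
  dgLie_ops (E := HomVg) (fun a b => - RB_bracket mu rho a b) (d_T mu rho T).

End Cochains.

(* Main.v *)
(* Write pi = mu + rho. Voronov's higher derived brackets make s^{-1}L' (+) h an
   L-infinity algebra because h is an abelian subalgebra of L and the kernel of P
   (the cochains preserving V) is a subalgebra, whence
   P[a, b] = P[Pa, b] + P[a, Pb]; iterating this together with the Leibniz rule
   expresses P[..[[Q, Q'], t_1], .., t_n] through nested brackets, which is the
   generalised Jacobi identity. Twisting by (s^{-1}pi, T) is possible since the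
   Maurer-Cartan equation amounts to [pi, pi] = 0 and P[[pi, T], T] = 0. By the
   first component k of the bidegree k|l, P[..[Q, t_1], .., t_m] vanishes for Q
   of degree n unless m = n + 1; hence only one summand of each twisted operation
   survives on h and in the quotient, and the twisted operations restrict to the
   two dg Lie algebras. These inherit the L-infinity identities along the
   injection and the surjection.

   Sums over shuffles are rewritten as a recursion over the word, under which
   splitting words is coassociative and graded cocommutative; the pre-Lie identity
   of the Nijenhuis-Richardson product, the Jacobi identities and the twisting
   procedure are consequences of these two facts. *)
Require Import Defs.
From mathcomp Require Import all_boot all_order all_algebra all_fingroup.
From mathcomp Require Import boolp classical_sets functions cardinality fsbigop.
From mathcomp Require Import ring zify.

Set Implicit Arguments.
Unset Strict Implicit.
Unset Printing Implicit Defensive.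

Import Order.TTheory GRing.Theory Num.Theory.

Local Open Scope ring_scope.

(** * Signs and shuffle sums *)

(** [bidegree] constrains a cochain only on lists with the arguments from g first, a form that the
    shuffles in a bracket destroy. It is therefore traded for a scaling condition under the
    automorphism (x, v) |-> (2 x, v): the factor 2^k of a cochain of bidegree k|0 is multiplicative
    under composition, and characteristic 0 keeps the powers of 2 apart. A cochain of weight other
    than -1 projects to 0 in h; this one fact bounds the number of copies of (s^{-1}pi, T) that can
    act and singles out the surviving terms of the twisted operations. Twisting rests on binomial(m,
    k) / m! = 1 / (k! (m - k)!): the Jacobi identity for m copies of the Maurer-Cartan element
    followed by a word, divided by m!, is the part of the twisted identity that contains m copies in
    all. The operations are linear only in homogeneous letters of a fixed degree, so statements
    about words carry a predicate on their letters, and sums over splittings are compared only on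
    the splittings that occur. *)

Definition zodd (n : int) : bool := odd `|n|%N.

Lemma signzE (K : fieldType) (n : int) : (-1) ^ n = (-1) ^+ (zodd n) :> K.
Proof.
rewrite /zodd signr_odd; case: n => [n|n] //.
by rewrite NegzE abszN -exprnN -exprVn invrN1.
Qed.

(** Parity is read off from the sign over [rat], where 1 and -1 differ and exponents add. *)
Lemma zoddD m n : zodd (m + n) = zodd m (+) zodd n.
Proof.
apply: (@signr_inj rat); rewrite signr_addb -!signzE.
by apply: expfzDr; rewrite oppr_eq0 oner_eq0.
Qed.

Lemma zoddN n : zodd (- n) = zodd n.
Proof. by rewrite /zodd abszN. Qed.

Lemma zoddM m n : zodd (m * n) = zodd m && zodd n.
Proof. by rewrite /zodd abszM oddM. Qed.

Lemma zodd_nat (n : nat) : zodd n%:Z = odd n.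
Proof. by []. Qed.

Lemma zodd1 : zodd 1 = true. Proof. by []. Qed.
Lemma zodd0 : zodd 0 = false. Proof. by []. Qed.

Definition zoddE := (zoddD, zoddM, zoddN, zodd1, zodd0, zodd_nat).

(** A sign depends only on the parities of the degrees, so an identity between signs is a finite
    check. *)
Ltac signs :=
  rewrite ?signzE ?zoddE;
  repeat match goal with |- context [zodd ?x] => case: (zodd x) end;
  rewrite ?expr0 ?expr1 /= ?expr0 ?expr1; by [|ring].

Section ShuffleSum.
Variables (K : fieldType) (X : eqType) (dg : X -> int).

Definition wdeg (s : seq X) : int := \sum_(x <- s) dg x.

Lemma wdeg_nil : wdeg [::] = 0.
Proof. exact: big_nil. Qed.

Lemma wdeg_cons x s : wdeg (x :: s) = dg x + wdeg s.
Proof. exact: big_cons. Qed.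

Lemma wdeg_cat s t : wdeg (s ++ t) = wdeg s + wdeg t.
Proof. exact: big_cat. Qed.

Lemma perm_wdeg s t : perm_eq s t -> wdeg s = wdeg t.
Proof. exact: perm_big. Qed.

Definition wdegE := (wdeg_nil, wdeg_cons, wdeg_cat).

(* The sum, with Koszul signs, over all ways to split the word s into a
   subword u and its complement v. *)
Fixpoint shsum (B : lmodType K) (G : seq X -> seq X -> B) (s : seq X) : B :=
  if s is x :: s' then
    shsum (fun u v => G (x :: u) v) s' +
    shsum (fun u v => (-1) ^ (dg x * wdeg u) *: G u (x :: v)) s'
  else G [::] [::].

Section Linear.
Variable B : lmodType K.
Implicit Types (G H : seq X -> seq X -> B) (s t u v : seq X).

(** Only splittings of [s] enter the sum. This form lets hypotheses on the letters, the length or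
    the degree of [s] be used under the sum. *)
Lemma eq_shsum_perm G H s :
  (forall u v, perm_eq (u ++ v) s -> G u v = H u v) -> shsum G s = shsum H s.
Proof.
elim: s G H => [|x s IHs] G H eqGH /=; first exact: eqGH.
congr (_ + _); apply: IHs => u v uvs; rewrite eqGH //= ?perm_cons //.
by rewrite -cat_rcons -cats1 -catA perm_catCA /= perm_cons.
Qed.

Lemma eq_shsum G H s : (forall u v, G u v = H u v) -> shsum G s = shsum H s.
Proof. by move=> eqGH; apply: eq_shsum_perm => u v _; apply: eqGH. Qed.

Lemma shsum0 s : shsum (fun _ _ => 0) s = 0 :> B.
Proof.
elim: s => //= x s IHs; rewrite [X in X + _]IHs add0r -[RHS]IHs.
by apply: eq_shsum => u v; rewrite scaler0.
Qed.

Lemma shsumP (a : K) G H s :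
  shsum (fun u v => a *: G u v + H u v) s = a *: shsum G s + shsum H s.
Proof.
elim: s G H => //= x s IHs G H; rewrite IHs scalerDr -!addrA; congr (_ + _).
rewrite addrCA -IHs; congr (_ + _); apply: eq_shsum => u v.
by rewrite scalerDr !scalerA mulrC.
Qed.

Lemma shsumD G H s : shsum (fun u v => G u v + H u v) s = shsum G s + shsum H s.
Proof.
rewrite -[shsum G s]scale1r -shsumP; apply: eq_shsum => u v.
by rewrite scale1r.
Qed.

Lemma shsumZ (a : K) G s : shsum (fun u v => a *: G u v) s = a *: shsum G s.
Proof.
rewrite -[RHS]addr0 -[in RHS](shsum0 s) -shsumP.
by apply: eq_shsum => u v; rewrite addr0.
Qed.

Lemma shsum_sum (I : Type) (r : seq I) (P : pred I) (F : I -> seq X -> seq X -> B) s :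
  shsum (fun u v => \sum_(i <- r | P i) F i u v) s =
  \sum_(i <- r | P i) shsum (F i) s.
Proof.
elim: r => [|i r IHr].
  by rewrite big_nil -[RHS](shsum0 s); apply: eq_shsum => u v; rewrite big_nil.
rewrite big_cons -IHr.
case: ifP => Pi; rewrite -?shsumD; apply: eq_shsum => u v;
  by rewrite big_cons Pi.
Qed.

(** Both sides distribute the letters over three blocks. The head letter goes to one of the three,
    and its sign for entering the last is additive in the first two. *)
Lemma shsum_assoc (G : seq X -> seq X -> seq X -> B) s :
  shsum (fun u w => shsum (fun u1 u2 => G u1 u2 w) u) s =
  shsum (fun u1 v => shsum (fun u2 w => G u1 u2 w) v) s.
Proof.
elim: s G => //= x s IHs G; rewrite shsumD.
under [X in _ = _ + X]eq_shsum do rewrite scalerDr.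
rewrite shsumD !addrA; congr (_ + _ + _); first exact: IHs.
  by rewrite IHs; apply: eq_shsum => u v; rewrite -shsumZ.
under eq_shsum do rewrite -shsumZ.
rewrite [RHS](_ : _ = shsum (fun u1 v => shsum (fun u2 w =>
   (-1) ^ (dg x * wdeg (u1 ++ u2)) *: G u1 u2 (x :: w)) v) s); last first.
  apply: eq_shsum => u v; rewrite -shsumZ; apply: eq_shsum => u2 w.
  by rewrite scalerA; congr (_ *: _); rewrite wdeg_cat; signs.
(* The sign involves the degree of [u], which equals that of [u1 ++ u2], a permutation of [u]. *)
rewrite -IHs; apply: eq_shsum => u v; apply: eq_shsum_perm => u1 u2 pu.
by rewrite (perm_wdeg pu).
Qed.

(** Exchanging the blocks exchanges the two branches of the recursion for the head letter. *)
Lemma shsumC G s :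
  shsum G s = shsum (fun u v => (-1) ^ (wdeg u * wdeg v) *: G v u) s.
Proof.
elim: s G => [|x s IHs] G /=; first by rewrite wdeg_nil mul0r expr0z scale1r.
rewrite addrC IHs; congr (_ + _); last rewrite IHs.
  apply: eq_shsum => u v; rewrite scalerA; congr (_ *: _).
  by rewrite wdeg_cons; signs.
apply: eq_shsum => u v; rewrite scalerA; congr (_ *: _).
by rewrite wdeg_cons; signs.
Qed.

End Linear.

Lemma linear_shsum (B C : lmodType K) (f : B -> C) (G : seq X -> seq X -> B) s :
  (forall a x y, f (a *: x + y) = a *: f x + f y) ->
  f (shsum G s) = shsum (fun u v => f (G u v)) s.
Proof.
move=> lin_f; have fD x y : f (x + y) = f x + f y.
  by rewrite -[x]scale1r lin_f !scale1r.
have f0 : f 0 = 0 by apply: (addrI (f 0)); rewrite -fD !addr0.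
have fZ a x : f (a *: x) = a *: f x by rewrite -[a *: x]addr0 lin_f f0 addr0.
elim: s G => //= x s IHs G; rewrite fD !IHs; congr (_ + _).
by apply: eq_shsum => u v; rewrite fZ.
Qed.

(** * Linearity and symmetry of shuffle sums in homogeneous letters *)

Section Letters.
Variables (B : lmodType K) (good : X -> Prop).
Implicit Types (G : seq X -> seq X -> B) (s t u v : seq X).
Local Notation goods s := {in s, forall x, good x}.

Lemma goods_cons x s : good x -> goods s -> goods (x :: s).
Proof. by move=> gx gs y; rewrite inE => /predU1P[->|/gs]. Qed.

Lemma goods1 x : good x -> goods [:: x].
Proof. by move=> gx y; rewrite inE => /eqP->. Qed.

Lemma goods_cat s t : goods s -> goods t -> goods (s ++ t).
Proof. by move=> gs gt y; rewrite mem_cat => /orP[/gs|/gt]. Qed.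

Lemma goods_catl s t : goods (s ++ t) -> goods s.
Proof. by move=> g x xs; apply: g; rewrite mem_cat xs. Qed.

Lemma goods_catr s t : goods (s ++ t) -> goods t.
Proof. by move=> g x xs; apply: g; rewrite mem_cat xs orbT. Qed.

Lemma goods_head x s : goods (x :: s) -> good x.
Proof. by apply; rewrite mem_head. Qed.

Lemma goods_behead x s : goods (x :: s) -> goods s.
Proof. by move=> g y ys; apply: g; rewrite inE ys orbT. Qed.

Lemma goods_perm s t : perm_eq t s -> goods s -> goods t.
Proof. by move=> pts gs x; rewrite (perm_mem pts) => /gs. Qed.

Lemma goods_split s u v : perm_eq (u ++ v) s -> goods s -> goods u /\ goods v.
Proof.
by move=> /goods_perm uvs /uvs gs; split; [apply: goods_catl gs|apply: goods_catr gs].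
Qed.

Lemma goods_swap s1 x y s2 : goods (s1 ++ x :: y :: s2) -> goods (s1 ++ y :: x :: s2).
Proof.
apply: goods_perm; rewrite perm_cat2l -[x :: y :: _]/([:: x; y] ++ s2).
by rewrite -[y :: x :: _]/([:: y; x] ++ s2) perm_cat2r (perm_catC [:: y] [:: x]).
Qed.

(** The distinguished letter lies in exactly one of the two blocks, so linearity of [G] in each
    block suffices; equal degrees make the signs agree. *)
Lemma shsum_lin (a : K) x y z G s1 s2 :
  dg x = dg z -> dg y = dg z ->
  (forall u1 u2 v, goods u1 -> goods u2 -> goods v ->
     G (u1 ++ z :: u2) v = a *: G (u1 ++ x :: u2) v + G (u1 ++ y :: u2) v) ->
  (forall u v1 v2, goods u -> goods v1 -> goods v2 ->
     G u (v1 ++ z :: v2) = a *: G u (v1 ++ x :: v2) + G u (v1 ++ y :: v2)) ->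
  goods s1 -> goods s2 ->
  shsum G (s1 ++ z :: s2) = a *: shsum G (s1 ++ x :: s2) + shsum G (s1 ++ y :: s2).
Proof.
move=> dxz dyz + + + gs2; elim: s1 G => [|w s1 IHs] G Gl Gr gs1 /=.
  rewrite scalerDr addrACA -!shsumP; congr (_ + _);
    apply: eq_shsum_perm => u v /goods_split/(_ gs2)[gu gv].
    exact: (Gl [::]).
  rewrite -[z :: v]cat0s (Gr u [::] v) //= dxz dyz scalerDr !scalerA.
  by rewrite [a * _]mulrC.
have gw := goods_head gs1; have {}gs1 := goods_behead gs1.
rewrite scalerDr addrACA; congr (_ + _).
  apply: IHs => // [u1 u2 v gu1 gu2 gv|u v1 v2 gu gv1 gv2].
    by apply: (Gl (w :: u1)) => //; apply: goods_cons.
  by apply: Gr => //; apply: goods_cons.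
apply: IHs => // [u1 u2 v gu1 gu2 gv|u v1 v2 gu gv1 gv2].
  rewrite Gl //; last exact: goods_cons.
  by rewrite !wdeg_cat !wdeg_cons dxz dyz scalerDr !scalerA mulrC.
rewrite (Gr u (w :: v1)) //; last exact: goods_cons.
by rewrite scalerDr !scalerA mulrC.
Qed.

Lemma shsum_swap x y G s1 s2 :
  (forall u1 u2 v, goods u1 -> goods u2 -> goods v ->
     G (u1 ++ x :: y :: u2) v = (-1) ^ (dg x * dg y) *: G (u1 ++ y :: x :: u2) v) ->
  (forall u v1 v2, goods u -> goods v1 -> goods v2 ->
     G u (v1 ++ x :: y :: v2) = (-1) ^ (dg x * dg y) *: G u (v1 ++ y :: x :: v2)) ->
  goods s1 -> goods s2 ->
  shsum G (s1 ++ x :: y :: s2) =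
    (-1) ^ (dg x * dg y) *: shsum G (s1 ++ y :: x :: s2).
Proof.
move=> + + + gs2; elim: s1 G => [|w s1 IHs] G Gl Gr gs1 /=.
  (* Of the four placements of [x] and [y], the two that separate them trade places. *)
  rewrite [LHS]addrACA !scalerDr -!shsumZ.
  congr (_ + _ + (_ + _)); apply: eq_shsum_perm => u v /goods_split/(_ gs2)[gu gv].
  - exact: (Gl [::]).
  - by rewrite !scalerA; congr (_ *: _); rewrite wdeg_cons; signs.
  - by rewrite !scalerA; congr (_ *: _); rewrite wdeg_cons; signs.
  - by rewrite (Gr u [::] v) //= !scalerA; congr (_ *: _); signs.
have gw := goods_head gs1; have {}gs1 := goods_behead gs1.
rewrite scalerDr; congr (_ + _); apply: IHs => // *.
- by apply: (Gl (w :: _)) => //; apply: goods_cons.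
- by apply: Gr => //; apply: goods_cons.
- rewrite Gl //; last exact: goods_cons.
  by rewrite !wdegE !scalerA; congr (_ *: _); signs.
- rewrite (Gr _ (w :: _)) //; last exact: goods_cons.
  by rewrite !scalerA; congr (_ *: _); signs.
Qed.

End Letters.
End ShuffleSum.

(** * Sums over shuffles in the symmetric group *)

Section Shuffles.
Variable K : fieldType.

(** A permutation is determined by the position k that it sends to [ord0] and by its restriction to
    the rest; injectivity suffices because n! (n + 1) = (n + 1)!. *)
Lemma lift_perm0_bij n :
  bijective (fun ks : 'I_n.+1 * 'S_n => lift_perm ks.1 ord0 ks.2).
Proof.
apply: inj_card_bij => [[k s] [k' s'] /= eqt|]; last first.
  by rewrite card_prod card_ord !card_Sn factS.
have eqk : k = k'.
  apply: (@perm_inj _ (lift_perm k ord0 s)).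
  by rewrite lift_perm_id eqt lift_perm_id.
rewrite -{k'}eqk in eqt *; congr (_, _); apply/permP => i.
by apply: (@lift_inj _ ord0); rewrite -!(lift_perm_lift k) eqt.
Qed.

Lemma bump_lt h i j : (bump h i < bump h j)%N = (i < j)%N.
Proof. by rewrite !ltnNge leq_bump2. Qed.

Lemma lt_bump h i : (bump h i < h)%N = (i < h)%N.
Proof. rewrite /bump; lia. Qed.

(** The value 0, at position k, is the smallest and must open one of the two increasing blocks: the
    first (k = 0, block nonempty) or the second (k = i). *)
Lemma shuffle_lift_perm n i (k : 'I_n.+1) (s : 'S_n) :
  shuffle i (lift_perm k ord0 s) =
    [&& (0 < i)%N, k == ord0 & shuffle i.-1 s] || (k == i :> nat) && shuffle i s.
Proof.
set t := lift_perm k ord0 s.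
have tk : t k = ord0 by rewrite /t lift_perm_id.
have tl j : t (lift k j) = lift ord0 (s j) by rewrite /t lift_perm_lift.
apply/idP/idP => [sh_t|].
  have lt_t (a b : 'I_n.+1) : (a < b)%N -> (b < i)%N || (i <= a)%N -> (t a < t b)%N.
    by move=> ab abi; have /forallP/(_ a)/forallP/(_ b) := sh_t; rewrite ab abi.
  have sh j : (forall a : 'I_n, (bump k a < i)%N = (a < j)%N) -> shuffle j s.
    move=> lt_j; apply/forallP => a; apply/forallP => b; apply/implyP => /andP[ab abj].
    suff: (t (lift k a) < t (lift k b))%N by rewrite !tl !lift0 ltnS.
    by apply: lt_t; rewrite /= ?bump_lt // [(i <= _)%N]leqNgt !lt_j -leqNgt.
  have k0i : (k == 0 :> nat)%N && (0 < i)%N || (k == i :> nat).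
    have [k0|k_neq0 /=] := eqVneq (k : nat) 0%N.
      by case: posnP => //= ->; rewrite k0.
    (* Otherwise k is not the first position of its block, and the entry that opens the block would
       lie below [t k], which is 0. *)
    apply/negPn/negP => k_neqi; have [k_lti|k_gei] := ltnP k i.
      by have := @lt_t ord0 k; rewrite tk /= k_lti lt0n k_neq0 => /(_ isT isT).
    have i_ltk : (i < k)%N by rewrite ltn_neqAle eq_sym k_neqi.
    have i_ltn : (i < n.+1)%N by apply: ltn_trans (ltn_ord k).
    by have := @lt_t (Ordinal i_ltn) k; rewrite tk /= i_ltk leqnn orbT => /(_ isT isT).
  case/orP: k0i => [/andP[/eqP k0 i0]|/eqP ki].
    rewrite -val_eqE /= k0 eqxx i0 /= sh // => a.
    by rewrite /= k0 /bump /= add1n; case: (i) i0.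
  by rewrite ki eqxx /= orbC sh // => a; rewrite /= ki lt_bump.
move=> kin; apply/forallP => a; apply/forallP => b; apply/implyP => /andP[ab abi].
case: (unliftP k b) ab abi => [b' ->|->]; case: (unliftP k a) => [a' ->|->].
- rewrite !tl !lift0 ltnS /= bump_lt => ab abi.
  suff [j sh_s abj]: exists2 j, shuffle j s & (b' < j)%N || (j <= a')%N.
    by have /forallP/(_ a')/forallP/(_ b') := sh_s; rewrite ab abj.
  case/orP: kin => [/and3P[i0 /eqP k0 sh]|/andP[/eqP ki sh]].
    exists i.-1 => //; move: abi; rewrite k0 /= /bump /= !add1n; lia.
  by exists i => //; move: abi; rewrite /= ki /bump; lia.
- by rewrite tk tl lift0.
- rewrite /= lt_bump => lt_ak abi; exfalso.
  have {kin}: (k == 0 :> nat) || (k == i :> nat).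
    by case/orP: kin => [/and3P[_ /eqP-> _]|/andP[-> _]]; rewrite ?orbT.
  by move: abi lt_ak; rewrite /= /bump => abi lt_ak /orP[] /eqP k0; move: abi lt_ak;
    rewrite k0; lia.
- by rewrite ltnn.
Qed.

(** Position k carries the value 0, so it is inverted with exactly the positions before it. *)
Lemma koszul_lift_perm n (d : 'I_n.+1 -> int) (k : 'I_n.+1) (s : 'S_n) :
  koszul K d (lift_perm k ord0 s) =
    \prod_(i < n | (i < k)%N) (-1) ^ (d ord0 * d (lift ord0 (s i))) *
    koszul K (fun i => d (lift ord0 i)) s.
Proof.
rewrite /koszul (bigD1_ord k) //= [X in X * _]big1; last first.
  by move=> j; rewrite lift_perm_id ltn0 andbF.
rewrite mul1r [X in _ = X * _]big_mkcond -big_split; apply: eq_bigr => i _ /=.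
rewrite big_mkcond (bigD1_ord k) //= -big_mkcond.
rewrite lt_bump lift_perm_id !lift_perm_lift lift0 /= andbT mulrC [RHS]mulrC.
congr (_ * _); last by rewrite [d ord0 * _]mulrC.
rewrite big_mkcond [RHS]big_mkcond; apply: eq_bigr => j _.
by rewrite lift_perm_lift bump_lt /= /bump /= !add1n ltnS.
Qed.

(** With all letters odd, each inversion contributes -1. Alternating sums over shuffles thereby
    become Koszul-signed sums. *)
Lemma koszul1 n (s : 'S_n) : koszul K (fun=> 1) s = (-1) ^+ s.
Proof.
elim: n s => [|n IHn] s.
  by rewrite /koszul big_ord0 (_ : s = 1%g) ?odd_perm1 //; apply/permP => -[].
have [ks _ /(_ s) <-] := lift_perm0_bij n.
rewrite koszul_lift_perm IHn odd_lift_perm addbF signr_addb signr_odd mulr1 expr1z.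
congr (_ * _); rewrite prodr_const; congr (_ ^+ _).
by rewrite -sum1_card -(big_ord_widen n (fun=> 1%N)) ?sum1_card ?card_ord // -ltnS ltn_ord.
Qed.

Section Words.
Variables (X : eqType) (dg : X -> int).

Lemma permuted_lift_perm n (x0 : X) (x : n.-tuple X) (k : 'I_n.+1) (s : 'S_n) :
  permuted [tuple of x0 :: x] (lift_perm k ord0 s) =
    take k (permuted x s) ++ x0 :: drop k (permuted x s).
Proof.
have szp : size (permuted x s) = n by rewrite size_map size_enum_ord.
have lek : (k <= n)%N by rewrite -ltnS.
apply: (@eq_from_nth _ x0) => [|i].
  rewrite size_cat /= size_drop size_takel ?szp // size_map size_enum_ord.
  by rewrite addnS subnKC.
rewrite size_map size_enum_ord => lt_in.
rewrite (nth_map ord0) ?size_enum_ord // (nth_ord_enum ord0 (Ordinal lt_in)).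
rewrite nth_cat size_takel ?szp //.
case: (unliftP k (Ordinal lt_in)) => [j|] Di; rewrite Di; last first.
  have /= -> := congr1 val Di.
  by rewrite lift_perm_id (tnth_nth x0) /= ltnn subnn.
have /= -> := congr1 val Di; rewrite lift_perm_lift (tnth_nth x0) /= lt_bump.
have -> : nth x0 x (s j) = nth x0 (permuted x s) j.
  by rewrite (nth_map j) ?size_enum_ord // nth_ord_enum (tnth_nth x0).
case: ltnP => [lt_jk|le_kj]; first by rewrite /bump leqNgt lt_jk nth_take.
by rewrite /bump le_kj add1n subSn //= nth_drop subnKC.
Qed.

Lemma prod_sign (I : Type) (r : seq I) (P : pred I) (c : int) (F : I -> int) :
  \prod_(i <- r | P i) (-1) ^ (c * F i) = (-1) ^ (c * \sum_(i <- r | P i) F i) :> K.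
Proof.
elim/big_rec2: _ => [|i m n _ ->]; first by rewrite mulr0.
by signs.
Qed.

Lemma wdeg_take_permuted n (x : n.-tuple X) (s : 'S_n) k : (k <= n)%N ->
  wdeg dg (take k (permuted x s)) = \sum_(i < n | (i < k)%N) dg (tnth x (s i)).
Proof.
case: n x s => [|n] x s lekn.
  by rewrite big_ord0 tuple0 /permuted enum_ord0 /= wdeg_nil.
have [x0 Dx] : {x0 : X | x0 = thead x} by exists (thead x).
have szp : size (permuted x s) = n.+1 by rewrite size_map size_enum_ord.
rewrite /wdeg (big_nth x0) size_takel ?szp // big_mkord.
rewrite (big_ord_widen n.+1 (fun i => dg (nth x0 (take k (permuted x s)) i))) //.
apply: eq_bigr => i lt_ik; rewrite nth_take // (nth_map i) ?size_enum_ord //.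
by rewrite nth_ord_enum.
Qed.

Lemma koszul_cons n (x0 : X) (x : n.-tuple X) (k : 'I_n.+1) (s : 'S_n) :
  koszul K (fun i => dg (tnth [tuple of x0 :: x] i)) (lift_perm k ord0 s) =
    (-1) ^ (dg x0 * wdeg dg (take k (permuted x s))) *
    koszul K (fun i => dg (tnth x i)) s.
Proof.
rewrite koszul_lift_perm wdeg_take_permuted ?leq_ord // -prod_sign tnth0.
congr (_ * _); first by apply: eq_bigr => i _; rewrite tnthS.
by congr (koszul _ _ _); apply/funext => i; rewrite tnthS.
Qed.

Section Symmetry.
Variables (B : lmodType K) (good : X -> Prop).
Implicit Types (f : seq X -> B).
Local Notation goods s := {in s, forall x, good x}.

Definition adjacent_symm f := forall s1 x y s2,
  goods (s1 ++ x :: y :: s2) ->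
  f (s1 ++ x :: y :: s2) = (-1) ^ (dg x * dg y) *: f (s1 ++ y :: x :: s2).

Lemma adjacent_symm_front f s1 x s2 : adjacent_symm f -> goods (s1 ++ x :: s2) ->
  f (s1 ++ x :: s2) = (-1) ^ (dg x * wdeg dg s1) *: f (x :: s1 ++ s2).
Proof.
move=> symm_f; elim/last_ind: s1 s2 => [|s1 y IHs] s2 gs.
  by rewrite wdeg_nil mulr0 expr0z scale1r.
rewrite cat_rcons in gs; rewrite !cat_rcons symm_f // IHs; last exact: goods_swap.
by rewrite scalerA; congr (_ *: _); rewrite -cats1 !wdegE; signs.
Qed.

(** The head letter is moved to the front from the position where the permutation puts it; induction
    then applies to [f] with that letter fixed in front. *)
Lemma adjacent_symm_permuted f n (x : n.-tuple X) (s : 'S_n) :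
  adjacent_symm f -> goods x ->
  f (permuted x s) = koszul K (fun i => dg (tnth x i)) s *: f x.
Proof.
elim: n f x s => [|n IHn] f x s symm_f gx.
  by rewrite /koszul big_ord0 scale1r tuple0 /permuted enum_ord0.
case/tupleP: x gx => x0 x gx; have [ks _ /(_ s) <-] := lift_perm0_bij n.
move: (ks s) => [k {}s] /=; rewrite permuted_lift_perm koszul_cons.
rewrite adjacent_symm_front // ?cat_take_drop; last first.
  move=> z; rewrite mem_cat inE orbCA -mem_cat cat_take_drop => zx.
  apply: gx; rewrite inE; case/predU1P: zx => [->|/mapP[i _ ->]].
    by rewrite eqxx.
  by rewrite mem_tnth orbT.
rewrite -scalerA; congr (_ *: _); apply: (IHn (fun u => f (x0 :: u))).
  by move=> s1 y z s2 gs; apply: (symm_f (x0 :: s1));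
    apply: goods_cons (gx _ (mem_head _ _)) gs.
exact: goods_behead gx.
Qed.

(** Permutations are indexed by the position of the head letter; the two cases of
    [shuffle_lift_perm] are then the two branches of the recursion of [shsum]. The length test on
    [u] takes over the role of i. *)
Lemma sum_shuffle n i (x : n.-tuple X) (G : seq X -> seq X -> B) : (i <= n)%N ->
  \sum_(s : 'S_n | shuffle i s) koszul K (fun j => dg (tnth x j)) s *:
     G (take i (permuted x s)) (drop i (permuted x s)) =
  shsum dg (fun u v => if size u == i then G u v else 0) x.
Proof.
elim: n i x G => [|n IHn] i x G lein.
  move: lein; rewrite leqn0 => /eqP-> ; rewrite (big_pred1 1%g); last exact: shuffle0.
  by rewrite /koszul big_ord0 scale1r tuple0 /permuted enum_ord0.
case/tupleP: x => x0 x.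
rewrite (reindex _ (onW_bij _ (lift_perm0_bij n))) /=.
pose F (k : 'I_n.+1) (s : 'S_n) :=
  koszul K (fun j => dg (tnth [tuple of x0 :: x] j)) (lift_perm k ord0 s) *:
     G (take i (permuted [tuple of x0 :: x] (lift_perm k ord0 s)))
       (drop i (permuted [tuple of x0 :: x] (lift_perm k ord0 s))).
rewrite -(pair_big_dep xpredT (fun k s => shuffle i (lift_perm k ord0 s)) F) /=.
have szp s : size (permuted x s) = n by rewrite size_map size_enum_ord.
transitivity ((if (0 < i)%N then \sum_(s : 'S_n | shuffle i.-1 s) F ord0 s else 0) +
   \sum_(k < n.+1 | k == i :> nat) \sum_(s : 'S_n | shuffle i s) F k s).
  rewrite [X in _ = _ + X]big_mkcond.
  rewrite [X in X + _](_ : _ = \sum_(k < n.+1) if (0 < i)%N && (k == ord0) then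
      \sum_(s : 'S_n | shuffle i.-1 s) F k s else 0); last first.
    case: ifP => _; last by rewrite big1.
    by rewrite -big_mkcond big_pred1_eq.
  rewrite -big_split; apply: eq_bigr => k _ /=.
  rewrite (eq_bigl _ _ (fun s => shuffle_lift_perm i k s)).
  case: ifP => [/andP[i0 /eqP->]|ik0] /=.
    by rewrite i0 /= eq_sym gtn_eqF //= addr0; apply: eq_bigl => s; rewrite orbF.
  rewrite add0r; case: ifP => ki /=.
    by apply: eq_bigl => s; rewrite andbA ik0.
  by rewrite big_pred0 // => s; rewrite andbA ik0.
congr (_ + _).
  case: i lein @F => [|i] lein F /=.
    by rewrite -[LHS](shsum0 dg B x); apply: eq_shsum.
  rewrite -[RHS](IHn i x (fun u v => G (x0 :: u) v)) //; apply: eq_bigr => s _.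
  by rewrite /F permuted_lift_perm koszul_cons !take0 !drop0 wdeg_nil mulr0 expr0z mul1r.
(* For i = n + 1 the second block is empty, so the head letter cannot open it and both sides
   vanish. *)
have [lt_in|le_ni] := ltnP i n.+1; last first.
  rewrite big_pred0 => [|k]; last by rewrite ltn_eqF // (leq_trans (ltn_ord k)).
  rewrite -[LHS](shsum0 dg B x); apply: eq_shsum_perm => u v uvx.
  rewrite ltn_eqF ?scaler0 // (leq_trans _ le_ni) // ltnS.
  by rewrite -(size_tuple x) -(perm_size uvx) size_cat leq_addr.
rewrite (big_pred1 (Ordinal lt_in)) => [|k]; last by [].
rewrite [RHS](_ : _ = shsum dg (fun u v => if size u == i then
    (-1) ^ (dg x0 * wdeg dg u) *: G u (x0 :: v) else 0) x); last first.
  by apply: eq_shsum => u v; case: ifP; rewrite ?scaler0.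
rewrite -[RHS](IHn i x (fun u v => (-1) ^ (dg x0 * wdeg dg u) *: G u (x0 :: v))) //.
apply: eq_bigr => s _; rewrite /F permuted_lift_perm koszul_cons /= mulrC -scalerA.
by congr (_ *: (_ *: _)); rewrite ?take_size_cat ?drop_size_cat // size_takel // szp.
Qed.

End Symmetry.

Lemma shsum_nil (B : lmodType K) (H : seq X -> B) s :
  shsum dg (fun u v => if u is [::] then H v else 0) s = H s.
Proof.
elim: s H => //= x s IHs H.
rewrite -[RHS](IHs (fun v => H (x :: v))) [X in X + _](shsum0 dg B s) add0r.
apply: eq_shsum => -[|y u] v; rewrite ?scaler0 //.
by rewrite wdeg_nil mulr0 expr0z scale1r.
Qed.

(** A splitting with a one-letter first block is the choice of a position j. The left side has the
    shape of the second component of [middle_op]. *)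
Lemma shsum_pick1 (B : lmodType K) (x0 : X) (G : X -> seq X -> B) s :
  \sum_(j < size s) (-1) ^ (dg (nth x0 s j) * wdeg dg (take j s)) *:
     G (nth x0 s j) (take j s ++ drop j.+1 s) =
  shsum dg (fun u v => if u is [:: x] then G x v else 0) s.
Proof.
elim: s G => [|x s IHs] G /=; first by rewrite big_ord0.
rewrite big_ord_recl /= wdeg_nil mulr0 expr0z scale1r drop0; congr (_ + _).
  by rewrite -[LHS](shsum_nil (G x)); apply: eq_shsum => -[].
rewrite [RHS](_ : _ = shsum dg (fun u v => if u is [:: y] then
    (-1) ^ (dg x * dg y) *: G y (x :: v) else 0) s); last first.
  apply: eq_shsum => -[|y [|z u]] v; rewrite ?scaler0 //.
  by rewrite wdeg_cons wdeg_nil addr0.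
rewrite -(IHs (fun y v => (-1) ^ (dg x * dg y) *: G y (x :: v))).
apply: eq_bigr => j _; rewrite scalerA; congr (_ *: _).
by rewrite wdeg_cons; signs.
Qed.

End Words.
End Shuffles.

(** * The Nijenhuis-Richardson bracket *)

(* Decides identities in abelian groups by cancelling opposite terms. *)
Ltac zmod_cancel :=
  match goal with
  | |- - ?x + _ = 0 => repeat (first [rewrite (addKr x);
    zmod_cancel | rewrite (addrCA _ x)])
  | |- ?x + _ = 0 => repeat (first [rewrite (addNKr x);
    zmod_cancel | rewrite (addrCA _ (- x))])
  | |- _ => reflexivity
  end.

Ltac zmod :=
  apply/eqP; rewrite -subr_eq0; apply/eqP;
  rewrite ?(opprD, opprK, oppr0, addr0, add0r); rewrite -[LHS]addr0 -?addrA ?addr0;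
  rewrite -[LHS]addr0 -?addrA; zmod_cancel.

(** * Multilinear and alternating maps on lists *)

Section Alternating.
Variables (K : fieldType) (A B : lmodType K).
Implicit Types (f : seq A -> B) (s : seq A).

Definition multilinear f := forall s1 s2 (a : K) x y,
  f (s1 ++ (a *: x + y) :: s2) = a *: f (s1 ++ x :: s2) + f (s1 ++ y :: s2).

Definition alternating f := multilinear f /\ forall s, ~~ uniq s -> f s = 0.

Lemma alt_map_alternating m f : alt_map m f -> alternating f.
Proof. by case. Qed.

Lemma alt_map_multilinear m f : alt_map m f -> multilinear f.
Proof. by case. Qed.

Lemma alt_map_size m f s : alt_map m f -> (size s)%:Z != m -> f s = 0.
Proof. by case=> + _ _; apply. Qed.

Lemma multilinear0 f s1 s2 : multilinear f -> f (s1 ++ 0 :: s2) = 0.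
Proof.
move=> lin_f; have := lin_f s1 s2 (-1) 0 0.
by rewrite scaler0 addr0 scaleN1r addNr.
Qed.

Lemma multilinearZ f s1 s2 a x : multilinear f ->
  f (s1 ++ a *: x :: s2) = a *: f (s1 ++ x :: s2).
Proof. by move=> lin_f; rewrite -[a *: x]addr0 lin_f multilinear0 // addr0. Qed.

Lemma multilinearD f s1 s2 x y : multilinear f ->
  f (s1 ++ x + y :: s2) = f (s1 ++ x :: s2) + f (s1 ++ y :: s2).
Proof. by move=> lin_f; rewrite -[x]scale1r lin_f !scale1r. Qed.

Lemma multilinear_swap f s1 s2 x y : multilinear f ->
  (forall z, f (s1 ++ z :: z :: s2) = 0) ->
  f (s1 ++ x :: y :: s2) = - f (s1 ++ y :: x :: s2).
Proof.
move=> lin_f alt_f; apply/eqP; rewrite -addr_eq0; apply/eqP.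
have fD z : f (s1 ++ z :: x + y :: s2) = f (s1 ++ z :: x :: s2) + f (s1 ++ z :: y :: s2).
  by rewrite -cat_rcons (multilinearD _ _ _ _ lin_f) !cat_rcons.
have := alt_f (x + y); rewrite (multilinearD _ _ _ _ lin_f) !fD.
by rewrite !alt_f add0r addr0.
Qed.

(** Adjacent transpositions, each costing a sign, bring two equal arguments together. *)
Lemma alternating_adjacent f : multilinear f ->
  (forall s1 x s2, f (s1 ++ x :: x :: s2) = 0) -> alternating f.
Proof.
move=> lin_f alt_f; split=> // s.
have alt2 x : forall s1 s2 s3, f (s1 ++ x :: s2 ++ x :: s3) = 0.
  move=> s1 s2; elim: s2 s1 => [|y s2 IHs] s1 s3 /=; first exact: alt_f.
  by rewrite multilinear_swap // -cat_rcons IHs oppr0.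
suff alt_cat s1 : ~~ uniq s -> f (s1 ++ s) = 0 by exact: (alt_cat [::]).
elim: s s1 => //= x s IHs s1.
rewrite negb_and negbK => /orP[/splitPr[s2 s3]|us]; first exact: alt2.
by rewrite -cat_rcons; apply: IHs.
Qed.

Lemma alternating_twice f s1 x s2 : alternating f -> f (s1 ++ x :: x :: s2) = 0.
Proof. by case=> _; apply; rewrite cat_uniq /= mem_head /= !andbF. Qed.

Lemma alternating_swap f s1 x y s2 : alternating f ->
  f (s1 ++ x :: y :: s2) = - f (s1 ++ y :: x :: s2).
Proof.
move=> alt_f; apply: multilinear_swap => [|z]; first by case: alt_f.
exact: alternating_twice.
Qed.

End Alternating.

Section NijenhuisRichardson.
Variables (K : fieldType) (g V : lmodType K).
Local Notation W := (g * V)%type.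
Local Notation cochains := (seq W -> W).
Implicit Types (P Q R F : cochains) (s u v : seq W) (p q r : int).

Local Notation odd_deg := (fun _ : W => 1 : int).
Local Notation altsum := (shsum odd_deg).

Lemma wdeg_size s : wdeg odd_deg s = size s.
Proof. by elim: s => [|x s IHs]; rewrite ?wdeg_nil // wdeg_cons IHs. Qed.

(** The arity of [Q] is not recorded: an alternating map vanishes on blocks of the wrong length, so
    the sum may run over all splittings. *)
Definition nr_comp P Q : cochains := fun s => altsum (fun u v => P (Q u :: v)) s.

Lemma circE q P Q : multilinear P -> alt_map (q + 1) Q ->
  circ (absz (q + 1)) P Q = nr_comp P Q.
Proof.
move=> linP altQ; apply/funext => s; rewrite /circ /nr_comp.
have Q0 u : size u != absz (q + 1) -> Q u = 0.
  by move=> szu; apply: alt_map_size altQ _; apply: contra_neq szu => <-.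
have P0 v : P (0 :: v) = 0 by exact: (multilinear0 [::]).
under eq_bigr do rewrite /= -koszul1.
have [le_is|lt_si] := leqP (absz (q + 1)) (size s).
  rewrite (sum_shuffle odd_deg (in_tuple s) (fun u v => P (Q u :: v)) le_is).
  by apply: eq_shsum => u v; case: eqP => // /eqP/Q0->; rewrite P0.
(* When the word is shorter than the arity of [Q], both sides vanish. *)
rewrite big1 => [|t _]; last first.
  have szt : size (permuted (in_tuple s) t) = size s by rewrite size_map size_enum_ord.
  by rewrite Q0 ?P0 ?scaler0 // take_oversize szt ?ltn_eqF // ltnW.
rewrite -[LHS](shsum0 odd_deg _ s); apply: eq_shsum_perm => u v /perm_size.
by rewrite size_cat => szuv; rewrite Q0 ?P0 // ltn_eqF // (leq_ltn_trans _ lt_si) //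
  -szuv leq_addr.
Qed.

Lemma compPl a P P' Q : nr_comp (a *: P + P') Q = a *: nr_comp P Q + nr_comp P' Q.
Proof. by apply/funext => s; rewrite !fctE -shsumP. Qed.

Lemma compPr a P Q Q' : multilinear P ->
  nr_comp P (a *: Q + Q') = a *: nr_comp P Q + nr_comp P Q'.
Proof.
move=> linP; apply/funext => s; rewrite !fctE -shsumP.
by apply: eq_shsum => u v; rewrite (linP [::]).
Qed.

Lemma comp_multilinear P Q : multilinear P -> multilinear Q ->
  multilinear (nr_comp P Q).
Proof.
move=> linP linQ s1 s2 a x y.
apply: (@shsum_lin _ _ odd_deg _ (fun=> True)) => // [u1 u2 v _ _ _|u v1 v2 _ _ _].
  by rewrite linQ (linP [::]).
by rewrite (linP (_ :: _)).
Qed.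

(** With two equal adjacent arguments, the terms that keep them in one block vanish. The two ways to
    separate them cancel, since their signs differ by the odd degree of an argument. *)
Lemma comp_alternating P Q : alternating P -> alternating Q ->
  alternating (nr_comp P Q).
Proof.
move=> altP altQ; have [linP _] := altP; have [linQ _] := altQ.
apply: alternating_adjacent => [|s1 x s2]; first exact: comp_multilinear.
rewrite /nr_comp; set G := fun u v => P (Q u :: v).
have Gr u v1 y v2 : G u (v1 ++ y :: y :: v2) = 0.
  exact: (alternating_twice (Q u :: v1)).
have Gl u1 y u2 v : G (u1 ++ y :: y :: u2) v = 0.
  by rewrite /G alternating_twice // (multilinear0 [::]).
move: G Gl Gr; elim: s1 => [|z s1 IHs] G Gl Gr /=.
  rewrite -!shsumD -[RHS](shsum0 odd_deg _ s2); apply: eq_shsum => u v.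
  rewrite (Gl [::] x u v : G (x :: x :: u) v = 0) (Gr u [::] x v : G u (x :: x :: v) = 0).
  rewrite !scaler0 add0r addr0 wdeg_cons -scalerDl; apply/eqP; rewrite scaler_eq0.
  by apply/orP; left; apply/eqP; signs.
rewrite !IHs ?addr0 // => *; rewrite ?Gl ?(Gr _ (z :: _)) ?scaler0 //.
  exact: (Gl (z :: _)).
Qed.

Lemma comp_alt_map p q P Q : alt_map (p + 1) P -> alt_map (q + 1) Q ->
  alt_map (p + q + 1) (nr_comp P Q).
Proof.
move=> altP altQ.
have [lin alt] := comp_alternating (alt_map_alternating altP) (alt_map_alternating altQ).
split=> // s szs; rewrite -[RHS](shsum0 odd_deg _ s).
apply: eq_shsum_perm => u v /perm_size; rewrite size_cat => szuv.
have [szu|szu] := eqVneq ((size u)%:Z) (q + 1).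
  apply: alt_map_size altP _; apply: contra_neq szs => /= szv.
  by rewrite -szuv PoszD szu [RHS]addrAC -szv intS; ring.
rewrite (alt_map_size altQ szu); apply: (multilinear0 [::]).
exact: alt_map_multilinear altP.
Qed.

Definition associator P Q R := nr_comp (nr_comp P Q) R - nr_comp P (nr_comp Q R).

(** Terms with [R] nested inside [Q] cancel in the associator. What is left applies [P] to values of
    [Q] and [R] on disjoint blocks; exchanging these two arguments and their blocks of q + 1 and r +
    1 letters produces the sign. *)
Lemma associator_symm q r P Q R : alternating P ->
  alt_map (q + 1) Q -> alt_map (r + 1) R ->
  associator P Q R = (-1) ^ (q * r) *: associator P R Q.
Proof.
move=> altP; have [linP _] := altP.
pose T Q R s := altsum (fun u v => altsum (fun v1 v2 => P (Q v1 :: R u :: v2)) v) s.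
have P0 v : P (0 :: v) = 0 by exact: (multilinear0 [::]).
have sizeE q' Q' u : alt_map (q' + 1) Q' -> Q' u <> 0 -> (size u)%:Z = q' + 1.
  by move=> altQ' Qu; have [//|/(alt_map_size altQ')] := eqVneq (size u)%:Z (q' + 1).
(* A sign given by the length of the block fed to [Q'] may be computed from its arity, since other
   lengths give 0. *)
have signQ q' Q' u v (c : int -> K) : alt_map (q' + 1) Q' ->
    c (size u) *: P (Q' u :: v) = c (q' + 1) *: P (Q' u :: v).
  move=> altQ'; have [->|/eqP/(sizeE _ _ _ altQ')-> //] := eqVneq (Q' u) 0.
  by rewrite P0 !scaler0.
have assocE q' Q' R' : alt_map (q' + 1) Q' ->
    associator P Q' R' = fun s => (-1) ^ (q' + 1) *: T Q' R' s.
  move=> altQ'; apply/funext => s; rewrite /associator !fctE; apply/eqP.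
  rewrite subr_eq addrC; apply/eqP; rewrite [LHS]/nr_comp.
  rewrite [LHS](_ : _ = altsum (fun u v =>
    altsum (fun v1 v2 => P (Q' (R' u :: v1) :: v2)) v +
    altsum (fun v1 v2 => (-1) ^ (1 * wdeg odd_deg v1) *: P (Q' v1 :: R' u :: v2)) v) s) //.
  rewrite shsumD -shsum_assoc; congr (_ + _).
    apply: eq_shsum => u v; rewrite -(linear_shsum _ (f := fun x => P (x :: v))) //.
    by move=> *; apply: (linP [::]).
  rewrite -shsumZ; apply: eq_shsum => u v; rewrite -shsumZ; apply: eq_shsum => v1 v2.
  by rewrite mul1r wdeg_size; apply: (signQ _ _ _ _ (fun n => (-1) ^ n)).
move=> altQ altR; rewrite (assocE _ _ _ altQ) (assocE _ _ _ altR).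
apply/funext => s; rewrite !fctE.
suff -> : T R Q s = - (-1) ^ ((q + 1) * (r + 1)) *: T Q R s.
  by rewrite !scalerA; congr (_ *: _); signs.
rewrite /T scaleNr -scaleN1r -!shsum_assoc -!shsumZ; apply: eq_shsum => u v.
rewrite shsumC -!shsumZ; apply: eq_shsum => u1 u2.
rewrite (alternating_swap [::]) // scalerN scaleN1r !wdeg_size; congr (- _).
rewrite (signQ _ _ _ _ (fun n => (-1) ^ ((size u1)%:Z * n)) altQ).
rewrite -[P _]opprK -(alternating_swap [::]) // !scalerN; congr (- _).
by rewrite (signQ _ _ _ _ (fun n => (-1) ^ (n * _)) altR) mulrC.
Qed.
End NijenhuisRichardson.

(** * The graded Lie algebra L *)

Section NijenhuisRichardsonBracket.
Variables (K : fieldType) (g V : lmodType K).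
Local Notation W := (g * V)%type.
Local Notation cochains := (seq W -> W).
Implicit Types (P Q R : cochains) (p q r : int).

Lemma compBl a P P' Q : nr_comp (P - a *: P') Q = nr_comp P Q - a *: nr_comp P' Q.
Proof. by rewrite addrC -scaleNr compPl scaleNr addrC. Qed.

Lemma compBr a P Q Q' : multilinear P ->
  nr_comp P (Q - a *: Q') = nr_comp P Q - a *: nr_comp P Q'.
Proof. by move=> linP; rewrite addrC -scaleNr compPr // scaleNr addrC. Qed.

Lemma NRE p q P Q : alt_map (p + 1) P -> alt_map (q + 1) Q ->
  NR (p, P) (q, Q) = nr_comp P Q - (-1) ^ (p * q) *: nr_comp Q P.
Proof.
move=> altP altQ; rewrite /NR /= (circE (q := q)) //; last exact: alt_map_multilinear altP.
by rewrite (circE (q := p)) //; apply: alt_map_multilinear altQ.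
Qed.

Lemma NR_alt_map p q P Q : alt_map (p + 1) P -> alt_map (q + 1) Q ->
  alt_map (p + q + 1) (NR (p, P) (q, Q)).
Proof.
move=> altP altQ; rewrite NRE // [nr_comp P Q - _]addrC -scaleNr; apply: alt_mapL.
  by rewrite [p + q]addrC; apply: comp_alt_map.
exact: comp_alt_map.
Qed.

Lemma NRC p q P Q : NR (p, P) (q, Q) = - (-1) ^ (p * q) *: NR (q, Q) (p, P).
Proof.
rewrite /NR /= [q * p]mulrC; move: (circ _ P Q) (circ _ Q P) => X Y.
rewrite scalerBr !scaleNr scalerA.
suff -> : (-1) ^ (p * q) * (-1) ^ (p * q) = 1 :> K by rewrite scale1r; zmod.
by signs.
Qed.

Lemma NRPl p q a P P' Q :
  alt_map (p + 1) P -> alt_map (p + 1) P' -> alt_map (q + 1) Q ->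
  NR (p, a *: P + P') (q, Q) = a *: NR (p, P) (q, Q) + NR (p, P') (q, Q).
Proof.
move=> altP altP' altQ; rewrite !NRE //; last exact: alt_mapL.
rewrite compPl compPr; last exact: alt_map_multilinear altQ.
rewrite scalerDr scalerBr !scalerA mulrC; zmod.
Qed.

Lemma NRPr p q a P Q Q' :
  alt_map (p + 1) P -> alt_map (q + 1) Q -> alt_map (q + 1) Q' ->
  NR (p, P) (q, a *: Q + Q') = a *: NR (p, P) (q, Q) + NR (p, P) (q, Q').
Proof.
move=> altP altQ altQ'; rewrite !NRE //; last exact: alt_mapL.
rewrite compPl compPr; last exact: alt_map_multilinear altP.
rewrite scalerDr scalerBr !scalerA mulrC; zmod.
Qed.

(** The variables stand for the twelve triple compositions, [pq_r] for (P Q) R and [p_qr] for P (Q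
    R). The hypotheses are the three symmetries of the associator, which eliminate three of the
    variables. *)
Lemma leibniz_identity (M : lmodType K) p q r
    (pq_r p_qr pr_q p_rq qp_r q_pr qr_p q_rp rp_q r_pq rq_p r_qp : M) :
  pq_r - p_qr = (-1) ^ (q * r) *: (pr_q - p_rq) ->
  qp_r - q_pr = (-1) ^ (p * r) *: (qr_p - q_rp) ->
  rp_q - r_pq = (-1) ^ (p * q) *: (rq_p - r_qp) ->
  pq_r - (-1) ^ (p * q) *: qp_r -
      (-1) ^ ((p + q) * r) *: (r_pq - (-1) ^ (p * q) *: r_qp) =
    p_qr - (-1) ^ (q * r) *: p_rq -
      (-1) ^ (p * (q + r)) *: (qr_p - (-1) ^ (q * r) *: rq_p) +
    (-1) ^ (q * r) *: (pr_q - (-1) ^ (p * r) *: rp_q -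
      (-1) ^ ((p + r) * q) *: (q_pr - (-1) ^ (p * r) *: q_rp)).
Proof.
move=> /eqP + /eqP + /eqP; rewrite !subr_eq => /eqP-> /eqP-> /eqP->.
rewrite !signzE !zoddE; case: (zodd p); case: (zodd q); case: (zodd r);
  rewrite /= ?expr0 ?expr1 ?scale1r ?scaleN1r; zmod.
Qed.

(** The Jacobi identity in the form that makes bracketing with [R] from the right a graded
    derivation, as iterated right brackets require. *)
Lemma NR_leibniz p q r P Q R :
  alt_map (p + 1) P -> alt_map (q + 1) Q -> alt_map (r + 1) R ->
  NR (p + q, NR (p, P) (q, Q)) (r, R) =
    NR (p, P) (q + r, NR (q, Q) (r, R)) +
    (-1) ^ (q * r) *: NR (p + r, NR (p, P) (r, R)) (q, Q).
Proof.
move=> altP altQ altR.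
have aP := alt_map_alternating altP; have [lP _] := aP.
have aQ := alt_map_alternating altQ; have [lQ _] := aQ.
have aR := alt_map_alternating altR; have [lR _] := aR.
rewrite ![NR (_ + _, _) _]NRE ?[NR _ (_ + _, _)]NRE //; try exact: NR_alt_map.
rewrite !NRE // !compBl !compBr //.
by apply: leibniz_identity; apply: associator_symm.
Qed.

(** * The abelian subalgebra h and the projection onto it *)

Section LiftProjection.
Implicit Types (theta phi : seq V -> g) (vs : seq V).

Lemma lift_hE theta (s : seq W) : lift_h theta s = (theta [seq w.2 | w <- s], 0).
Proof.
rewrite /lift_h /lift_map (big_pred1 1%g) => [|t]; last exact: shuffle0.
by rewrite odd_perm1 expr0 scale1r drop0 permuted1.
Qed.

Lemma lift_h_linear a theta phi :
  lift_h (a *: theta + phi) = a *: lift_h theta + lift_h phi.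
Proof.
apply/funext => s; rewrite !fctE !lift_hE; congr (_, _).
by rewrite /= scaler0 addr0.
Qed.

Lemma proj_h_linear a P Q : proj_h (a *: P + Q) = a *: proj_h P + proj_h Q.
Proof. by apply/funext => vs; rewrite !fctE. Qed.

Lemma proj_h0 : proj_h (0 : cochains) = 0. Proof. by []. Qed.

Lemma proj_hD P Q : proj_h (P + Q) = proj_h P + proj_h Q.
Proof. by rewrite -[P]scale1r proj_h_linear !scale1r. Qed.

Lemma proj_hZ a P : proj_h (a *: P) = a *: proj_h P.
Proof. by rewrite -[a *: P]addr0 proj_h_linear proj_h0 addr0. Qed.

Lemma alt_map_lift_h m theta : alt_map m theta -> alt_map m (lift_h theta).
Proof.
move=> [sz lin alt]; split=> [s szs|s1 s2 a x y|s us]; rewrite !lift_hE.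
- by rewrite sz // size_map.
- rewrite !map_cat /= lin; congr (_, _).
  by rewrite /= scaler0 addr0.
- by rewrite alt //; apply: contra us; apply: map_uniq.
Qed.

Lemma alt_map_proj_h m P : alt_map m P -> alt_map m (proj_h P).
Proof.
move=> [sz lin alt]; split=> [s szs|s1 s2 a x y|s us]; rewrite /proj_h.
- by rewrite sz // size_map.
- rewrite !map_cat /= (_ : in_V g _ = a *: in_V g x + in_V g y) ?lin //.
  by congr (_, _); rewrite /= scaler0 addr0.
- by rewrite alt //; apply: contra us; apply: map_uniq.
Qed.

(** A lift has values in g and reads only V-components, so a lift inserted into another one feeds
    [theta] a zero. *)
Lemma comp_lift_h theta phi : multilinear theta -> nr_comp (lift_h theta) (lift_h phi) = 0.
Proof.
move=> lin; apply/funext => s; rewrite -[RHS](shsum0 (fun=> 1) _ s).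
by apply: eq_shsum => u v; rewrite !lift_hE /= (multilinear0 [::]).
Qed.

Lemma NR_lift_h p q theta phi : alt_map (p + 1) theta -> alt_map (q + 1) phi ->
  NR (p, lift_h theta) (q, lift_h phi) = 0.
Proof.
move=> altT altP; rewrite NRE; do ?exact: alt_map_lift_h.
by rewrite !comp_lift_h ?scaler0 ?subr0 //; apply: alt_map_multilinear; eassumption.
Qed.

Lemma proj_comp P Q : proj_h P = 0 -> proj_h Q = 0 -> proj_h (nr_comp P Q) = 0.
Proof.
move=> P0 Q0; apply/funext => vs; rewrite /proj_h /nr_comp.
have fstP : forall a (x y : W), (a *: x + y).1 = a *: x.1 + y.1 by [].
rewrite (linear_shsum _ _ _ fstP) -[RHS](shsum0 (fun=> 1) _ [seq in_V g v | v <- vs]).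
apply: eq_shsum_perm => u v uv.
(* Both blocks consist of arguments from V. The value of [Q] then lies in V, and [P] sees only
   arguments from V. *)
have inV w : {subset w <= u ++ v} -> w = [seq in_V g x | x <- [seq x.2 | x <- w]].
  move=> sub_w; rewrite -map_comp -[LHS]map_id; apply/eq_in_map => x /sub_w.
  by rewrite (perm_mem uv) => /mapP[y _ ->].
have {1}-> : u = [seq in_V g x | x <- [seq x.2 | x <- u]].
  by apply: inV => x xu; rewrite mem_cat xu.
have -> : v = [seq in_V g x | x <- [seq x.2 | x <- v]].
  by apply: inV => x xv; rewrite mem_cat xv orbT.
move: (map _ u) (map _ v) => us vs'.
have := congr1 (@^~ us) Q0; rewrite /proj_h; case: (Q _) => x y /= ->.
by have := congr1 (@^~ (y :: vs')) P0; rewrite /proj_h.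
Qed.

Lemma proj_NR0 p q P Q : alt_map (p + 1) P -> alt_map (q + 1) Q ->
  proj_h P = 0 -> proj_h Q = 0 -> proj_h (NR (p, P) (q, Q)) = 0.
Proof.
move=> altP altQ P0 Q0; rewrite NRE // proj_hD -scaleNr proj_hZ.
by rewrite !proj_comp // scaler0 addr0.
Qed.

(* The kernel of proj_h is a subalgebra and the image of lift_h an abelian one. *)
Lemma proj_NR p q P Q : alt_map (p + 1) P -> alt_map (q + 1) Q ->
  proj_h (NR (p, P) (q, Q)) = proj_h (NR (p, lift_h (proj_h P)) (q, Q)) +
    proj_h (NR (p, P) (q, lift_h (proj_h Q))).
Proof.
move=> altP altQ.
have altP1 := alt_map_lift_h (alt_map_proj_h altP).
have altQ1 := alt_map_lift_h (alt_map_proj_h altQ).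
have NR1 := NR_lift_h (alt_map_proj_h altP) (alt_map_proj_h altQ).
set P1 := lift_h (proj_h P) in altP1 NR1 *; set Q1 := lift_h (proj_h Q) in altQ1 NR1 *.
(* [P0] and [Q0] are the components in the kernel of [proj_h]. Their bracket projects to 0, and
   expanding it with [P1, Q1] = 0 gives the claim. *)
pose P0 := -1 *: P1 + P; pose Q0 := -1 *: Q1 + Q.
have altP0 : alt_map (p + 1) P0 by exact: alt_mapL.
have altQ0 : alt_map (q + 1) Q0 by exact: alt_mapL.
have projP0 : proj_h P0 = 0 by rewrite proj_h_linear lift_hK scaleN1r addNr.
have projQ0 : proj_h Q0 = 0 by rewrite proj_h_linear lift_hK scaleN1r addNr.
have := proj_NR0 altP0 altQ0 projP0 projQ0.
rewrite NRPl // !NRPr // NR1.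
move: (NR _ _) (NR _ _) (NR _ _) => X Y Z; rewrite !proj_h_linear proj_h0 scaler0 add0r.
by rewrite !scaleN1r addrA -opprD addrC => /subr0_eq ->.
Qed.

End LiftProjection.

(** * Bidegrees as scaling weights *)

Section Weight.
Implicit Types (theta : seq V -> g) (s : seq W) (k l : int).

Definition dilate (w : W) : W := (2%:R *: w.1, w.2).

(* The grading of [bidegree k _] by k, read off from the action of the
   automorphism (x, v) |-> (2 x, v). *)
Definition weight k P := forall s,
  P [seq dilate w | w <- s] = 2%:R ^ k *: dilate (P s).

Hypothesis K0 : [pchar K] =i pred0.

Lemma natr_neq0 n : (n.+1)%:R != 0 :> K.
Proof. by have [charK _] := pcharf0P K; rewrite charK. Qed.

Lemma two_neq0 : 2%:R != 0 :> K. Proof. exact: natr_neq0. Qed.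

(** In characteristic 0 the positive integer 2^n - 1 stays nonzero for n > 0; this is what separates
    different weights. *)
Lemma exp2z_neq1 k : k != 0 -> 2%:R ^ k != 1 :> K.
Proof.
have exp2 n : 2%:R ^+ n.+1 != 1 :> K.
  rewrite -natrX -subr_eq0 -[1]/(1%:R) -natrB ?expn_gt0 //.
  have : (2 ^ n.+1 - 1 = (2 ^ n.+1 - 2).+1)%N.
    by have := @leq_pexp2l 2 1 n.+1 isT isT; lia.
  by move=> ->; apply: natr_neq0.
case: k => [[|n]|n] // _; first exact: exp2.
by rewrite NegzE -exprnN invr_eq1.
Qed.

Lemma exp2zS k : 2%:R ^ k * 2%:R = 2%:R ^ (k + 1) :> K.
Proof. by rewrite expfzDr ?two_neq0 // expr1z. Qed.

Lemma dilate_linear a (x y : W) : dilate (a *: x + y) = a *: dilate x + dilate y.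
Proof. by congr (_, _); rewrite /= scalerDr !scalerA mulrC. Qed.

Lemma shsum_map (X Y : eqType) (dX : X -> int) (dY : Y -> int) (h : X -> Y)
    (B : lmodType K) (G : seq Y -> seq Y -> B) (s : seq X) :
  (forall x, dY (h x) = dX x) ->
  shsum dY G (map h s) = shsum dX (fun u v => G (map h u) (map h v)) s.
Proof.
move=> dh; have wh u : wdeg dY (map h u) = wdeg dX u.
  by elim: u => [|x u IHu]; rewrite ?wdeg_nil // !wdeg_cons IHu dh.
elim: s G => //= x s IHs G; rewrite !IHs; congr (_ + _).
by apply: eq_shsum => u v; rewrite wh dh.
Qed.

Lemma weight_comp k l P Q : multilinear P ->
  weight k P -> weight l Q -> weight (k + l) (nr_comp P Q).
Proof.
move=> linP wP wQ s; rewrite /nr_comp (shsum_map _ (dX := fun=> 1)) //.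
rewrite (linear_shsum _ _ _ dilate_linear) -shsumZ; apply: eq_shsum => u v.
rewrite wQ (multilinearZ [::] _ _ _ linP) /= -map_cons wP scalerA.
by rewrite mulrC expfzDr ?two_neq0.
Qed.

Lemma weightP k a P Q : weight k P -> weight k Q -> weight k (a *: P + Q).
Proof.
move=> wP wQ s; rewrite !fctE wP wQ dilate_linear.
by rewrite scalerDr !scalerA mulrC.
Qed.

Lemma weight0 k : weight k 0.
Proof.
move=> s; rewrite -[RHS]/(2%:R ^ k *: dilate 0).
by congr (_, _); rewrite /= !scaler0.
Qed.

Lemma weight_NR k l p q P Q : alt_map (p + 1) P -> alt_map (q + 1) Q ->
  weight k P -> weight l Q -> weight (k + l) (NR (p, P) (q, Q)).
Proof.
move=> altP altQ wP wQ; rewrite NRE // [nr_comp P Q - _]addrC -scaleNr; apply: weightP.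
  by rewrite addrC; apply: weight_comp => //; apply: alt_map_multilinear altQ.
by apply: weight_comp => //; apply: alt_map_multilinear altP.
Qed.

Lemma weight_lift_h theta : weight (-1) (lift_h theta).
Proof.
move=> s; rewrite !lift_hE -map_comp; congr (_, _); last by rewrite /= scaler0.
by rewrite /= scalerA mulVf ?two_neq0 // scale1r.
Qed.

(** The dilation fixes arguments from V, so the g-component x of the value satisfies x = 2^(k + 1)
    x. *)
Lemma proj_weight k P : k != -1 -> weight k P -> proj_h P = 0.
Proof.
move=> kN1 wP; apply/funext => vs; have := wP [seq in_V g v | v <- vs].
rewrite -map_comp (@eq_map _ _ _ (@in_V K g V)) => [|v]; last first.
  by congr (_, _); rewrite /= scaler0.
move/(congr1 fst); rewrite /= scalerA exp2zS -/(proj_h P vs) => /eqP.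
rewrite -subr_eq0 -{1}[proj_h P vs]scale1r -scalerBl scaler_eq0 subr_eq0 eq_sym.
by rewrite (negPf (exp2z_neq1 _)) ?addr_eq0 // => /eqP.
Qed.

(** Each argument is the sum of its parts in g and V; by alternation the part in g moves to the
    front past the arguments from V. *)
Lemma alternating_sorted0 (P : cochains) : alternating P ->
  (forall (xs : seq g) (vs : seq V),
     P ([seq in_g V x | x <- xs] ++ [seq in_V g v | v <- vs]) = 0) -> P = 0.
Proof.
move=> [linP altP] P0; apply/funext => s.
have moveg xs vs s' x : P ([seq in_g V x | x <- xs] ++ in_g V x :: [seq in_V g v | v <-
  vs] ++ s') = 0 ->
  P ([seq in_g V x | x <- xs] ++ [seq in_V g v | v <- vs] ++ in_g V x :: s') = 0.
  elim/last_ind: vs s' => [//|vs v IHvs] s'.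
  rewrite map_rcons !cat_rcons => Px;
    rewrite catA (alternating_swap _ _ _ _ (conj linP altP)) -catA IHvs ?oppr0 //.
suff Ps xs vs s' : P ([seq in_g V x | x <- xs] ++ [seq in_V g v | v <- vs] ++ s') = 0.
  exact: (Ps [::] [::]).
elim: s' xs vs => [|w s' IHs] xs vs; first by rewrite cats0.
have -> : w = in_g V w.1 + in_V g w.2.
  by case: w => x v; congr (_, _); rewrite /= ?addr0 ?add0r.
rewrite catA multilinearD // -!catA -[in X in _ + X]cat_rcons -map_rcons IHs addr0.
by rewrite moveg // -cat_rcons -map_rcons.
Qed.

Lemma alternating_scale P a (xs : seq g) (s : seq W) : multilinear P ->
  P ([seq in_g V (a *: x) | x <- xs] ++ s) = a ^+ size xs *: P ([seq in_g V x | x <-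
    xs] ++ s).
Proof.
move=> linP; rewrite -[LHS]/(P ([::] ++ _)) -[in RHS]/(P ([::] ++ _)).
elim: xs [::] => [|x xs IHx] t /=; first by rewrite scale1r.
rewrite (_ : in_g V (a *: x) = a *: in_g V x); last by congr (_, _); rewrite /= scaler0.
by rewrite multilinearZ // -!cat_rcons IHx scalerA -exprS.
Qed.

Lemma dilate_sorted (xs : seq g) (vs : seq V) :
  [seq dilate w | w <- [seq in_g V x | x <- xs] ++ [seq in_V g v | v <- vs]] =
  [seq in_g V (2%:R *: x) | x <- xs] ++ [seq in_V g v | v <- vs].
Proof.
rewrite map_cat -!map_comp; congr (_ ++ _); apply: eq_map => x; congr (_, _).
by rewrite /= scaler0.
Qed.

(* [alt_map] fixes the total number of arguments, the weight the number of those
   in g. *)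
Lemma bidegree_weight (n : int) P :
  bidegree n 0 P <-> alt_map (n + 1) P /\ weight n P.
Proof.
rewrite /bidegree /= addr0; split=> -[altP bP]; split=> //.
  have linP := alt_map_multilinear altP.
  (* The defect of the weight equation is itself alternating, so it may be tested on sorted lists,
     where [bidegree] applies. *)
  have: (P \o map dilate) + (- 2%:R ^ n) *: (dilate \o P) = 0.
    apply: alternating_sorted0 => [|xs vs].
      split=> [s1 s2 a x y|s us].
        rewrite !fctE /= !map_cat /= dilate_linear !linP dilate_linear !scalerDr !scalerA.
        by rewrite mulrC; zmod.
      have [_ altP0] := alt_map_alternating altP; rewrite !fctE /= !altP0 //.
        by rewrite add0r; congr (_, _); rewrite /= !scaler0.
      apply: contra us; apply: map_uniq.
    rewrite !fctE /= dilate_sorted alternating_scale //.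
    have [/= gP VP] := bP xs vs; move: (P _) gP VP => [x v] /= gP VP.
    congr (_, _).
      have [szx|/gP->] := eqVneq ((size xs)%:Z, (size vs)%:Z) (n + 1, 0);
        last by rewrite /= !scaler0 addr0.
      case: szx => szx _; rewrite /= exprnP szx scalerA mulNr exp2zS scaleNr.
      by rewrite subrr.
    have [szx|/VP->] := eqVneq ((size xs)%:Z, (size vs)%:Z) (n, 0 + 1);
      last by rewrite /= !scaler0 addr0.
    case: szx => szx _; rewrite /= exprnP szx scaleNr.
    by rewrite subrr.
  move=> eq0 s; have := congr1 (@^~ s) eq0; rewrite !fctE /= scaleNr.
  by move/eqP; rewrite subr_eq0 => /eqP.
move=> xs vs; set y := P _; have :=
  bP ([seq in_g V x | x <- xs] ++ [seq in_V g v | v <- vs]).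
rewrite dilate_sorted alternating_scale; last exact: alt_map_multilinear altP.
have sz0 : (size xs + size vs)%:Z != n + 1 -> y = 0.
  by move=> szn; apply: alt_map_size altP _; rewrite size_cat !size_map.
rewrite -/y => Py;
have Eg : 2%:R ^ (size xs)%:Z *: y.1 = 2%:R ^ (n + 1) *: y.1.
  by have /= := congr1 fst Py; rewrite scalerA exp2zS.
have EV : 2%:R ^ (size xs)%:Z *: y.2 = 2%:R ^ n *: y.2 by have /= := congr1 snd Py.
(* Distinct powers of 2 cannot scale a nonzero vector equally. A nonzero component thus fixes the
   number of arguments from g, and the total length then fixes the number from V. *)
have exp0 (B : lmodType K) (z : B) (k l : int) : 2%:R ^ k *: z = 2%:R ^ l *: z -> k !=
  l -> z = 0.
  move=> eqz neq_kl; apply/eqP; move/eqP: eqz.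
  rewrite -subr_eq0 -scalerBl scaler_eq0 => /orP[|//].
  rewrite -[k](subrK l) expfzDr ?two_neq0 // -{2}[_ ^ l]mul1r -mulrBl mulf_eq0.
  by rewrite expfz_eq0 (negPf two_neq0) andbF orbF subr_eq0 (negPf (exp2z_neq1 _)) //
    subr_eq0.
split=> [szg|szV].
  have [szx|/(exp0 _ _ _ _ Eg)//] := eqVneq (size xs)%:Z (n + 1).
  rewrite sz0 //; apply: contra_neq szg; rewrite PoszD -szx => /eqP.
  by rewrite -subr_eq0 addrC addKr => /eqP ->; rewrite szx.
have [szx|/(exp0 _ _ _ _ EV)//] := eqVneq (size xs)%:Z n.
rewrite sz0 //; apply: contra_neq szV; rewrite PoszD -szx add0r.
by move/addrI->.
Qed.

End Weight.
End NijenhuisRichardsonBracket.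

(** * The L-infinity algebra on the middle term *)

Section ShsumExchange.
Variables (K : fieldType) (X : eqType) (dg : X -> int) (B : lmodType K).

Lemma shsum_exchange (G : seq X -> seq X -> seq X -> seq X -> B) s t :
  shsum dg (fun u v => shsum dg (G u v) t) s =
  shsum dg (fun u' v' => shsum dg (fun u v => G u v u' v') s) t.
Proof.
elim: s G => //= x s IHs G; rewrite shsumD !IHs; congr (_ + _).
by rewrite -IHs; apply: eq_shsum => u v; rewrite -shsumZ.
Qed.

End ShsumExchange.

(** * Nested brackets with elements of h *)

Section BracketWords.
Variables (K : fieldType) (g V : lmodType K).
Hypothesis K0 : [pchar K] =i pred0.
Local Notation W := (g * V)%type.
Local Notation cochains := (seq W -> W).
Local Notation letter := (int * (cochains * (seq V -> g)))%type.
Implicit Types (P Q R : cochains) (theta : seq V -> g) (p q r : int).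
Implicit Types (x y z : letter) (s u v : seq letter).

Local Notation deg := (wdeg (@fst int (cochains * (seq V -> g)))).
Local Notation sh := (shsum (@fst int (cochains * (seq V -> g)))).

(** Negative degrees are forced to be zero, as in [Lprime] and [hspace]; in degree -1 this excludes
    the maps without arguments. *)
Definition graded_cochain (n : int) (P : cochains) : Prop :=
  if 0 <= n then alt_map (n + 1) P else P = 0.

Lemma graded_alt_map n P : graded_cochain n P -> alt_map (n + 1) P.
Proof. by rewrite /graded_cochain; case: ifP => // _ ->; apply: alt_map0. Qed.

Lemma graded0 n : graded_cochain n 0.
Proof. by rewrite /graded_cochain; case: ifP => // _; apply: alt_map0. Qed.

Lemma NR0l p q Q : alt_map (q + 1) Q -> NR (p, 0) (q, Q) = 0.
Proof.
move=> altQ; have := NRPl (-1) (@alt_map0 K _ _ (p + 1)) (@alt_map0 K _ _ _) altQ.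
by rewrite scaler0 addr0 scaleN1r addNr.
Qed.

Lemma NR0r p q P : alt_map (p + 1) P -> NR (p, P) (q, 0) = 0.
Proof. by move=> altP; rewrite NRC NR0l // scaler0. Qed.

Lemma graded_NR p q P Q : graded_cochain p P -> graded_cochain q Q ->
  graded_cochain (p + q) (NR (p, P) (q, Q)).
Proof.
move=> gP gQ; have altP := graded_alt_map gP; have altQ := graded_alt_map gQ.
have [p0|p0] := boolP (0 <= p); last first.
  by move: gP; rewrite {1}/graded_cochain (negPf p0) => ->; rewrite NR0l //; apply: graded0.
have [q0|q0] := boolP (0 <= q); last first.
  by move: gQ; rewrite {1}/graded_cochain (negPf q0) => ->; rewrite NR0r //; apply: graded0.
by rewrite /graded_cochain addr_ge0 //; apply: NR_alt_map.
Qed.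

Definition good_letter x := @gv_deg K (middle_space g V) x.1 x.2.
Local Notation good s := {in s, forall x, good_letter x}.

Lemma good_cochain x : good_letter x -> graded_cochain (x.1 + 1) x.2.1.
Proof.
case=> + _; rewrite /= /ge_deg /graded_cochain; case: ifP => // _.
by move=> /(bidegree_weight K0)[].
Qed.

Lemma good_alt x : good_letter x -> alt_map (x.1 + 1 + 1) x.2.1.
Proof. by move/good_cochain/graded_alt_map. Qed.

Lemma good_weight x : good_letter x -> weight (x.1 + 1) x.2.1.
Proof.
case=> + _; rewrite /= /ge_deg; case: ifP => [_ /(bidegree_weight K0)[]//|_ ->].
exact: weight0.
Qed.

Lemma good_proj x : good_letter x -> proj_h x.2.1 = 0.
Proof.
case=> + _; rewrite /= /ge_deg; case: ifP => [x0 /(bidegree_weight K0)[_]|_ -> //].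
by apply: (proj_weight K0); rewrite gt_eqF // (lt_le_trans _ x0).
Qed.

Lemma good_lift x : good_letter x -> graded_cochain x.1 (lift_h x.2.2).
Proof.
case=> _; rewrite /= /ge_deg /graded_cochain; case: ifP => _.
  exact: alt_map_lift_h.
by move=> ->; apply/funext => s; rewrite lift_hE.
Qed.

Lemma good_theta x : good_letter x -> alt_map (x.1 + 1) x.2.2.
Proof.
by case=> _; rewrite /= /ge_deg; case: ifP => // _ ->; apply: alt_map0.
Qed.

Definition bracket_word (q : int) (Q : cochains) (s : seq letter) : cochains :=
  (foldl (@NRd K g V) (q, Q) [seq (y.1, lift_h y.2.2) | y <- s]).2.
Local Notation Br := bracket_word.

Lemma Br_nil q Q : Br q Q [::] = Q. Proof. by []. Qed.

Lemma Br_cons q Q y s :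
  Br q Q (y :: s) = Br (q + y.1) (NR (q, Q) (y.1, lift_h y.2.2)) s.
Proof. by []. Qed.

Lemma foldl_NRd_deg q Q s :
  (foldl (@NRd K g V) (q, Q) [seq (y.1, lift_h y.2.2) | y <- s]).1 = q + deg s.
Proof.
elim: s q Q => [|y s IHs] q Q; first by rewrite wdeg_nil addr0.
by rewrite /= IHs wdeg_cons addrA.
Qed.

Lemma Br_rcons q Q s y :
  Br q Q (rcons s y) = NR (q + deg s, Br q Q s) (y.1, lift_h y.2.2).
Proof.
rewrite /Br map_rcons -cats1 foldl_cat /= -(foldl_NRd_deg _ Q).
by case: (foldl _ _ _).
Qed.

Lemma Br_cat q Q s t : Br q Q (s ++ t) = Br (q + deg s) (Br q Q s) t.
Proof. by rewrite /Br map_cat foldl_cat -(foldl_NRd_deg q Q);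
  case: (foldl _ _ (map _ s)). Qed.

Lemma graded_Br q Q s : graded_cochain q Q -> good s ->
  graded_cochain (q + deg s) (Br q Q s).
Proof.
elim: s q Q => [|y s IHs] q Q gQ gs; first by rewrite wdeg_nil addr0.
rewrite Br_cons wdeg_cons addrA; apply: IHs (goods_behead gs).
exact: graded_NR (good_lift (goods_head gs)).
Qed.

Lemma weight_Br k q Q s : graded_cochain q Q -> good s -> weight k Q ->
  weight (k - (size s)%:Z) (Br q Q s).
Proof.
elim: s k q Q => [|y s IHs] k q Q gQ gs wQ; first by rewrite subr0.
have gy := good_lift (goods_head gs).
rewrite Br_cons /= intS opprD addrA; apply: IHs (goods_behead gs) _.
  exact: graded_NR.
by apply: weight_NR => //; [exact: graded_alt_map..|exact: weight_lift_h].
Qed.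

Lemma BrP a q P Q s : graded_cochain q P -> graded_cochain q Q -> good s ->
  Br q (a *: P + Q) s = a *: Br q P s + Br q Q s.
Proof.
elim: s q P Q => // y s IHs q P Q gP gQ gs.
have gy := good_lift (goods_head gs).
rewrite !Br_cons NRPl; do ?exact: graded_alt_map.
by rewrite IHs //; [exact: graded_NR..|exact: goods_behead gs].
Qed.

Lemma Br0 q s : good s -> Br q 0 s = 0.
Proof.
move=> gs; have := BrP (-1) (graded0 q) (graded0 q) gs.
by rewrite scaler0 addr0 scaleN1r addNr.
Qed.

Lemma BrZ a q P s : graded_cochain q P -> good s -> Br q (a *: P) s = a *: Br q P s.
Proof.
by move=> gP gs; rewrite -[a *: P]addr0 BrP // ?Br0 ?addr0 //; apply: graded0.
Qed.

Lemma Br_lin a q Q s1 s2 x y z : graded_cochain q Q ->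
  x.1 = z.1 -> y.1 = z.1 -> z.2.2 = a *: x.2.2 + y.2.2 ->
  good_letter x -> good_letter y -> good s1 -> good s2 ->
  Br q Q (s1 ++ z :: s2) = a *: Br q Q (s1 ++ x :: s2) + Br q Q (s1 ++ y :: s2).
Proof.
move=> gQ xz yz zE gx gy gs1 gs2; rewrite !Br_cat !Br_cons xz yz zE lift_h_linear.
have {}gQ := graded_Br gQ gs1.
have lx := good_lift gx; have ly := good_lift gy; rewrite xz in lx; rewrite yz in ly.
rewrite NRPr; do ?exact: graded_alt_map.
by apply: BrP => //; apply: graded_NR.
Qed.

(** In the Leibniz rule for [[Q, x], y] the term [Q, [x, y]] vanishes because h is abelian. *)
Lemma Br_swap q Q s1 x y s2 : graded_cochain q Q -> good (s1 ++ x :: y :: s2) ->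
  Br q Q (s1 ++ x :: y :: s2) = (-1) ^ (x.1 * y.1) *: Br q Q (s1 ++ y :: x :: s2).
Proof.
move=> gQ gs; have gs1 := goods_catl gs; have gs2 := goods_catr gs.
have gx := goods_head gs2; have gy := goods_head (goods_behead gs2).
have {}gs2 := goods_behead (goods_behead gs2).
rewrite !Br_cat !Br_cons; have {gQ gs1}gQ := graded_Br gQ gs1.
have lx := good_lift gx; have ly := good_lift gy.
move: (q + deg s1) (Br _ _ _) gQ => {}q {}Q gQ.
rewrite NR_leibniz; do ?exact: graded_alt_map.
rewrite NR_lift_h; do ?exact: good_theta.
rewrite NR0r; last exact: graded_alt_map.
rewrite add0r BrZ //; first by rewrite [q + y.1 + _]addrAC.
by rewrite addrAC; apply: graded_NR => //; apply: graded_NR.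
Qed.

Lemma Br_front q Q s1 x s2 : graded_cochain q Q -> good (s1 ++ x :: s2) ->
  Br q Q (s1 ++ x :: s2) = (-1) ^ (x.1 * deg s1) *: Br q Q (x :: s1 ++ s2).
Proof.
move=> gQ; apply: (@adjacent_symm_front K _ fst _ good_letter (Br q Q)).
by move=> t1 y z t2; apply: Br_swap.
Qed.

(** By the derivation rule each letter acts on one of the two factors; the letters [u] acting on [P]
    pass [Q], whence the sign. *)
Lemma Br_leibniz p q P Q s : graded_cochain p P -> graded_cochain q Q -> good s ->
  Br (p + q) (NR (p, P) (q, Q)) s =
  sh (fun u v => (-1) ^ (q * deg u) *:
        NR (p + deg u, Br p P u) (q + deg v, Br q Q v)) s.
Proof.
elim: s p q P Q => [|y s IHs] p q P Q gP gQ gs.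
  by rewrite /= wdeg_nil mulr0 expr0z scale1r !addr0.
have ly := good_lift (goods_head gs); have {}gs := goods_behead gs.
have altP := graded_alt_map gP; have altQ := graded_alt_map gQ.
have alty := graded_alt_map ly.
rewrite Br_cons NR_leibniz // -addrA.
have gPy := graded_NR gP ly; have gQy := graded_NR gQ ly.
have gPQy := graded_NR gP gQy; have gPyQ := graded_NR gPy gQ.
have E : p + (q + y.1) = p + y.1 + q by ring.
rewrite [X in Br _ X _]addrC BrP //; last by rewrite E.
rewrite [Br _ (NR (p, P) _) s]IHs // E [Br _ (NR _ (q, Q)) s]IHs //= -shsumZ; congr (_ + _).
  apply: eq_shsum => u v; rewrite scalerA wdeg_cons addrA Br_cons; congr (_ *: _).
  by signs.
apply: eq_shsum => u v; rewrite scalerA wdeg_cons addrA Br_cons; congr (_ *: _).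
by signs.
Qed.

Lemma good_proj_letter n P : graded_cochain n P -> good_letter (n, (0, proj_h P)).
Proof.
move=> gP; split; first exact: gv_deg0.
move: gP; rewrite /= /ge_deg /graded_cochain; case: ifP => _.
  exact: alt_map_proj_h.
by move=> ->.
Qed.

(** These are the terms of the generalised Jacobi identity in which an operation of [Q] is inserted
    into an operation of [P]. *)
Definition nested_sum p P q Q s : seq V -> g :=
  sh (fun u v => proj_h (Br p P ((q + deg u, (0, proj_h (Br q Q u))) :: v))) s.

(* Voronov's identity P[a, b] = P[Pa, b] + P[a, Pb], summed over all ways to
   distribute s over the two factors. *)
Lemma proj_Br_NR p q P Q s : graded_cochain p P -> graded_cochain q Q -> good s ->
  proj_h (Br (p + q) (NR (p, P) (q, Q)) s) =
  nested_sum p P q Q s - (-1) ^ (p * q) *: nested_sum q Q p P s.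
Proof.
move=> gP gQ gs; rewrite Br_leibniz // (linear_shsum _ _ _ (@proj_h_linear K g V)).
rewrite [nested_sum p P q Q s]shsumC -scaleNr -shsumZ -shsumD.
apply: eq_shsum_perm => u v uvs; have [gu gv] := goods_split uvs gs.
have gPu := graded_Br gP gu; have gQv := graded_Br gQ gv.
have lPu := good_proj_letter gPu; have lQv := good_proj_letter gQv.
rewrite proj_hZ proj_NR; do ?exact: graded_alt_map.
rewrite scalerDr addrC; congr (_ + _).
  (* The bracket with the projected factor is a nested bracket whose last letter is that factor; the
     letter is then moved to the front. *)
  rewrite -[NR (p + deg u, _) _](Br_rcons p P u (_, (0, proj_h (Br q Q v)))) -cats1.
  rewrite Br_front //; last exact: goods_cat gu (goods1 lQv).
  by rewrite cats0 proj_hZ scalerA /=; congr (_ *: _); signs.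
rewrite NRC proj_hZ -[NR (q + deg v, _) _](Br_rcons q Q v (_, (0,
  proj_h (Br p P u)))) -cats1.
rewrite Br_front //; last exact: goods_cat gv (goods1 lPu).
by rewrite cats0 proj_hZ !scalerA /=; congr (_ *: _); signs.
Qed.

End BracketWords.

Lemma shsum_closed (K : fieldType) (X : eqType) (dg : X -> int) (B : lmodType K)
    (S : B -> Prop) (G : seq X -> seq X -> B) s :
  (forall a x y, S x -> S y -> S (a *: x + y)) -> S 0 ->
  (forall u v, perm_eq (u ++ v) s -> S (G u v)) -> S (shsum dg G s).
Proof.
move=> SP S0; have SZ a x : S x -> S (a *: x) by move=> Sx; rewrite -[_ *: _]addr0;
  apply: SP.
elim: s G => [|x s IHs] G SG /=; first exact: SG.
rewrite -[X in X + _]scale1r; apply: (SP); apply: IHs => u v uvs.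
  by apply: SG; rewrite /= perm_cons.
by apply: SZ; apply: SG; rewrite -cat_rcons -cats1 -catA perm_catCA /= perm_cons.
Qed.

(** Summing over the length i of the first block merges the shuffles of all types into one sum over
    splittings; since i starts at 1, an empty first block counts 0. *)
Lemma jacobi_shsum (K : fieldType) (E : higher_ops K) n (x : n.-tuple (int * E)) :
  \sum_(1 <= i < n.+1) \sum_(s : 'S_n | shuffle i s)
     koszul K (fun i => (tnth x i).1) s *:
     (let t := permuted x s in
      ho_op ((degree (take i t) + 1, ho_op (take i t)) :: drop i t)) =
  shsum fst (fun u v => if u is [::] then 0 else
    ho_op ((degree u + 1, ho_op u) :: v)) x.
Proof.
transitivity (\sum_(1 <= i < n.+1) shsum fst (fun u v => if size u == i then
    ho_op ((degree u + 1, ho_op u) :: v) else 0) x).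
  apply: eq_big_nat => i /andP[_ lt_in].
  exact: (sum_shuffle fst x (fun u v => ho_op ((degree u + 1, ho_op u) :: v)) lt_in).
rewrite -shsum_sum; apply: eq_shsum_perm => u v /perm_size.
rewrite size_cat size_tuple => szuv; rewrite -big_mkcond big_nat_cond /=.
case: u szuv => [|y u] szuv; first by rewrite big1 // => i /andP[/andP[i1 _] /eqP i0];
  rewrite -i0 in i1.
rewrite (eq_bigl (fun i => i == size (y :: u))) => [|i].
  rewrite -big_filter (_ : [seq i <- _ | _] = [:: size (y :: u)]) ?big_seq1 //.
  by rewrite /index_iota filter_pred1_uniq ?iota_uniq //
    mem_iota subn1 /= ltnS -szuv leq_addr.
rewrite [RHS]eq_sym andbC; case: eqP => //= <- /=; rewrite ltnS.
by rewrite -szuv leq_addr.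
Qed.

Lemma eq_pair12 (A B : Type) (c d : A * B) : c.1 = d.1 -> c.2 = d.2 -> c = d.
Proof. by case: c d => [a b] [a' b'] /= -> ->. Qed.

Section MiddleOperations.
Variables (K : fieldType) (g V : lmodType K).
Hypothesis K0 : [pchar K] =i pred0.
Local Notation W := (g * V)%type.
Local Notation cochains := (seq W -> W).
Local Notation letter := (int * (cochains * (seq V -> g)))%type.
Implicit Types (P Q R : cochains) (theta : seq V -> g) (p q r : int).
Implicit Types (x y z : letter) (s u v : seq letter).

Local Notation deg := (wdeg (@fst int (cochains * (seq V -> g)))).
Local Notation sh := (shsum (@fst int (cochains * (seq V -> g)))).
Local Notation good_letter := (@good_letter K g V).
Local Notation good s := {in s, forall x, good_letter x}.
Local Notation Br := (@bracket_word K g V).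

Definition pick_bracket u v : seq V -> g :=
  if u is [:: x] then proj_h (Br (x.1 + 1) x.2.1 v) else 0.

(** The length test in [middle_op] is absorbed: on a one-letter word the sum is the projection of an
    element of L', which is 0. *)
Lemma middle_op2E s : good s -> (middle_op s).2 = sh pick_bracket s.
Proof.
case: s => [|x [|y s]] gs //.
  rewrite /= /pick_bracket Br_nil (good_proj K0 (goods_head gs)).
  by rewrite scaler0 addr0.
rewrite /pick_bracket.
rewrite -(shsum_pick1 _ (0, 0) (fun x v => proj_h (Br (x.1 + 1) x.2.1 v))).
by [].
Qed.

(** Additivity of weights gives closure of L' without tracking the arguments from g and V through
    the shuffles. *)
Lemma Lprime_NR p q P Q : @gv_deg K (Lprime g V) p P -> @gv_deg K (Lprime g V) q Q ->
  @gv_deg K (Lprime g V) (p + q) (NR (p, P) (q, Q)).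
Proof.
have alt n R : @gv_deg K (Lprime g V) n R -> alt_map (n + 1) R.
  rewrite /= /ge_deg; case: ifP => _ ; first by case/(bidegree_weight K0).
  by move=> ->; apply: alt_map0.
move=> LP LQ; have altP := alt _ _ LP; have altQ := alt _ _ LQ.
move: (LP) (LQ); rewrite {1 2}/gv_deg /= /ge_deg.
case: ifP => [p0|_ ->]; last by rewrite NR0l // => _; apply: (@gv_deg0 K (Lprime g V)).
case: ifP => [q0|_ _ ->]; last by rewrite NR0r //; apply: (@gv_deg0 K (Lprime g V)).
move=> /(bidegree_weight K0)[_ wP] /(bidegree_weight K0)[_ wQ].
rewrite addr_ge0 //; apply/(bidegree_weight K0); split; first exact: NR_alt_map.
exact: weight_NR.
Qed.

Lemma gv_degZ (E : gvspace K) i (a : K) (e : E) : gv_deg i e -> gv_deg i (a *: e).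
Proof. by move=> de; rewrite -[_ *: _]addr0; apply: gv_degL => //; apply: gv_deg0. Qed.

Lemma graded_proj_h n P : graded_cochain n P -> @gv_deg K (hspace g V) n (proj_h P).
Proof. by move/good_proj_letter => []. Qed.

Lemma middle_op_deg s : good s -> @gv_deg K (middle_space g V) (deg s + 1) (middle_op s).
Proof.
move=> gs; split.
  case: s gs => [|x [|y [|z s]]] gs; try exact: gv_deg0.
  apply: (@gv_degZ (Lprime g V)).
  have [gx _] := goods_head gs; have [gy _] := goods_head (goods_behead gs).
  rewrite !wdegE addr0 (_ : _ + 1 = x.1 + 1 + (y.1 + 1)); last by ring.
  exact: Lprime_NR.
rewrite middle_op2E //; apply: shsum_closed.
- by move=> a x y; apply: gv_degL.
- exact: gv_deg0.
move=> u v uvs; have [gu gv] := goods_split uvs gs.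
case: u gu uvs => [|x [|y u]] gu uvs; try exact: gv_deg0.
apply: graded_proj_h; rewrite -(perm_wdeg _ uvs) wdeg_cons addrAC.
exact: (graded_Br (good_cochain K0 (goods_head gu))).
Qed.

Lemma middle_op_linear s1 s2 (d : int) (a : K) (e f : middle_space g V) :
  good s1 -> good s2 -> gv_deg d e -> gv_deg d f ->
  middle_op (s1 ++ (d, a *: e + f) :: s2) =
    a *: middle_op (s1 ++ (d, e) :: s2) + middle_op (s1 ++ (d, f) :: s2).
Proof.
move=> gs1 gs2 de df; have def : gv_deg d (a *: e + f) by apply: gv_degL.
have ge : good_letter (d, e) := de.
have gf : good_letter (d, f) := df.
have gef : good_letter (d, a *: e + f) := def.
have gcat x : good_letter x -> good (s1 ++ x :: s2).
  by move=> gx; apply: goods_cat gs1 (goods_cons gx gs2).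
have alte := good_alt K0 ge; have altf := good_alt K0 gf.
apply: eq_pair12.
  case: s1 s2 gs1 gs2 {gcat} => [|x [|x' s1]] [|y [|y' s2]] gs1 gs2 //=;
    rewrite ?scaler0 ?addr0 //.
  - have alty := good_alt K0 (goods_head gs2).
    by rewrite NRPl // scalerDr !scalerA mulrC.
  - have altx := good_alt K0 (goods_head gs1).
    by rewrite NRPr // scalerDr !scalerA mulrC.
  - by case: s1 {gs1} => [|? ?] /=; rewrite scaler0 addr0.
  - by case: s1 {gs1} => [|? ?] /=; rewrite scaler0 addr0.
  - by case: s1 {gs1} => [|? ?] /=; rewrite scaler0 addr0.
rewrite -[RHS]/(_ *: (middle_op (s1 ++ (d, e) :: s2)).2 + (middle_op (s1 ++ (d,
  f) :: s2)).2).
rewrite !middle_op2E; do ?exact: gcat.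
apply: (@shsum_lin _ _ fst _ good_letter) => // [u1 u2 v gu1 gu2 gv|u v1 v2 gu gv1 gv2].
  case: u1 {gu1} => [|x [|x' u1]] /=; last 2 first.
  - by rewrite scaler0 addr0.
  - by rewrite scaler0 addr0.
  case: u2 {gu2} => [|y u2] /=; last by rewrite scaler0 addr0.
  rewrite -proj_h_linear BrP //; first exact: (good_cochain K0 ge).
  exact: (good_cochain K0 gf).
case: u gu => [|x [|x' u]] gu /=; rewrite ?scaler0 ?addr0 //.
rewrite -proj_h_linear; congr proj_h.
by apply: Br_lin => //; apply: (good_cochain K0); apply: goods_head gu.
Qed.

(** In the first component the bracket is antisymmetric in degrees shifted by one; the sign of the
    desuspension turns this into the Koszul sign of the unshifted degrees. *)
Lemma middle_op_symm : @adjacent_symm K _ fst _ good_letter (@middle_op K g V).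
Proof.
move=> s1 x y s2 gs; apply: eq_pair12.
  case: s1 gs => [|z s1] gs; last first.
    by case: s1 {gs} => [|z' [|z'' s1]] /=; rewrite scaler0.
  case: s2 gs => [|z s2] gs /=; last by rewrite scaler0.
  rewrite NRC !scalerA; congr (_ *: _).
  by signs.
have gs' := goods_swap gs.
rewrite -[RHS]/(_ *: (middle_op (s1 ++ y :: x :: s2)).2) !middle_op2E //.
have gs1 := goods_catl gs; have gs2 := goods_catr gs.
have gx := goods_head gs2; have gy := goods_head (goods_behead gs2).
have {}gs2 := goods_behead (goods_behead gs2).
apply: (@shsum_swap _ _ fst _ good_letter) => // [u1 u2 v gu1 gu2 gv|u v1 v2 gu gv1 gv2].
  by case: u1 {gu1} => [|z [|z' u1]] /=; rewrite scaler0.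
case: u gu => [|z [|z' u]] gu /=; rewrite ?scaler0 //.
rewrite Br_swap ?proj_hZ //; first by apply: (good_cochain K0); apply: goods_head gu.
by apply: goods_cat gv1 _; do 2!apply: goods_cons => //.
Qed.

End MiddleOperations.

Lemma linear_shsum_in (K : fieldType) (X : eqType) (dg : X -> int) (B C : lmodType K)
    (S : B -> Prop) (f : B -> C) (G : seq X -> seq X -> B) s :
  (forall a x y, S x -> S y -> S (a *: x + y)) -> S 0 ->
  (forall a x y, S x -> S y -> f (a *: x + y) = a *: f x + f y) ->
  (forall u v, perm_eq (u ++ v) s -> S (G u v)) ->
  f (shsum dg G s) = shsum dg (fun u v => f (G u v)) s.
Proof.
move=> SP S0 lin_f.
have f0 : f 0 = 0.
  by have := lin_f (-1) 0 0 S0 S0; rewrite scaler0 addr0 scaleN1r addNr.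
have fZ a x : S x -> f (a *: x) = a *: f x.
  by move=> Sx; rewrite -[a *: x]addr0 lin_f // f0 addr0.
have SZ a x : S x -> S (a *: x) by move=> Sx; rewrite -[_ *: _]addr0; apply: SP.
elim: s G => [|x s IHs] G SG //=.
have SG1 u v : perm_eq (u ++ v) s -> S (G (x :: u) v).
  by move=> uvs; apply: SG; rewrite /= perm_cons.
have SG2 u v : perm_eq (u ++ v) s -> S (G u (x :: v)).
  by move=> uvs; apply: SG; rewrite -cat_rcons -cats1 -catA perm_catCA /= perm_cons.
rewrite -[X in X + _]scale1r lin_f.
- rewrite scale1r !IHs //; last by move=> u v /SG2; apply: SZ.
  by congr (_ + _); apply: eq_shsum_perm => u v /SG2/fZ->.
- by apply: shsum_closed => // u v /SG1.
- by apply: shsum_closed => // u v /SG2; apply: SZ.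
Qed.

(** * The generalised Jacobi identity on the middle term *)

Section MiddleJacobi.
Variables (K : fieldType) (g V : lmodType K).
Hypothesis K0 : [pchar K] =i pred0.
Local Notation W := (g * V)%type.
Local Notation cochains := (seq W -> W).
Local Notation letter := (int * (cochains * (seq V -> g)))%type.
Implicit Types (P Q R : cochains) (theta : seq V -> g) (p q r : int).
Implicit Types (x y z : letter) (s u v : seq letter).

Local Notation deg := (wdeg (@fst int (cochains * (seq V -> g)))).
Local Notation sh := (shsum (@fst int (cochains * (seq V -> g)))).
Local Notation good_letter := (@good_letter K g V).
Local Notation good s := {in s, forall x, good_letter x}.
Local Notation Br := (@bracket_word K g V).

(** Only l_2 has a value in the first component, so the identity concerns words of length 3 and is
    the Jacobi identity of L'. *)
Lemma middle_jacobi1 s : good s ->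
  sh (fun u v => (middle_op ((deg u + 1, middle_op u) :: v)).1) s = 0.
Proof.
move=> gs.
(* The inner sign (-1)^(x.1 + 1) and the outer sign (-1)^(x.1 + y.1 + 2) combine to this one. *)
pose T x y z := (-1) ^ (y.1 + 1) *:
  NR (x.1 + 1 + (y.1 + 1), NR (x.1 + 1, x.2.1) (y.1 + 1, y.2.1)) (z.1 + 1, z.2.1).
pose G u v := if (u, v) is ([:: x; y], [:: z]) then T x y z else 0.
rewrite (@eq_shsum_perm _ _ _ _ _ G) => [|u v uvs]; last first.
  have [gu gv] := goods_split uvs gs.
  case: v {uvs} gv => [|z [|z' v]] gv; rewrite /G; try by case: u gu => [|x [|y [|? ?]]].
  have altz := good_alt K0 (goods_head gv).
  case: u gu => [|x [|y [|y' u]]] gu /=; rewrite ?(NR0l _ altz) ?scaler0 //.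
  have altx := good_alt K0 (goods_head gu).
  have alty := good_alt K0 (goods_head (goods_behead gu)).
  rewrite !wdegE (_ : x.1 + (y.1 + 0) + 1 + 1 = x.1 + 1 + (y.1 + 1)); last by ring.
  rewrite -[_ *: NR (x.1 + 1, _) _]addr0 NRPl //; [|exact: NR_alt_map|exact: alt_map0].
  by rewrite (NR0l _ altz) addr0 scalerA; congr (_ *: _); signs.
have [sz3|sz_neq3] := eqVneq (size s) 3; last first.
  rewrite -[RHS](shsum0 (@fst int (cochains * (seq V -> g))) _ s).
  apply: eq_shsum_perm => u v /perm_size; rewrite size_cat /G => szuv.
  case: u v szuv => [|x [|y [|? ?]]] [|z [|? ?]] //= szuv.
  by rewrite -szuv eqxx in sz_neq3.
case: s sz3 gs => [|a [|b [|c [|? ?]]]] //= _ gs.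
rewrite /G !scaler0 !wdegE !addr0 !add0r.
have alta := good_alt K0 (goods_head gs).
have altb := good_alt K0 (goods_head (goods_behead gs)).
have altc := good_alt K0 (goods_head (goods_behead (goods_behead gs))).
rewrite /T NR_leibniz // [NR (b.1 + 1 + _, _) _]NRC.
move: (NR _ (_ + _, _)) (NR (_ + _, _) _) => X Y.
rewrite !scalerDr !scalerA mulr0 expr0z !mul1r -!scalerA.
rewrite !signzE !zoddE; case: (zodd a.1); case: (zodd b.1); case: (zodd c.1);
  rewrite /= ?expr0 ?expr1 ?scale1r ?scaleN1r ?scaleNr ?scale1r; zmod.
Qed.

(** The letter of the outer word that acts through L' is either the inner value, which yields
    brackets of [Q, Q'] ([T]), or a letter of [v], which yields insertions ([H]). [proj_Br_NR]
    matches the two kinds for each pair of letters acting through L'. *)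
Lemma middle_jacobi2 s : good s ->
  sh (fun u v => (middle_op ((deg u + 1, middle_op u) :: v)).2) s = 0.
Proof.
move=> gs.
(* Here [y] acts inside on the letters [w], and [x] acts outside on the inner value and on [v']. *)
pose H u1 w u' v' := if (u1, u') is ([:: y], [:: x]) then
  (-1) ^ ((y.1 + 1 + deg w) * x.1) *: proj_h (Br (x.1 + 1) x.2.1
    ((y.1 + 1 + deg w, (0, proj_h (Br (y.1 + 1) y.2.1 w))) :: v')) else 0.
pose T u v := proj_h (Br (deg u + 1 + 1) (middle_op u).1 v).
transitivity (sh (fun u v => T u v +
    sh (fun u' v' => sh (fun u1 w => H u1 w u' v') u) v) s).
  apply: eq_shsum_perm => u v uvs; have [gu gv] := goods_split uvs gs.
  have gz : good_letter (deg u + 1, middle_op u) := middle_op_deg K0 gu.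
  rewrite (middle_op2E K0 (goods_cons gz gv)) /=; congr (_ + _).
    rewrite -[RHS](shsum_nil (@fst int (cochains * (seq V -> g))) (T u)).
    by apply: eq_shsum => -[].
  apply: eq_shsum_perm => u' v' uv'; have [gu' gv'] := goods_split uv' gv.
  case: u' gu' uv' => [|x [|x' u']] gu' uv'; rewrite /pick_bracket ?scaler0.
  - rewrite -[LHS](shsum0 (@fst int (cochains * (seq V -> g))) _ u).
    by apply: eq_shsum => -[|? [|? ?]].
  - have gx := goods_head gu'.
    pose f theta := proj_h (Br (x.1 + 1) x.2.1 ((deg u + 1, (0,
      theta) : cochains * _) :: v')).
    have lin_f a theta phi : gv_deg (deg u + 1) (theta : hspace g V) ->
        gv_deg (deg u + 1) (phi : hspace g V) -> f (a *: theta + phi) = a *: f theta +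
          f phi.
      move=> dtheta dphi; rewrite -proj_h_linear; congr proj_h.
      apply: (Br_lin (s1 := [::])) => //; first exact: (good_cochain K0 gx).
        by split=> //; apply: gv_deg0.
      by split=> //; apply: gv_deg0.
    have f0 : f 0 = 0.
      have := lin_f (-1) 0 0 (gv_deg0 _ _) (gv_deg0 _ _).
      by rewrite scaler0 addr0 scaleN1r addNr.
    rewrite -[X in _ *: X]/(f (middle_op u).2) (middle_op2E K0 gu).
    rewrite (linear_shsum_in _ _ _ lin_f).
    + rewrite -shsumZ; apply: eq_shsum_perm => u1 w u1w.
      case: u1 u1w => [|y [|y' u1]] u1w; rewrite /H /pick_bracket.
      * by rewrite f0 scaler0.
      * rewrite /f -(perm_wdeg _ u1w) !wdegE !addr0 [y.1 + 1 + _]addrAC.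
        by [].
      * by rewrite f0 scaler0.
    + by move=> a theta phi; apply: gv_degL.
    + exact: gv_deg0.
    + move=> u1 w u1w; have [gu1 gw] := goods_split u1w gu.
      case: u1 gu1 u1w => [|y [|? ?]] gu1 u1w; try exact: gv_deg0.
      apply: graded_proj_h; rewrite -(perm_wdeg _ u1w) wdeg_cons addrAC.
      exact: (graded_Br (good_cochain K0 (goods_head gu1))).
  - rewrite -[LHS](shsum0 (@fst int (cochains * (seq V -> g))) _ u).
    by apply: eq_shsum => -[|? [|? ?]].
(* The four blocks are regrouped: the letters acting through L', [u1] and [u'], form [n], and those
   acting through h, [w] and [v'], form [k]. Exchanging [u'] and [w] costs the sign. *)
transitivity (sh (fun n k => T n k + sh (fun u1 u' => sh (fun w v' =>
    (-1) ^ (deg u' * deg w) *: H u1 w u' v') k) n) s).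
  rewrite !shsumD; congr (_ + _).
  under eq_shsum do rewrite shsum_exchange.
  rewrite shsum_assoc [RHS]shsum_assoc; apply: eq_shsum => u1 r.
  rewrite -shsum_assoc -[RHS]shsum_assoc; apply: eq_shsum => m v'.
  by rewrite shsumC.
rewrite -[RHS](shsum0 (@fst int (cochains * (seq V -> g))) _ s).
apply: eq_shsum_perm => n k nk; have [gn gk] := goods_split nk gs.
have [sz2|sz_neq2] := eqVneq (size n) 2; last first.
  rewrite /T (_ : (middle_op n).1 = 0); last by case: n sz_neq2 {nk gn} => [|? [|? [|? ?]]].
  rewrite Br0 // proj_h0 add0r -[RHS](shsum0 (@fst int (cochains * (seq V -> g))) _ n).
  apply: eq_shsum_perm => u1 u' /perm_size; rewrite size_cat => szu.
  rewrite -[RHS](shsum0 (@fst int (cochains * (seq V -> g))) _ k).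
  apply: eq_shsum => w v'; rewrite /H.
  case: u1 u' szu => [|y [|? ?]] [|x [|? ?]] szu; rewrite ?scaler0 //.
  by rewrite -szu in sz_neq2.
case: n sz2 gn {nk} => [|a [|b [|? ?]]] //= _ gn.
have FE y x : sh (fun w v' => (-1) ^ (deg [:: x] * deg w) *: H [:: y] w [:: x] v') k =
    (-1) ^ ((y.1 + 1) * x.1) *: nested_sum (x.1 + 1) x.2.1 (y.1 + 1) y.2.1 k.
  rewrite /nested_sum -shsumZ; apply: eq_shsum => w v'.
  by rewrite /H scalerA; congr (_ *: _); rewrite !wdegE; signs.
have zero u1 u' : size u1 != 1 \/ size u' != 1 ->
    sh (fun w v' => (-1) ^ (deg u' * deg w) *: H u1 w u' v') k = 0.
  move=> sz; rewrite -[RHS](shsum0 (@fst int (cochains * (seq V -> g))) _ k).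
  apply: eq_shsum => w v'; rewrite /H.
  by case: u1 u' sz => [|y [|? ?]] [|x [|? ?]] [] //; rewrite scaler0.
rewrite !FE !zero; try by [left|right].
have ga := good_cochain K0 (goods_head gn).
have gb := good_cochain K0 (goods_head (goods_behead gn)).
rewrite /T /= !wdegE (_ : a.1 + (b.1 + 0) + 1 + 1 = a.1 + 1 + (b.1 + 1)); last by ring.
rewrite BrZ //; last exact: graded_NR.
rewrite proj_hZ proj_Br_NR //.
move: (nested_sum _ _ _ _ _) (nested_sum _ _ _ _ _) => X Y.
rewrite !scaler0 add0r addr0 addr0 mulr0 expr0z scale1r.
rewrite !signzE !zoddE; case: (zodd a.1); case: (zodd b.1);
  rewrite /= ?expr0 ?expr1 ?scale1r ?scaleN1r; zmod.
Qed.

End MiddleJacobi.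

(** * Twisting by a Maurer-Cartan element *)

Lemma triangle_sum (B : nmodType) (f : nat -> nat -> B) N :
  (forall k l, (N <= k)%N || (N <= l)%N -> f k l = 0) ->
  \sum_(m < N + N) \sum_(k < m.+1) f k (m - k)%N = \sum_(k < N) \sum_(l < N) f k l.
Proof.
move=> f0; transitivity (\sum_(m < N + N) \sum_(k < N + N | (k <= m)%N) f k (m - k)%N).
  apply: eq_bigr => m _; rewrite (big_ord_widen (N + N) (fun k =>
    f k (m - k)%N)) ?ltn_ord //.
rewrite (exchange_big_dep xpredT) //=.
rewrite (big_ord_widen (N + N) (fun k => \sum_(l < N) f k l)) ?leq_addr // [RHS]big_mkcond.
apply: eq_bigr => k _; case: ltnP => [lt_kN|le_Nk]; last first.
  by apply: big1 => m _; rewrite f0 ?le_Nk.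
rewrite -(big_mkord (fun m => (k <= m)%N) (fun m => f k (m - k)%N)).
rewrite -(big_mkord xpredT (f k)) (big_cat_nat (n := k)) ?(ltnW (ltn_ord k)) //=.
rewrite big_nat_cond big1 ?add0r => [|m /andP[/andP[_ lt_mk]]];
  last by rewrite leqNgt lt_mk.
rewrite -{1}[val k]add0n big_addn big_mkcond (big_cat_nat (n := N)) //=; last by lia.
rewrite [X in _ + X]big_nat_cond [X in _ + X]big1 ?addr0 => [|l /andP[/andP[le_Nl _] _]].
  by apply: eq_bigr => l _; rewrite leq_addl addnK.
by rewrite leq_addl addnK f0 // le_Nl orbT.
Qed.

(** Copies of a letter of degree 0 move without sign, so only the number k of copies in the first
    block matters; the induction on m is Pascal's rule. *)
Lemma shsum_nseq (K : fieldType) (X : eqType) (dg : X -> int) (B : lmodType K)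
    (a : X) m (G : seq X -> seq X -> B) s : dg a = 0 ->
  shsum dg G (nseq m a ++ s) =
  \sum_(k < m.+1) shsum dg (fun u v =>
    G (nseq k a ++ u) (nseq (m - k) a ++ v)) s *+ 'C(m, k).
Proof.
move=> da; elim: m G => [|m IHm] G; first by rewrite big_ord1.
rewrite -[nseq m.+1 a ++ s]/(a :: nseq m a ++ s) /=.
rewrite [X in _ + X](_ : _ = shsum dg (fun u v => G u (a :: v)) (nseq m a ++ s));
  last first.
  by apply: eq_shsum => u v; rewrite da mul0r expr0z scale1r.
rewrite !IHm [RHS]big_ord_recl [X in _ + X = _]big_ord_recl /= !bin0 !mulr1n.
rewrite addrCA subn0; congr (_ + _).
under [RHS]eq_bigr do rewrite /bump /= add1n binS mulrnDr.
rewrite big_split addrC; congr (_ + _).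
rewrite [RHS]big_ord_recr /= bin_small // mulr0n addr0; apply: eq_bigr => k _.
rewrite /bump /= add1n; congr (_ *+ _); apply: eq_shsum => u v.
by rewrite -[a :: nseq _ a ++ v]/(nseq (m - k.+1).+1 a ++ v) subnSK.
Qed.

Section Twist.
Variables (K : fieldType).
Hypothesis K0 : [pchar K] =i pred0.

(* [is_Linfty] with the sums over shuffles written as [shsum]. An empty first
   block contributes nothing because the operation on the empty word is 0. *)
Definition shuffle_Linfty (E : higher_ops K) : Prop :=
  [/\ forall s : seq (int * E), homog s -> gv_deg (degree s + 1) (ho_op s),
      forall (s1 s2 : seq (int * E)) (d : int) (a : K) (x y : E),
        homog s1 -> homog s2 -> gv_deg d x -> gv_deg d y ->
        ho_op (s1 ++ (d, a *: x + y) :: s2) =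
          a *: ho_op (s1 ++ (d, x) :: s2) + ho_op (s1 ++ (d, y) :: s2),
      adjacent_symm (@fst int E) (fun p : int * E => gv_deg p.1 p.2) (@ho_op K E),
      forall s : seq (int * E), homog s ->
        shsum fst (fun u v => ho_op ((degree u + 1, ho_op u) :: v)) s = 0
    & ho_op ([::] : seq (int * E)) = 0].

Lemma ho_op_letter0 (E : higher_ops K) d (s1 s2 : seq (int * E)) :
  shuffle_Linfty E -> homog s1 -> homog s2 -> ho_op (s1 ++ (d, 0) :: s2) = 0.
Proof.
move=> [_ lin _ _ _] h1 h2.
have := lin s1 s2 d (-1) 0 0 h1 h2 (gv_deg0 _ _) (gv_deg0 _ _).
by rewrite scaler0 addr0 scaleN1r addNr.
Qed.

Lemma shuffle_LinftyP (E : higher_ops K) : shuffle_Linfty E -> is_Linfty E.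
Proof.
move=> LE; have [dE lE sE jE E0] := LE; split=> //.
- by move=> s _; apply: dE.
- by move=> n x s _ hx; apply: (adjacent_symm_permuted s sE).
move=> n x _ hx; rewrite jacobi_shsum -[RHS](jE _ hx).
apply: eq_shsum_perm => -[|y u] v uvx //; rewrite E0.
by rewrite (@ho_op_letter0 E _ [::]) // => p pv; apply: hx; rewrite -(perm_mem uvx).
Qed.

Variables (E : higher_ops K) (alpha : E).
Local Notation letter := (int * E)%type.
Local Notation a := ((0, alpha) : letter).
Local Notation deg := (wdeg (@fst int E)).

(** Measures how many copies of [alpha] can act. Unlike the total degree it does not decrease when
    letters are added, so one truncation serves all blocks of a word. *)
Definition abs_deg (s : seq letter) : nat := \sum_(p <- s) `|p.1|%N.

Hypothesis LE : shuffle_Linfty E.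
Hypothesis alpha0 : gv_deg 0 alpha.
Variable C : nat.
Hypothesis bounded : forall (s : seq letter) n, homog s ->
  (C + abs_deg s <= n)%N -> ho_op (nseq n a ++ s) = 0.

Local Notation tw := (@ho_op K (twist alpha)).

Lemma homog_nseq n (s : seq letter) : homog s -> homog (nseq n a ++ s).
Proof.
by move=> hs p; rewrite mem_cat mem_nseq => /orP[/andP[_ /eqP->]|/hs].
Qed.

Lemma deg_nseq n (s : seq letter) : deg (nseq n a ++ s) = deg s.
Proof. by elim: n => // n IHn; rewrite /= wdeg_cons IHn add0r. Qed.

Lemma twistE N (s : seq letter) : homog s -> (C + abs_deg s <= N)%N ->
  tw s = \sum_(n < N) (n`!%:R)^-1 *: ho_op (nseq n a ++ s).
Proof.
move=> hs leN; rewrite /= (fsbigE (iota 0 N)) ?iota_uniq //.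
  rewrite -(big_mkord xpredT (fun n => (n`!%:R)^-1 *: ho_op (nseq n a ++ s))).
  by rewrite /index_iota subn0; apply: eq_bigl => n; rewrite in_setT.
move=> n _; rewrite mem_iota -leqNgt => leNn.
by rewrite bounded ?scaler0 // (leq_trans leN).
Qed.

Hypothesis MC : tw [::] = 0.

Lemma gv_deg_sum i (I : Type) (r : seq I) (P : pred I) (F : I -> E) :
  (forall j, P j -> gv_deg i (F j)) -> gv_deg i (\sum_(j <- r | P j) F j).
Proof.
move=> dF; elim/big_rec: _ => [|j e Pj de]; first exact: gv_deg0.
by rewrite -[F j]scale1r; apply: gv_degL => //; apply: dF.
Qed.

Lemma homog_insert (s1 s2 : seq letter) d (x : E) :
  homog s1 -> homog s2 -> gv_deg d x -> homog (s1 ++ (d, x) :: s2).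
Proof. by move=> h1 h2 dx; apply: goods_cat h1 (goods_cons _ h2). Qed.

Lemma abs_deg_cat s1 s2 : abs_deg (s1 ++ s2) = (abs_deg s1 + abs_deg s2)%N.
Proof. exact: big_cat. Qed.

Lemma abs_deg_cons x s : abs_deg (x :: s) = (`|x.1|%N + abs_deg s)%N.
Proof. exact: big_cons. Qed.

Lemma abs_degree s : (`|deg s|%N <= abs_deg s)%N.
Proof.
elim: s => [|x s IHs]; first by rewrite wdeg_nil.
by rewrite wdeg_cons abs_deg_cons; lia.
Qed.

Lemma ho_op_sum (s1 s2 : seq letter) d n (c : 'I_n -> K) (F : 'I_n -> E) :
  homog s1 -> homog s2 -> (forall k, gv_deg d (F k)) ->
  ho_op (s1 ++ (d, \sum_(k < n) c k *: F k) :: s2) =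
  \sum_(k < n) c k *: ho_op (s1 ++ (d, F k) :: s2).
Proof.
move=> h1 h2 dF; have [_ lE _ _ _] := LE.
suff [] : ho_op (s1 ++ (d, \sum_(k < n) c k *: F k) :: s2) =
  \sum_(k < n) c k *: ho_op (s1 ++ (d,
    F k) :: s2) /\ gv_deg d (\sum_(k < n) c k *: F k) by [].
elim/big_rec2: _ => [|k y1 y2 _ [<- dy]].
  by rewrite ho_op_letter0 //; split=> //; apply: gv_deg0.
by split; [rewrite lE|apply: gv_degL].
Qed.

(** The double sum over the copies of [alpha] inside and outside is arranged by their total m; each
    diagonal is 1/m! times the Jacobi identity of [E] on m copies followed by [s]. Splittings with
    an empty inner block, the curvature terms, are included. *)
Lemma twist_jacobi (s : seq letter) : homog s ->
  shsum fst (fun u v => tw ((degree u + 1, tw u) :: v)) s = 0.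
Proof.
move=> hs; have [dE lE sE jE _] := LE.
(* The extra 1 accounts for the letter carrying the inner value, of degree [degree u + 1]. *)
pose N := (C + abs_deg s + 1)%N.
pose H k l := shsum (@fst int E) (fun u v =>
  ho_op ((degree u + 1, ho_op (nseq k a ++ u)) :: nseq l a ++ v)) s.
have dnseq k u : homog u -> gv_deg (degree u + 1) (ho_op (nseq k a ++ u)).
  by move=> hu; rewrite -[degree u](deg_nseq k); apply: dE; apply: homog_nseq.
have split_s u v : perm_eq (u ++ v) s ->
    [/\ homog u, homog v & (abs_deg u + abs_deg v = abs_deg s)%N].
  move=> uvs; have [hu hv] := goods_split uvs hs.
  by split=> //; rewrite -abs_deg_cat; apply: perm_big.
have bd_out u v (y : E) : (abs_deg u + abs_deg v = abs_deg s)%N ->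
    (C + abs_deg ((degree u + 1, y)%R :: v) <= N)%N.
  have : (absz (degree u) <= abs_deg u)%N := abs_degree u.
  rewrite abs_deg_cons /N /=; move: (degree u) (abs_deg u) (abs_deg v) (abs_deg s).
  by move=> n i j k; lia.
have front d (y : E) l v : homog v -> gv_deg d y ->
    ho_op (nseq l a ++ (d, y) :: v) = ho_op ((d, y) :: nseq l a ++ v).
  move=> hv dy; rewrite (adjacent_symm_front sE); last first.
    by apply: homog_nseq; apply: (goods_cons (good := fun p : letter => gv_deg p.1 p.2)).
  have -> : deg (nseq l a) = 0 by rewrite -[nseq l a]cats0 deg_nseq wdeg_nil.
  by rewrite mulr0 expr0z scale1r.
have twH : shsum fst (fun u v => tw ((degree u + 1, tw u) :: v)) s =
    \sum_(k < N) \sum_(l < N) ((k`!%:R)^-1 * (l`!%:R)^-1) *: H k l.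
  rewrite exchange_big.
  transitivity (shsum fst (fun u v => \sum_(l < N) \sum_(k < N)
     ((k`!%:R)^-1 * (l`!%:R)^-1) *: ho_op ((degree u + 1,
       ho_op (nseq k a ++ u)) :: nseq l a ++ v)) s).
    apply: eq_shsum_perm => u v /split_s[hu hv szuv].
    rewrite (twistE (N := N) hu); last by rewrite /N; lia.
    have dsum : gv_deg (degree u + 1) (\sum_(n < N) (n`!%:R)^-1 *: ho_op (nseq n a ++ u)).
      apply: gv_deg_sum => k _; rewrite -[_ *: _]addr0; apply: gv_degL; first exact: dnseq.
      exact: gv_deg0.
    rewrite (twistE (N := N)); last 2 first.
    - exact: (goods_cons (good := fun p : letter => gv_deg p.1 p.2)).
    - exact: bd_out szuv.
    apply: eq_bigr => l _; rewrite ho_op_sum //; last 2 first.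
    - by rewrite -[nseq l a]cats0; apply: homog_nseq.
    - by move=> k; apply: dnseq.
    rewrite scaler_sumr; apply: eq_bigr => k _.
    by rewrite scalerA mulrC front //; apply: dnseq.
  rewrite shsum_sum; apply: eq_bigr => l _; rewrite shsum_sum.
  by apply: eq_bigr => k _; rewrite shsumZ.
rewrite twH -(@triangle_sum _ (fun k l => ((k`!%:R)^-1 * (l`!%:R)^-1) *: H k l));
  last first.
  move=> k l kl; rewrite (_ : H k l = 0) ?scaler0 //.
  rewrite -[RHS](shsum0 (@fst int E) _ s); apply: eq_shsum_perm => u v /split_s[hu hv szuv].
  case/orP: kl => [le_Nk|le_Nl].
    rewrite bounded //; last by move: le_Nk; rewrite /N; lia.
    by rewrite (@ho_op_letter0 E _ [::]) //; apply: homog_nseq.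
  rewrite -front //; last exact: dnseq.
  rewrite bounded //; first by apply: (goods_cons (good := fun p : letter =>
    gv_deg p.1 p.2)) => //; apply: dnseq.
  by apply: leq_trans le_Nl; apply: bd_out szuv.
apply: big1 => m _.
have := jE _ (@homog_nseq m _ hs); rewrite shsum_nseq // => jm.
rewrite -[RHS](scaler0 _ (m`!%:R)^-1) -[in RHS]jm scaler_sumr; apply: eq_bigr => k _.
rewrite /H -scalerMnr scalerMnl.
have le_km : (k <= m)%N by rewrite -ltnS.
congr (_ *: _); last first.
  by apply: eq_shsum => u v; rewrite [degree (nseq k a ++ u)](deg_nseq k u).
have pos_neq0 n : (0 < n)%N -> n%:R != 0 :> K by case: n => // n _; apply: natr_neq0.
(* The number of splittings over m! is 1 / (k! (m - k)!); characteristic 0 makes the factorials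
   invertible. *)
rewrite -mulr_natr -(bin_fact le_km) !natrM; field.
by rewrite !pos_neq0 ?fact_gt0 ?bin_gt0.
Qed.

(** The Maurer-Cartan equation enters as the vanishing of the twisted operation on the empty word,
    that is, of the curvature. *)
Theorem twist_Linfty : shuffle_Linfty (twist alpha).
Proof.
have [dE lE sE jE _] := LE; split=> //.
- move=> s hs; rewrite (twistE hs (leqnn _)); apply: gv_deg_sum => n _.
  rewrite -[_ *: _]addr0; apply: gv_degL; last exact: gv_deg0.
  by rewrite -[degree s](deg_nseq n); apply: dE; apply: homog_nseq.
- move=> s1 s2 d c x y h1 h2 dx dy.
  pose N := (C + abs_deg (s1 ++ (d, x) :: s2))%N.
  have bd e : (C + abs_deg (s1 ++ (d, e) :: s2) <= N)%N.
    by rewrite /N !abs_deg_cat !abs_deg_cons.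
  have dxy : gv_deg d (c *: x + y) by apply: gv_degL.
  rewrite !(twistE (N := N)) //; do ?exact: homog_insert.
  rewrite scaler_sumr -big_split; apply: eq_bigr => n _ /=.
  have h1n := @homog_nseq n _ h1.
  by rewrite !catA lE // scalerDr !scalerA mulrC.
- move=> s1 x y s2 hs.
  pose N := (C + abs_deg (s1 ++ x :: y :: s2))%N.
  have hs' : homog (s1 ++ y :: x :: s2) := goods_swap hs.
  rewrite !(twistE (N := N)) //; last first.
    by rewrite /N !abs_deg_cat !abs_deg_cons; lia.
  rewrite scaler_sumr; apply: eq_bigr => n _.
  rewrite !catA sE; last by rewrite -catA; apply: homog_nseq.
  by rewrite !scalerA mulrC.
exact: twist_jacobi.
Qed.

End Twist.

(** * The Maurer-Cartan element of a relative Rota-Baxter Lie algebra *)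

Section RelativeRotaBaxter.
Variables (K : fieldType) (g V : lmodType K).
Hypothesis K0 : [pchar K] =i pred0.
Variables (mu : g -> g -> g) (rho : g -> V -> V) (T : V -> g).
Hypothesis hT : relative_RB_Lie_algebra mu rho T.
Local Notation W := (g * V)%type.
Local Notation cochains := (seq W -> W).
Local Notation pi := (pi_cochain mu rho).
Local Notation T1 := (one_cochain T).

Lemma lift_mapE (B : lmodType K) (j : B -> W) k (f : seq g -> seq V -> B) (s : seq W) :
  (k <= size s)%N ->
  lift_map j k f s = j (shsum (fun=> 1) (fun u v => if size u == k then
    f [seq w.1 | w <- u] [seq w.2 | w <- v] else 0) s).
Proof.
move=> lek; congr (j _); under eq_bigr do rewrite /= -koszul1.
exact: (sum_shuffle (fun=> 1) (in_tuple s)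
  (fun u v => f [seq w.1 | w <- u] [seq w.2 | w <- v]) lek).
Qed.

Lemma lift_map_size (B : lmodType K) (j : B -> W) k n (f : seq g -> seq V -> B) (s :
  seq W) :
  j 0 = 0 -> (forall xs vs, (size xs + size vs)%N != n -> f xs vs = 0) ->
  size s != n -> lift_map j k f s = 0.
Proof.
move=> j0 f0 szs; rewrite /lift_map big1 ?j0 // => t _ /=.
rewrite f0 ?scaler0 // !size_map -size_cat cat_take_drop.
by rewrite size_map size_enum_ord.
Qed.

(** This is the bracket of the semidirect product of g with V. *)
Lemma pi_cochainE (s : seq W) : pi s =
  if s is [:: w1; w2] then (mu w1.1 w2.1, rho w1.1 w2.2 - rho w2.1 w1.2) else 0.
Proof.
have [sz2|sz_neq2] := eqVneq (size s) 2; last first.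
  rewrite /pi_cochain !fctE /lift_mu /lift_rho !(@lift_map_size _ _ _ 2) //.
  - by rewrite addr0; case: s sz_neq2 => [|? [|? [|? ?]]].
  - by move=> [|? [|? ?]] [|? [|? ?]].
  - by move=> [|? [|? [|? ?]]] [|? ?].
case: s sz2 => [|w1 [|w2 [|? ?]]] //= _.
rewrite /pi_cochain !fctE /lift_mu /lift_rho !lift_mapE //=.
rewrite !wdegE !scaler0 !mulr0 !expr0z !scale1r !addr0 !add0r.
rewrite mul1r expr1z scaleN1r.
by congr (_, _); rewrite /= ?add0r ?addr0.
Qed.

Lemma lift_TE (s : seq W) : lift_h T1 s = if s is [:: w] then (T w.2, 0) else 0.
Proof. by rewrite lift_hE; case: s => [|w [|? ?]]. Qed.

Let muPl a x y z : mu (a *: x + y) z = a *: mu x z + mu y z.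
Proof. by have [[+ _ _ _] _ _] := hT; apply. Qed.
Let muPr a x y z : mu x (a *: y + z) = a *: mu x y + mu x z.
Proof. by have [[_ + _ _] _ _] := hT; apply. Qed.
Let muxx x : mu x x = 0.
Proof. by have [[_ _ + _] _ _] := hT; apply. Qed.
Let mu_jacobi x y z : mu x (mu y z) + mu y (mu z x) + mu z (mu x y) = 0.
Proof. by have [[_ _ _ +] _ _] := hT; apply. Qed.
Let rhoPl a x y v : rho (a *: x + y) v = a *: rho x v + rho y v.
Proof. by have [_ [+ _ _] _] := hT; apply. Qed.
Let rhoPr a x u v : rho x (a *: u + v) = a *: rho x u + rho x v.
Proof. by have [_ [_ + _] _] := hT; apply. Qed.
Let rho_mu x y v : rho (mu x y) v = rho x (rho y v) - rho y (rho x v).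
Proof. by have [_ [_ _ +] _] := hT; apply. Qed.
Let TP a u v : T (a *: u + v) = a *: T u + T v.
Proof. by have [_ _ [+ _]] := hT; apply. Qed.
Let mu_TT u v : mu (T u) (T v) = T (rho (T u) v - rho (T v) u).
Proof. by have [_ _ [_ +]] := hT; apply. Qed.

Let rho0l v : rho 0 v = 0.
Proof. by have := rhoPl (-1) 0 0 v; rewrite scaler0 addr0 scaleN1r addNr. Qed.
Let rho0r x : rho x 0 = 0.
Proof. by have := rhoPr (-1) x 0 0; rewrite scaler0 addr0 scaleN1r addNr. Qed.
Let mu0l z : mu 0 z = 0.
Proof. by have := muPl (-1) 0 0 z; rewrite scaler0 addr0 scaleN1r addNr. Qed.
Let mu0r z : mu z 0 = 0.
Proof. by have := muPr (-1) z 0 0; rewrite scaler0 addr0 scaleN1r addNr. Qed.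
Let T0 : T 0 = 0.
Proof. by have := TP (-1) 0 0; rewrite scaler0 addr0 scaleN1r addNr. Qed.
Let rhoB x u v : rho x (u - v) = rho x u - rho x v.
Proof. by rewrite addrC -scaleN1r rhoPr scaleN1r addrC. Qed.
Let TB u v : T (u - v) = T u - T v.
Proof. by rewrite addrC -scaleN1r TP scaleN1r addrC. Qed.
Let muC x y : mu x y = - mu y x.
Proof.
apply/eqP; rewrite -addr_eq0; apply/eqP; have := muxx (x + y).
rewrite -[X in mu (X + _) _]scale1r muPl -[X in mu _ (X + _)]scale1r muPr.
rewrite -[X in _ + mu _ (X + _)]scale1r muPr.
by rewrite !scale1r !muxx add0r addr0.
Qed.

Lemma pi_alt_map : alt_map 2 pi.
Proof.
split=> [s szs|s1 s2 a x y|s us]; rewrite !pi_cochainE.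
- by case: s szs => [|? [|? [|? ?]]].
- case: s1 => [|w [|w' s1]] /=.
  + case: s2 => [|w [|? ?]]; rewrite ?scaler0 ?addr0 //.
    congr (_, _); rewrite /= ?muPl ?rhoPl ?rhoPr //.
    by rewrite opprD addrACA scalerBr.
  + case: s2 => [|? ?]; rewrite ?scaler0 ?addr0 //.
    congr (_, _); rewrite /= ?muPr ?rhoPl ?rhoPr //.
    by rewrite opprD addrACA scalerBr.
  + by case: s1 => [|? ?] /=; rewrite ?scaler0 ?addr0.
- case: s us => [|w1 [|w2 [|? ?]]] //=.
  rewrite inE andbT negbK => /eqP->.
  by rewrite muxx subrr.
Qed.

Lemma pi_weight : weight 1 pi.
Proof.
move=> s; rewrite !pi_cochainE expr1z.
case: s => [|w1 [|w2 [|? ?]]] /=; try by congr (_, _); rewrite /= !scaler0.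
have muZl a x y : mu (a *: x) y = a *: mu x y by rewrite -[a *: x]addr0 muPl mu0l addr0.
have muZr a x y : mu x (a *: y) = a *: mu x y by rewrite -[a *: y]addr0 muPr mu0r addr0.
have rhoZ a x v : rho (a *: x) v = a *: rho x v by rewrite -[a *: x]addr0 rhoPl rho0l addr0.
by congr (_, _); rewrite /= ?muZl ?muZr // !rhoZ scalerBr.
Qed.

Lemma pi_bidegree : bidegree 1 0 pi.
Proof. by apply/(bidegree_weight K0); split; [exact: pi_alt_map|exact: pi_weight]. Qed.

Lemma T_alt_map : alt_map 1 T1.
Proof.
split=> [s|s1 s2 a x y|s]; first by case: s => [|? [|? ?]].
  case: s1 => [|w s1] /=; last by case: s1 => [|? ?] /=; rewrite scaler0 addr0.
  by case: s2 => [|? ?] /=; rewrite ?TP // scaler0 addr0.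
by case: s => [|? [|? ?]].
Qed.

(** [pi, pi] is twice the composition of pi with itself, the Jacobiator of the semidirect product up
    to sign: its g-component vanishes by the Jacobi identity of [mu], its V-component because [rho]
    is a representation. *)
Lemma NR_pi_pi : NR (1, pi) (1, pi) = 0.
Proof.
have altp := pi_alt_map.
rewrite (NRE (p := 1) (q := 1)) //.
suff -> : nr_comp pi pi = 0 by rewrite scaler0 subr0.
apply/funext => s; have [sz3|sz_neq3] := eqVneq (size s) 3; last first.
  by apply: (alt_map_size (comp_alt_map (p := 1) (q := 1) altp altp));
    case: (size s) sz_neq3 => [|[|[|[|n]]]].
case: s sz3 => [|a [|b [|c [|? ?]]]] //= _.
rewrite /nr_comp /= !pi_cochainE !wdegE !mulr0 !expr0z !scale1r !scaler0 !addr0 !add0r.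
rewrite !mul1r expr1z scaleN1r (_ : (-1) ^ (1 + 1) = 1 :> K); last by signs.
rewrite scale1r.
apply: eq_pair12 => /=.
  rewrite -[RHS]oppr0 -[in RHS](mu_jacobi a.1 b.1 c.1).
  rewrite (muC (mu a.1 b.1)) (muC (mu a.1 c.1)) (muC (mu b.1 c.1)).
  rewrite (muC a.1 c.1).
  have muNr x y : mu x (- y) = - mu x y by rewrite -scaleN1r -[_ *: y]addr0 muPr mu0r
    addr0 scaleN1r.
  by rewrite !muNr; zmod.
by rewrite !rhoB !rho_mu; zmod.
Qed.

(** On (v1, v2) this is twice mu (T v1) (T v2) - T (rho (T v1) v2 - rho (T v2) v1), the defect of
    the Rota-Baxter equation. *)
Lemma proj_NR_pi_T_T :
  proj_h (NR (1, NR (1, pi) (0, lift_h T1)) (0, lift_h T1)) = 0.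
Proof.
have altp := pi_alt_map; have altT := alt_map_lift_h T_alt_map.
have altB : alt_map 2 (NR (1, pi) (0, lift_h T1)).
  exact: (NR_alt_map (p := 1) (q := 0) altp altT).
have altBT : alt_map 2 (NR (1, NR (1, pi) (0, lift_h T1)) (0, lift_h T1)).
  exact: (NR_alt_map (p := 1) (q := 0) altB altT).
apply/funext => vs; have [sz2|sz_neq2] := eqVneq (size vs) 2; last first.
  by apply: (alt_map_size (alt_map_proj_h altBT)); case: (size vs) sz_neq2 => [|[|[|n]]].
have BE w1 w2 : NR (1, pi) (0, lift_h T1) [:: w1; w2] =
    (mu (T w1.2) w2.1 - mu (T w2.2) w1.1 - T (rho w1.1 w2.2 - rho w2.1 w1.2),
     rho (T w1.2) w2.2 - rho (T w2.2) w1.2).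
  rewrite (NRE (p := 1) (q := 0)) // mulr0 expr0z scale1r !fctE /nr_comp /=.
  rewrite !lift_TE !pi_cochainE !wdegE !mulr0 !expr0z !scale1r !scaler0 !addr0 !add0r.
  rewrite mul1r expr1z scaleN1r /=.
  by apply: eq_pair12; rewrite /= ?T0 ?rho0r ?subr0 ?oppr0 ?addr0.
have B1 w : NR (1, pi) (0, lift_h T1) [:: w] = 0 by exact: (alt_map_size altB).
have B3 w1 w2 w3 : NR (1, pi) (0, lift_h T1) [:: w1; w2; w3] = 0.
  exact: (alt_map_size altB).
case: vs sz2 => [|v1 [|v2 [|? ?]]] //= _.
rewrite /proj_h (NRE (p := 1) (q := 0)) // mulr0 expr0z scale1r !fctE.
have lTE := lift_TE; move: (NR _ _) BE B1 B3 => B BE B1 B3.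
move: (lift_h T1) lTE {altT altB altBT} => lT lTE; rewrite /nr_comp /=.
rewrite !lTE !BE ?B1 ?B3 /= !wdegE !mulr0 !expr0z !scale1r !scaler0 !addr0 !add0r.
rewrite mul1r expr1z scaleN1r /= ?T0 !mu0r !rho0l.
by rewrite !mu_TT !TB ?rho0r ?T0; zmod.
Qed.

End RelativeRotaBaxter.

(** * Transfer of L-infinity structures and the extension *)

Section Transfer.
Variable K : fieldType.

Lemma degree_map (E F : higher_ops K) (f : int * E -> F) s :
  degree [seq (p.1, f p) | p <- s] = degree s.
Proof. exact: big_map. Qed.

Lemma shuffle_Linfty_pullback (A E : higher_ops K) (f : A -> E) :
  shuffle_Linfty E -> ho_op ([::] : seq (int * A)) = 0 ->
  injective f -> (forall a x y, f (a *: x + y) = a *: f x + f y) ->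
  (forall i x, gv_deg i (f x) <-> gv_deg i x) ->
  (forall s : seq (int * A), s != [::] -> homog s ->
    f (ho_op s) = ho_op [seq (p.1, f p.2) | p <- s]) ->
  shuffle_Linfty A.
Proof.
move=> [dE lE sE jE E0] A0 f_inj lin_f df op_f.
have f0 : f 0 = 0 by have := lin_f (-1) 0 0; rewrite scaler0 addr0 scaleN1r addNr.
have fZ a x : f (a *: x) = a *: f x by rewrite -[a *: x]addr0 lin_f f0 addr0.
have {}op_f s : homog s -> f (ho_op s) = ho_op [seq (p.1, f p.2) | p <- s].
  by case: s => [|x s] hs; [rewrite A0 f0 E0|apply: op_f].
have hf (s : seq (int * A)) : homog s -> homog [seq (p.1, f p.2) | p <- s].
  by move=> hs _ /mapP[p /hs dp ->] /=; apply: (df _ _).2.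
have dA (s : seq (int * A)) : homog s -> gv_deg (degree s + 1) (ho_op s).
  by move=> hs; apply: (df _ _).1; rewrite op_f // -(degree_map (fun p => f p.2));
    apply/dE/hf.
split=> //.
- move=> s1 s2 d a x y h1 h2 dx dy; apply: f_inj.
  have dxy : gv_deg d (a *: x + y) by apply: gv_degL.
  rewrite lin_f !op_f; do ?exact: homog_insert.
  by rewrite !map_cat /= lin_f lE //; [exact: hf..| |]; apply: (df _ _).2.
- move=> s1 x y s2 hs; apply: f_inj; rewrite fZ !op_f //.
    by rewrite !map_cat /= sE // -map_cons -map_cons -map_cat; apply: hf.
  exact: goods_swap.
move=> s hs; apply: f_inj; rewrite f0 (linear_shsum _ _ _ lin_f) -[RHS](jE _ (hf _ hs)).
rewrite (shsum_map _ (dX := fst)) //; apply: eq_shsum_perm => u v uvs.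
have [hu hv] := goods_split uvs hs.
rewrite op_f /= ?degree_map ?op_f //.
by apply: (goods_cons (good := fun p : int * A => gv_deg p.1 p.2)) => //; apply: dA.
Qed.

(** Words are lifted letter by letter along the section [h]; each identity holds for the lifted word
    and is pushed forward by [f]. *)
Lemma shuffle_Linfty_pushforward (E B : higher_ops K) (f : int -> E -> B)
    (h : int -> B -> E) :
  shuffle_Linfty E -> ho_op ([::] : seq (int * B)) = 0 ->
  strict_morphism f ->
  (forall i z, gv_deg i z -> gv_deg i (h i z) /\ f i (h i z) = z) ->
  shuffle_Linfty B.
Proof.
move=> [dE lE sE jE E0] B0 [lin_f df op_f] hP.
have f0 i : f i 0 = 0.
  by have := lin_f i (-1) 0 0 (gv_deg0 _ _) (gv_deg0 _ _);
    rewrite scaler0 addr0 scaleN1r addNr.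
have fZ i a x : gv_deg i x -> f i (a *: x) = a *: f i x.
  by move=> dx; rewrite -[a *: x]addr0 lin_f ?f0 ?addr0 //; apply: gv_deg0.
have {}op_f s : homog s -> f (degree s + 1) (ho_op s) = ho_op [seq (p.1,
  f p.1 p.2) | p <- s].
  by case: s => [|x s] hs; [rewrite B0 E0 f0|apply: op_f].
pose lift (s : seq (int * B)) : seq (int * E) := [seq (p.1, h p.1 p.2) | p <- s].
have hl (s : seq (int * B)) : homog s -> homog (lift s).
  by move=> hs _ /mapP[p /hs/hP[dp _] ->].
have liftK (s : seq (int * B)) : homog s -> [seq (p.1, f p.1 p.2) | p <- lift s] = s.
  move=> hs; rewrite -map_comp -[RHS]map_id; apply/eq_in_map => p /hs/hP[_ /=] ->.
  by case: p.
have dl s : degree (lift s) = degree s by exact: degree_map.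
have dB (s : seq (int * B)) : homog s -> gv_deg (degree s + 1) (ho_op s).
  by move=> hs; rewrite -{2}(liftK _ hs) -op_f ?dl; do ?[apply: df; rewrite -dl;
    apply: dE]; apply: hl.
split=> //.
- move=> s1 s2 d a x y h1 h2 dx dy.
  have [dhx fhx] := hP _ _ dx; have [dhy fhy] := hP _ _ dy.
  (* A combination of letters is lifted to the combination of their lifts, where linearity of [f]
     applies. *)
  have dhxy : gv_deg d (a *: h d x + h d y) by apply: gv_degL.
  have opE e : gv_deg d e -> ho_op (s1 ++ (d, f d e) :: s2) =
      f (degree (s1 ++ (d, x) :: s2) + 1) (ho_op (lift s1 ++ (d, e) :: lift s2)).
    move=> de.
    have -> : degree (s1 ++ (d, x) :: s2) = degree (lift s1 ++ (d, e) :: lift s2).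
      by rewrite /degree !big_cat !big_cons /= -/(degree (lift s1)) -/(degree (lift
        s2)) !dl.
    by rewrite op_f ?map_cat /= ?liftK //; apply: homog_insert => //; apply: hl.
  have dop e : gv_deg d e -> gv_deg (degree (s1 ++ (d,
    x) :: s2) + 1) (ho_op (lift s1 ++ (d, e) :: lift s2)).
    move=> de.
    have -> : degree (s1 ++ (d, x) :: s2) = degree (lift s1 ++ (d, e) :: lift s2).
      by rewrite /degree !big_cat !big_cons /= -/(degree (lift s1)) -/(degree (lift
        s2)) !dl.
    by apply: dE; apply: homog_insert => //; apply: hl.
  rewrite -{1}fhx -{1}fhy -lin_f // opE // lE //; do ?exact: hl.
  rewrite lin_f; do ?exact: dop.
  by rewrite -!opE // fhx fhy.
- move=> s1 x y s2 hs.
  have hs' : homog (s1 ++ y :: x :: s2) := goods_swap hs.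
  have degE : degree (lift (s1 ++ y :: x :: s2)) = degree (lift (s1 ++ x :: y :: s2)).
    by rewrite !dl /degree !big_cat !big_cons /= [y.1 + _]addrCA.
  rewrite -[in LHS](liftK _ hs) -[in RHS](liftK _ hs') -!op_f; do ?exact: hl.
  rewrite degE -fZ; last by rewrite -degE; apply: dE; apply: hl.
  congr (f _ _); have := hl _ hs; rewrite /lift !map_cat /= => hls.
  by rewrite sE.
move=> s hs; rewrite -(liftK _ hs) (shsum_map _ (dX := fst)) //.
rewrite -[RHS](f0 (degree s + 1 + 1)) -[in RHS](jE _ (hl _ hs)).
rewrite (@linear_shsum_in _ _ _ _ _ (gv_deg (degree s + 1 + 1))).
- apply: eq_shsum_perm => u v uvs; have [hu hv] := goods_split uvs (hl _ hs).
  have -> : degree s + 1 + 1 = degree ((degree u + 1, ho_op u) :: v) + 1.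
    rewrite -dl /degree -(perm_big _ uvs) big_cons big_cat /=.
    by rewrite -/(degree u) -/(degree v); ring.
  have dm : degree [seq (p.1, f p.1 p.2) | p <- u] = degree u by exact: big_map.
  rewrite [RHS]op_f /= ?(op_f u hu) ?dm //.
  by apply: (goods_cons (good := fun p : int * E => gv_deg p.1 p.2)) => //; apply: dE.
- by move=> a x y; apply: gv_degL.
- exact: gv_deg0.
- exact: lin_f.
move=> u v uvs; have [hu hv] := goods_split uvs (hl _ hs).
have -> : degree s + 1 + 1 = degree ((degree u + 1, ho_op u) :: v) + 1.
  rewrite -dl /degree -(perm_big _ uvs) big_cons big_cat /=.
  by rewrite -/(degree u) -/(degree v); ring.
by apply: (dE); apply: (goods_cons (good := fun p : int * E => gv_deg p.1 p.2)) => //;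
  apply: dE.
Qed.

End Transfer.

(** * The twisted operations *)

Section TwistedMiddle.
Variables (K : fieldType) (g V : lmodType K).
Hypothesis K0 : [pchar K] =i pred0.
Local Notation W := (g * V)%type.
Local Notation cochains := (seq W -> W).
Local Notation letter := (int * (cochains * (seq V -> g)))%type.
Local Notation good_letter := (@good_letter K g V).
Local Notation good s := {in s, forall x, good_letter x}.
Local Notation Br := (@bracket_word K g V).
Implicit Types (x y z : letter) (s u v : seq letter).

Theorem middle_shuffle_Linfty : shuffle_Linfty (middle g V).
Proof.
split=> //.
- by move=> s gs; apply: middle_op_deg.
- by move=> s1 s2 d a x y; apply: middle_op_linear.
- exact: middle_op_symm.
move=> s gs; apply: eq_pair12.
  rewrite (@linear_shsum _ _ _ _ _ (@fst _ _)) //; exact: middle_jacobi1.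
rewrite (@linear_shsum _ _ _ _ _ (@snd _ _)) //; exact: middle_jacobi2.
Qed.

(** The cochain starts with weight [x.1 + 1] and loses 1 with each letter; only weight -1 survives
    the projection. *)
Lemma proj_Br_size x v : good_letter x -> good v -> (size v)%:Z != x.1 + 1 + 1 ->
  proj_h (Br (x.1 + 1) x.2.1 v) = 0.
Proof.
move=> gx gv szv; apply: (proj_weight K0) (weight_Br K0 (good_cochain K0 gx) gv
  (good_weight K0 gx)).
by apply: contra_neq szv => /eqP; rewrite subr_eq => /eqP->; rewrite addrC addNKr.
Qed.

Lemma middle_op2_0 s : good s ->
  (forall x v, perm_eq (x :: v) s -> proj_h (Br (x.1 + 1) x.2.1 v) = 0) ->
  (middle_op s).2 = 0.
Proof.
move=> gs Br0s; rewrite middle_op2E //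
  -[RHS](shsum0 (@fst int (cochains * (seq V -> g))) _ s).
by apply: eq_shsum_perm => -[|x [|y u]] v // xv; apply: Br0s.
Qed.

Variables (mu : g -> g -> g) (rho : g -> V -> V) (T : V -> g).
Hypothesis hT : relative_RB_Lie_algebra mu rho T.
Local Notation pi := (pi_cochain mu rho).
Local Notation alpha := ((pi, one_cochain T) : middle g V).
Local Notation a := ((0, alpha) : int * middle g V).

Lemma alpha_deg : @gv_deg K (middle g V) 0 alpha.
Proof. by split; [apply: (pi_bidegree K0 hT)|apply: (T_alt_map hT)]. Qed.

(** A surviving term has [size v = x.1 + 2], hence n is at most [x.1 + 3]; this gives the constant
    4, which also rules out the two-letter words of the first component. *)
Lemma middle_bounded (s : seq (int * middle g V)) n : homog s ->
  (4 + abs_deg s <= n)%N -> middle_op (nseq n a ++ s) = 0.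
Proof.
move=> hs le_n; have gw : good (nseq n a ++ s) := homog_nseq alpha_deg hs.
apply: eq_pair12.
  by case: n le_n {gw} => [|[|[|n]]].
apply: middle_op2_0 => // x v xv.
have [gx gv] := goods_split (u := [:: x]) xv gw.
apply: proj_Br_size => //; first exact: goods_head gx.
have szv : (size v).+1 = (n + size s)%N.
  by rewrite -[LHS]/(size (x :: v)) (perm_size xv) size_cat size_nseq.
have le_x : (`|x.1| <= abs_deg s)%N.
  have : x \in nseq n a ++ s by rewrite -(perm_mem xv) mem_head.
  rewrite mem_cat mem_nseq => /orP[/andP[_ /eqP->] //|xs].
  by rewrite /abs_deg (big_rem _ xs) /= leq_addr.
by apply/eqP => szE; move: le_n szv le_x szE;
  move: (abs_deg s) (x.1) (size v) (size s) => b d i j; lia.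
Qed.

Local Notation tw := (@ho_op K (twist alpha)).

(** Serves for the two components of a twisted operation: length (first component) or weight
    (second) leaves at most one number of copies of [alpha]. *)
Lemma twist_single (M : lmodType K) (f : middle g V -> M) (s : seq (int * middle g V)) n0 :
  (forall c e e', f (c *: e + e') = c *: f e + f e') -> homog s ->
  (forall n, n != n0 -> f (middle_op (nseq n a ++ s)) = 0) ->
  f (tw s) = (n0`!%:R)^-1 *: f (middle_op (nseq n0 a ++ s)).
Proof.
move=> lin_f hs f_n.
have f0 : f 0 = 0 by have := lin_f (-1) 0 0; rewrite scaler0 addr0 scaleN1r addNr.
have f_sum n (F : nat -> middle g V) (c : nat -> K) :
    f (\sum_(i < n) c i *: F i) = \sum_(i < n) c i *: f (F i).
  by elim/big_rec2: _ => [|i e e' _ <-]; rewrite ?f0 ?lin_f.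
pose N := (4 + abs_deg s + n0.+1)%N.
rewrite (@twistE _ _ _ 4 middle_bounded N) // ?leq_addr //.
rewrite (f_sum N (fun n => middle_op (nseq n a ++ s)) (fun n => (n`!%:R)^-1)).
have lt_n0N : (n0 < N)%N by rewrite /N; lia.
rewrite (bigD1 (Ordinal lt_n0N)) //= big1 ?addr0 // => n n_neq.
by rewrite [f _]f_n ?scaler0.
Qed.

(** Two terms survive: two copies in the first component, giving [pi, pi], and three in the second,
    since pi has weight 1 and takes two letters from h. *)
Lemma twist_nil : tw [::] = 0.
Proof.
have ga n : good (nseq n a ++ [::]) by apply: (homog_nseq alpha_deg).
have altp := pi_alt_map hT.
apply: eq_pair12.
  rewrite (@twist_single _ (@fst _ _) _ 2) //.
    by rewrite /= (_ : NR _ _ = 0) ?scaler0 //; apply: (NR_pi_pi hT).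
  by move=> [|[|[|n]]].
rewrite (@twist_single _ (@snd _ _) _ 3) //.
  rewrite [(_).2]middle_op2_0 ?scaler0 // => x v xv.
  (* All three letters are equal, so every choice of the acting letter gives the projection of
     [[pi, T], T]. *)
  have xa : x = a.
    have : x \in nseq 3 a by rewrite -[nseq 3 a]cats0 -(perm_mem xv) mem_head.
    by rewrite mem_nseq => /eqP.
  move: xv; rewrite xa -[_ ++ _]/(a :: [:: a; a]) perm_cons => va.
  have : all (pred1 a) v by rewrite (perm_all _ va) /= eqxx.
  move/all_pred1P; rewrite (perm_size va) => -> /=.
  exact: (proj_NR_pi_T_T hT).
move=> n n3; apply: middle_op2_0 => // x v xv.
have [gx gv] := goods_split (u := [:: x]) xv (ga n).
apply: proj_Br_size => //; first exact: goods_head gx.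
have -> : x.1 = 0.
  have : x \in nseq n a ++ [::] by rewrite -(perm_mem xv) mem_head.
  by rewrite cats0 mem_nseq => /andP[_ /eqP->].
have := perm_size xv; rewrite size_cat size_nseq addn0 /= => szv.
by move: n3; rewrite -szv; case: (size v) => [|[|[|m]]].
Qed.

Lemma twisted_shuffle_Linfty : shuffle_Linfty (twisted_middle mu rho T).
Proof.
exact: (twist_Linfty K0 middle_shuffle_Linfty alpha_deg middle_bounded twist_nil).
Qed.

Lemma twist_fst1 d (e : middle g V) : gv_deg d e ->
  (tw [:: (d, e)]).1 = - NR (1, pi) (d + 1, e.1).
Proof.
move=> de; rewrite (@twist_single _ (@fst _ _) _ 1) //.
- by rewrite invr1 scale1r /= add0r expr1z scaleN1r.
- exact: goods1.
- by move=> [|[|[|n]]].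
Qed.

Lemma twist_fst2 (x y : int * middle g V) : homog [:: x; y] ->
  (tw [:: x; y]).1 = (-1) ^ (x.1 + 1) *: NR (x.1 + 1, x.2.1) (y.1 + 1, y.2.1).
Proof.
move=> hs; rewrite (@twist_single _ (@fst _ _) _ 0) //.
  by rewrite invr1 scale1r.
by move=> [|[|[|n]]].
Qed.

Lemma twist_fst3 (x y z : int * middle g V) s : homog [:: x, y, z & s] ->
  (tw [:: x, y, z & s]).1 = 0.
Proof.
move=> hs; rewrite (@twist_single _ (@fst _ _) _ 0) ?scaler0 //.
by move=> [|[|[|n]]].
Qed.

(** On a word from h only the copies of pi can act, and pi takes exactly two letters. This forces
    total length 3: two copies of [alpha] for l_1, one for l_2, none for longer words. *)
Lemma middle_op2_in_h n (s : seq letter) : homog (E := middle g V) s ->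
  {in s, forall x, x.2.1 = 0} -> ((0 < n)%N -> (n + size s != 3)%N) -> (middle_op (nseq
    n a ++ s)).2 = 0.
Proof.
move=> hs s0 nsz; have gw : good (nseq n a ++ s) := homog_nseq alpha_deg hs.
apply: middle_op2_0 => // x v xv.
have [gx gv] := goods_split (u := [:: x]) xv gw.
have : x \in nseq n a ++ s by rewrite -(perm_mem xv) mem_head.
rewrite mem_cat mem_nseq => /orP[/andP[/nsz{}nsz /eqP xa]|/s0->]; last first.
  by rewrite Br0.
apply: proj_Br_size => //; first exact: goods_head gx.
rewrite xa /=; apply: contra_neq nsz => -[szv].
by rewrite -(size_nseq n a) -size_cat -(perm_size xv) /= szv.
Qed.

Lemma twist_snd1 (x : letter) : good_letter x -> x.2.1 = 0 ->
  (tw [:: x]).2 = proj_h (Br 1 pi [:: a; x]).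
Proof.
move=> gx x0; have hx : homog (E := middle g V) [:: x] by apply: goods1.
have gax : good [:: a; a; x] := @homog_nseq _ _ _ alpha_deg 2 _ hx.
rewrite (@twist_single _ (@snd _ _) _ 2) //; last first.
  move=> n n2; apply: middle_op2_in_h => // [y|_]; last by rewrite addn1 eqSS.
  by rewrite inE => /eqP->.
rewrite [(_).2](middle_op2E K0 gax) /= !wdegE !mulr0 !mul0r !expr0z !scaler0 !scale1r
  !addr0 !add0r.
rewrite x0 Br0 ?proj_h0 ?addr0; last exact: (goods_catl (s := [:: a; a]) (t := [:: x]) gax).
(* Either copy of [alpha] may supply pi; the two equal terms cancel the factor 1/2!. *)
by rewrite -mulr2n -scaler_nat scalerA mulVf ?scale1r //; apply: (natr_neq0 K0 1).
Qed.

Lemma twist_snd2 (x y : letter) : good_letter x -> good_letter y ->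
  x.2.1 = 0 -> y.2.1 = 0 -> (tw [:: x; y]).2 = proj_h (Br 1 pi [:: x; y]).
Proof.
move=> gx gy x0 y0.
have hxy : homog (E := middle g V) [:: x; y] by apply: goods_cons => //; apply: goods1.
have gax : good [:: a; x; y] := @homog_nseq _ _ _ alpha_deg 1 _ hxy.
rewrite (@twist_single _ (@snd _ _) _ 1) //; last first.
  move=> n n1; apply: middle_op2_in_h => // [z|_]; last by rewrite addn2 !eqSS.
  by rewrite !inE => /orP[] /eqP->.
have ga := goods_catl (s := [:: a]) (t := [:: x; y]) gax.
rewrite [(_).2](middle_op2E K0 gax) /= x0 y0 !Br0 ?proj_h0 ?scaler0 ?addr0.
- by rewrite !add0r !wdegE !mulr0 expr0z !scale1r invr1 scale1r.
- by apply: goods_cat ga _; apply: goods1.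
- by apply: goods_cat ga _; apply: goods1.
Qed.

Lemma twist_snd3 (x y z : letter) s : good [:: x, y, z & s] ->
  {in [:: x, y, z & s], forall w, w.2.1 = 0} -> (tw [:: x, y, z & s]).2 = 0.
Proof.
move=> gs s0; rewrite (@twist_single _ (@snd _ _) _ 0) //.
  by rewrite [X in _ *: X](@middle_op2_in_h 0) ?scaler0.
by move=> [|n] // _; apply: middle_op2_in_h => // _; rewrite /= addSn !addnS.
Qed.

Lemma HomVg_deg i (theta : seq V -> g) :
  @gv_deg K (desusp (HomVg g V)) i theta = @gv_deg K (hspace g V) i theta.
Proof. by rewrite /= /ge_deg -{1}[1]add0r lerD2r. Qed.

Lemma in_h_good (i : int) (theta : seq V -> g) :
  @gv_deg K (desusp (HomVg g V)) i theta -> good_letter (i, (0, theta)).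
Proof. by rewrite HomVg_deg => dtheta; split=> //; apply: gv_deg0. Qed.

Lemma iota_op (s : seq (int * RB_ops_opp mu rho T)) : s != [::] -> homog s ->
  (0, ho_op s) = tw [seq (p.1, (0, p.2)) | p <- s].
Proof.
have hl (t : seq (int * RB_ops_opp mu rho T)) : homog t -> good [seq (p.1, (0,
  p.2)) | p <- t].
  by move=> ht _ /mapP[p /ht/in_h_good ? ->].
have l0 (t : seq (int * RB_ops_opp mu rho T)) :
    {in [seq (p.1, (0, p.2)) | p <- t], forall w : letter, w.2.1 = 0}.
  by move=> _ /mapP[p _ ->].
have altp := pi_alt_map hT.
case: s => [//|x [|y [|z s]]] _ hs; have gs := hl _ hs; apply: eq_pair12.
- rewrite [RHS]twist_fst1; last exact: goods_head gs.
  by rewrite (@NR0r _ _ _ 1) // oppr0.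
- rewrite [RHS]twist_snd1 //; last exact: goods_head gs.
  by rewrite /= /d_T /RB_bracket /= subrr expr0z scale1r /NRd /= addrK.
- by rewrite [RHS]twist_fst2 //= NR0l ?scaler0 //; apply: alt_map0.
- rewrite [RHS]twist_snd2 //; [|exact: goods_head gs|exact: goods_head (goods_behead gs)].
  (* With n = x.1 + 1, the signs (-1)^n of the desuspension and (-1)^(n - 1) of the bracket multiply
     to -1, which the sign of the opposite bracket cancels. *)
  rewrite /= /RB_bracket /= !addrK scalerN scalerA -scaleNr /Br /= [_ * _](_ : _ = -1);
    last by signs.
  by rewrite opprK scale1r.
- by rewrite [RHS]twist_fst3.
- by rewrite [RHS]twist_snd3 //; apply: (l0 (_ :: _ :: _ :: _)).
Qed.

End TwistedMiddle.

Lemma ho_opN (K : fieldType) (E : higher_ops K) (s1 s2 : seq (int * E)) d (e : E) :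
  shuffle_Linfty E -> homog s1 -> homog s2 -> gv_deg d e ->
  ho_op (s1 ++ (d, - e) :: s2) = - ho_op (s1 ++ (d, e) :: s2).
Proof.
move=> LE h1 h2 de; have [_ lE _ _ _] := LE.
have := lE s1 s2 d (-1) e 0 h1 h2 de (gv_deg0 _ _).
by rewrite (ho_op_letter0 _ LE h1 h2) !addr0 !scaleN1r.
Qed.

(** * The two strict extensions *)

Section Extension.
Variables (K : fieldType) (g V : lmodType K).
Hypothesis K0 : [pchar K] =i pred0.
Variables (mu : g -> g -> g) (rho : g -> V -> V) (T : V -> g).
Hypothesis hT : relative_RB_Lie_algebra mu rho T.
Local Notation pi := (pi_cochain mu rho).
Local Notation E := (twisted_middle mu rho T).

Let LE : shuffle_Linfty E := twisted_shuffle_Linfty K0 hT.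

Lemma in_h_deg i (theta : seq V -> g) :
  gv_deg i ((0, theta) : E) <-> @gv_deg K (desusp (HomVg g V)) i theta.
Proof. by rewrite HomVg_deg; split=> [[]|] // dtheta; split=> //; apply: gv_deg0. Qed.

Lemma in_h_degN i (theta : seq V -> g) :
  gv_deg i ((0, - theta) : E) <-> @gv_deg K (desusp (HomVg g V)) i theta.
Proof.
have N (t : desusp (HomVg g V)) : gv_deg i t -> gv_deg i (- t).
  by move=> dt; rewrite -scaleN1r; apply: gv_degZ.
by split=> [/in_h_deg/N|/N dtheta]; [rewrite opprK|apply/in_h_deg].
Qed.

(** Negating every letter multiplies l_k by (-1)^k. Hence l_1 still matches d_T, while on two
    letters the signs cancel and the opposite bracket becomes the original one under the outer
    minus. *)
Lemma iota_opp_op (s : seq (int * RB_ops mu rho T)) : s != [::] -> homog s ->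
  ((0, - ho_op s) : E) = ho_op [seq (p.1, (0, - p.2) : E) | p <- s].
Proof.
move=> s_neq0 hs.
have eqN (theta : seq V -> g) : ((0, - theta) : E) = - ((0, theta) : E).
  by apply: eq_pair12; rewrite /= ?oppr0.
have io (t : seq (int * RB_ops mu rho T)) : t != [::] -> homog t -> ho_op [seq (p.1,
  (0, p.2) : E) | p <- t] = (0, ho_op (h := RB_ops_opp mu rho T) t).
  by move=> t0 ht; rewrite (iota_op K0 hT).
have hl (t : seq (int * RB_ops mu rho T)) : homog t -> homog [seq (p.1, (0,
  p.2) : E) | p <- t].
  by move=> ht _ /mapP[p /ht /in_h_deg ? ->].
case: s s_neq0 hs => [//|x [|y [|z s]]] _ hs; have gs := hl _ hs.
- have gx := goods_head gs; have h0 : homog ([::] : seq (int * E)) by [].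
  rewrite -[RHS]/(ho_op ([::] ++ [:: (x.1, (0, - x.2) : E)])) eqN [in RHS]eqN.
  rewrite (ho_opN LE h0 h0 gx); congr (- _).
  by rewrite -[RHS]/(ho_op [seq (p.1, (0, p.2) : E) | p <- [:: x]]) io.
- have gx := goods_head gs; have gy := goods_head (goods_behead gs).
  have h0 : homog ([::] : seq (int * E)) by [].
  have hy : homog [:: (y.1, (0, y.2) : E)] by apply: goods1.
  have hxN : homog [:: (x.1, - ((0, x.2) : E))].
    by apply: goods1; rewrite -eqN; apply/in_h_degN/in_h_deg.
  rewrite -[RHS]/(ho_op ([:: (x.1, (0, - x.2) : E)] ++ [:: (y.1, (0, - y.2) : E)])).
  rewrite [in RHS]eqN [in RHS]eqN (ho_opN LE hxN h0 gy) (ho_opN (s1 :=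
    [::]) LE h0 hy gx) opprK.
  rewrite -[RHS]/(ho_op [seq (p.1, (0, p.2) : E) | p <- [:: x; y]]) io //.
  by rewrite /= scalerN.
have gs' : homog [seq (p.1, (0, - p.2) : E) | p <- [:: x, y, z & s]].
  by move=> _ /mapP[p /hs /in_h_degN ? ->].
apply: eq_pair12.
  by rewrite [RHS](twist_fst3 K0 hT).
rewrite [RHS](twist_snd3 K0 hT) //= ?oppr0 //.
by move=> _ /(mapP (s := [:: x, y, z & s]))[p _ ->].
Qed.

Lemma strict_iota_opp : @strict_morphism K (RB_ops_opp mu rho T) E (fun _ theta =>
  (0, theta)).
Proof.
split=> [i a x y _ _|i x /in_h_deg //|s s0 hs]; last exact: iota_op.
by apply: eq_pair12; rewrite /= ?scaler0 ?addr0.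
Qed.

Lemma strict_iota : @strict_morphism K (RB_ops mu rho T) E (fun _ theta => (0, - theta)).
Proof.
split=> [i a x y _ _|i x /in_h_degN //|s s0 hs]; last exact: iota_opp_op.
by apply: eq_pair12; rewrite /= ?scaler0 ?addr0 // opprD scalerN.
Qed.

Lemma Linfty_RB_opp : shuffle_Linfty (RB_ops_opp mu rho T).
Proof.
apply: (@shuffle_Linfty_pullback K (RB_ops_opp mu rho T) E (fun theta =>
  (0, theta)) LE) => //.
- by move=> x y [].
- by move=> a x y; apply: eq_pair12; rewrite /= ?scaler0 ?addr0.
- exact: in_h_deg.
- exact: iota_op.
Qed.

Lemma Linfty_RB : shuffle_Linfty (RB_ops mu rho T).
Proof.
apply: (@shuffle_Linfty_pullback K (RB_ops mu rho T) E (fun theta =>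
  (0, - theta)) LE) => //.
- by move=> x y [/oppr_inj].
- by move=> a x y; apply: eq_pair12; rewrite /= ?scaler0 ?addr0 // opprD scalerN.
- exact: in_h_degN.
- exact: iota_opp_op.
Qed.

Lemma strict_p_opp : @strict_morphism K E (pair_ops_opp mu rho) (fun _ x => x.1).
Proof.
split=> [//|i x [] //|s s0 hs]; case: s s0 hs => [|[d e] [|y [|z s]]] // _ hs.
- by rewrite [LHS](twist_fst1 K0 hT) //; exact: (goods_head hs).
- by rewrite [LHS](twist_fst2 K0 hT).
- by rewrite [LHS](twist_fst3 K0 hT).
Qed.

Lemma NRZl p q a (P Q : seq (g * V) -> g * V) :
  alt_map (p + 1) P -> alt_map (q + 1) Q ->
  NR (p, a *: P) (q, Q) = a *: NR (p, P) (q, Q).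
Proof.
move=> altP altQ; have := NRPl a altP (@alt_map0 K _ _ (p + 1)) altQ.
by rewrite !addr0 NR0l // addr0.
Qed.

Lemma NRZr p q a (P Q : seq (g * V) -> g * V) :
  alt_map (p + 1) P -> alt_map (q + 1) Q ->
  NR (p, P) (q, a *: Q) = a *: NR (p, P) (q, Q).
Proof.
move=> altP altQ; have := NRPr a altP altQ (@alt_map0 K _ _ (q + 1)).
by rewrite !addr0 NR0r // addr0.
Qed.

(** The exponent [i + 1] is the degree of f in L. Since d_pi raises this degree by one, the sign
    turns - d_pi into d_pi, and it is multiplicative on brackets. *)
Lemma strict_p : @strict_morphism K E (pair_ops mu rho) (fun i x => (-1) ^ (i + 1) *: x.1).
Proof.
have altZ n a (P : seq (g * V) -> g * V) : alt_map n P -> alt_map n (a *: P).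
  by move=> altP; rewrite -[_ *: _]addr0; apply: alt_mapL => //; apply: alt_map0.
split=> [i a x y _ _|i x [dx _]|s s0 hs].
- by rewrite /= scalerDr !scalerA mulrC.
- exact: (@gv_degZ K (desusp (Lprime g V))).
case: s s0 hs => [|[d e] [|[d' e'] [|z s]]] // _ hs.
- have ge := goods_head hs; rewrite [X in _ *: X](twist_fst1 K0 hT) //.
  rewrite /= /d_pi NRZr; [|exact: (pi_alt_map hT)|exact: (good_alt K0 ge)].
  rewrite scalerN -scaleNr; congr (_ *: _).
  by rewrite /degree big_seq1 /=; signs.
- have ge := goods_head hs; have ge' := goods_head (goods_behead hs).
  have alte := good_alt K0 ge; have alte' := good_alt K0 ge'.
  rewrite [X in _ *: X](twist_fst2 K0 hT) //= NRZl ?NRZr //; last exact: altZ.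
  rewrite !scalerA; congr (_ *: _).
  by rewrite /degree !big_cons big_nil /=; signs.
- by rewrite [X in _ *: X](twist_fst3 K0 hT) // scaler0.
Qed.

Lemma signZK i (M : lmodType K) (x : M) : (-1) ^ i *: ((-1) ^ i *: x) = x.
Proof. by rewrite scalerA -[RHS]scale1r; congr (_ *: _); signs. Qed.

Lemma Linfty_pair_opp : shuffle_Linfty (pair_ops_opp mu rho).
Proof.
apply: (@shuffle_Linfty_pushforward K E (pair_ops_opp mu rho) _ (fun _ z =>
  (z, 0)) LE _ strict_p_opp) => // i z dz.
by split=> //; split=> //; apply: gv_deg0.
Qed.

Lemma Linfty_pair : shuffle_Linfty (pair_ops mu rho).
Proof.
apply: (@shuffle_Linfty_pushforward K E (pair_ops mu rho) _ (fun i z =>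
  ((-1) ^ (i + 1) *: z, 0)) LE _ strict_p) => // i z dz.
split; last exact: signZK.
by split; [apply: (@gv_degZ K (desusp (Lprime g V)))|apply: gv_deg0].
Qed.

End Extension.

(** The inclusion theta |-> (0, theta) and the projection onto the first component are strict for
    the outer structures with adjusted signs. The second part keeps the original outer structures
    and puts the signs into the maps, through the isomorphisms theta |-> - theta and f |-> (-1)^|f|
    f. *)
Theorem theorem3p16 (K : fieldType) (K0 : [pchar K] =i pred0)
    (g V : lmodType K) (mu : g -> g -> g) (rho : g -> V -> V) (T : V -> g)
    (hT : relative_RB_Lie_algebra mu rho T) :
  strict_extension (A := RB_ops_opp mu rho T) (E := twisted_middle mu rho T)
    (B := pair_ops_opp mu rho)
    (fun _ theta => (0, theta)) (fun _ x => x.1)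
  /\
  strict_extension (A := RB_ops mu rho T) (E := twisted_middle mu rho T)
    (B := pair_ops mu rho)
    (fun _ theta => (0, - theta)) (fun i x => (-1) ^ (i + 1) *: x.1).
Proof.
have LE := shuffle_LinftyP (twisted_shuffle_Linfty K0 hT).
split; split.
- split=> //; apply: shuffle_LinftyP;
  [exact: (Linfty_RB_opp K0 hT)|exact: (Linfty_pair_opp K0 hT)].
- exact: (strict_iota_opp K0 hT).
- exact: (strict_p_opp K0 hT).
- move=> i; split=> [x y _ _ [] //|z dz|[P theta] dx].
    by exists (z, 0) => //; split=> //; apply: gv_deg0.
  split=> [/= P0|[y _ <-] //]; rewrite P0 in dx *.
  by exists theta => //; apply/(in_h_deg mu rho T).
- split=> //; apply: shuffle_LinftyP; [exact: (Linfty_RB K0 hT)|exact: (Linfty_pair K0 hT)].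
- exact: (strict_iota K0 hT).
- exact: (strict_p K0 hT).
- move=> i; split=> [x y _ _ [/oppr_inj] //|z dz|[P theta] dx].
    exists ((-1) ^ (i + 1) *: z, 0); last exact: signZK.
    by split; [apply: (@gv_degZ K (desusp (Lprime g V)))|apply: gv_deg0].
  split=> [/= P0|[y _ <-]]; last by rewrite /= scaler0.
  have {}P0 : P = 0 by rewrite -[P](signZK (i + 1)) P0 scaler0.
  rewrite P0 in dx *; exists (- theta); last by rewrite opprK.
  by apply/(in_h_degN mu rho T); rewrite opprK.
Qed.
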